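(* Let $M$ be a smooth manifold of dimension $n$ endowed with a conformal structure $CO(n-1,1)$ of Lorentzian signature $(n-1,1)$, and let $V^{n-1}\subset M$ be a lightlike hypersurface. Then $V^{n-1}$ carries a foliation formed by isotropic geodesics.
   Context: A $CO(n-1,1)$-structure on $M$ is the set of all pseudo-Riemannian metrics $\sigma g$ ($\sigma$ a smooth positive function on $M$) conformally equivalent to a fixed pseudo-Riemannian metric $g$ of signature $(n-1,1)$. The isotropic cone at $x\in M$ is $C_x=\{\xi\in T_x(M): g(\xi,\xi)=0\}$; it depends only on the conformal class. A lightlike hypersurface $V^{n-1}\subset M$ is a (smooth) hypersurface that is tangent to the isotropic cone $C_x$ at each point $x\in V^{n-1}$, i.e. $T_x(V^{n-1})$ is tangent to $C_x$ along a rectilinear generator of $C_x$ (equivalently, the restriction of $g$ to $T_x(V^{n-1})$ is degenerate). Geodesics are considered as unparametrized curves: a smooth regular curve $x(t)$ is a geodesic of a metric $g$ if $\nabla_{\dot x}\dot x=\varphi(t)\dot x$ for some function $\varphi$, with $\nabla$ the Levi-Civita connection of $g$. An isotropic geodesic on $M$ is a geodesic (of a metric in the conformal class) that is tangent to the isotropic cone $C_x$ at each of its points $x$; this notion does not depend on the choice of the metric in the conformal class. The foliation is by curves (one-dimensional leaves) lying in $V^{n-1}$. *)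

(* Defs.v *)
From HB Require Import structures.
From mathcomp Require Import all_boot all_order all_algebra.
From mathcomp Require Import all_classical all_reals all_analysis.
Set Implicit Arguments.
Unset Strict Implicit.
Unset Printing Implicit Defensive.
Import Order.TTheory GRing.Theory Num.Theory.
Import numFieldNormedType.Exports.
Local Open Scope classical_set_scope.
Local Open Scope ring_scope.

(* [Ck k U f]: for U open and E finite-dimensional this is the usual class C^k
   on U, since continuity of all directional derivatives implies Frechet
   differentiability. It is only used with E = R or E = 'rV[R]_n. *)
Fixpoint Ck (R : realType) (E F : normedModType R) (k : nat)
    (U : set E) (f : E -> F) : Prop :=
  (forall x, U x -> {for x, continuous f}) /\
  match k with
  | 0 => True
  | k'.+1 => forall v, (forall x, U x -> derivable f x v) /\ Ck k' U ('D_v f)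
  end.

Definition smooth_on (R : realType) (E F : normedModType R)
  (U : set E) (f : E -> F) := forall k, Ck k U f.

(* A chart is a homeomorphism [cmap] from the open set [cdom] onto an open set
   of R^n, with inverse [cinv]; both are total functions, meaningful only on
   [cdom] and [cmap @` cdom]. *)
Record chart (R : realType) (T : topologicalType) (n : nat) := Chart {
  cdom : set T;
  cmap : T -> 'rV[R]_n;
  cinv : 'rV[R]_n -> T;
  cdom_open : open cdom;
  cimg_open : open (cmap @` cdom);
  cmapK : forall x, cdom x -> cinv (cmap x) = x;
  cmap_continuous : forall x, cdom x -> {for x, continuous cmap};
  cinv_continuous :
    forall u, (cmap @` cdom) u -> {for u, continuous cinv} }.

Definition cimg (R : realType) (T : topologicalType) (n : nat)
  (c : chart R T n) : set 'rV[R]_n := cmap c @` cdom c.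

Definition transition (R : realType) (T : topologicalType) (n : nat)
  (c d : chart R T n) : 'rV[R]_n -> 'rV[R]_n := cmap d \o cinv c.

Definition compatible (R : realType) (T : topologicalType) (n : nat)
  (c d : chart R T n) :=
  smooth_on (cmap c @` (cdom c `&` cdom d)) (transition c d) /\
  smooth_on (cmap d @` (cdom c `&` cdom d)) (transition d c).

Record manifold (R : realType) (n : nat) := Manifold {
  mcarrier :> topologicalType;
  mhausdorff : hausdorff_space mcarrier;
  msecond_countable : @second_countable mcarrier;
  atlas : set (chart R mcarrier n);
  atlas_cover : forall x, exists2 c, atlas c & cdom c x;
  atlas_compatible : forall c d, atlas c -> atlas d -> compatible c d;
  atlas_maximal :
    forall c, (forall d, atlas d -> compatible c d) -> atlas c }.

Definition chart_at (R : realType) (n : nat) (M : manifold R n) (x : M)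
  (c : chart R M n) := atlas c /\ cdom c x.

Definition smooth_fun (R : realType) (n : nat) (M : manifold R n)
  (s : M -> R) :=
  forall c, atlas c -> smooth_on (cimg c) (s \o cinv c).

Definition smooth_map (R : realType) (m n : nat)
    (N : manifold R m) (M : manifold R n) (f : N -> M) :=
  continuous f /\
  forall b c, atlas b -> atlas c ->
    smooth_on (cmap b @` (cdom b `&` f @^-1` cdom c))
              (cmap c \o f \o cinv b).

(* Differential at p of f : N -> M, read in the charts b of N and c of M. *)
Definition differential (R : realType) (m n : nat)
    (N : manifold R m) (M : manifold R n) (f : N -> M)
    (b : chart R N m) (c : chart R M n) (p : N) (w : 'rV[R]_m) : 'rV[R]_n :=
  'D_w (cmap c \o f \o cinv b) (cmap b p).

(* A pseudo-Riemannian metric, given by its Gram matrix [gmx c x] in each chart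
   c around x. A tangent vector at x with components v in the chart c has
   components ['D_v (transition c d) (cmap c x)] in the chart d. *)
Record metric (R : realType) (n : nat) (M : manifold R n) := Metric {
  gmx : chart R M n -> M -> 'M[R]_n;
  gmx_sym : forall c x, chart_at x c -> (gmx c x)^T = gmx c x;
  gmx_unit : forall c x, chart_at x c -> gmx c x \in unitmx;
  gmx_smooth : forall c i j, atlas c ->
    smooth_on (cimg c) (fun u => gmx c (cinv c u) i j : R);
  gmx_transition : forall c d x v w, chart_at x c -> chart_at x d ->
    v *m gmx c x *m w^T =
    'D_v (transition c d) (cmap c x) *m gmx d x
      *m ('D_w (transition c d) (cmap c x))^T }.

Definition gform (R : realType) (n : nat) (M : manifold R n) (g : metric M)
    (c : chart R M n) (x : M) (v w : 'rV[R]_n) : R :=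
  (v *m gmx g c x *m w^T) 0 0.

(* Signature (n, 1) in dimension n + 1, by Sylvester's normal form. *)
Definition lorentzian (R : realType) (n : nat) (M : manifold R n.+1)
    (g : metric M) :=
  forall c x, chart_at x c ->
    exists2 P : 'M[R]_n.+1, P \in unitmx &
      P *m gmx g c x *m P^T
      = diag_mx (\row_i (if i == ord_max then -1 else 1)).

Definition conformal (R : realType) (n : nat) (M : manifold R n)
    (g h : metric M) :=
  exists s : M -> R, [/\ smooth_fun s, forall x, 0 < s x &
    forall c x, chart_at x c -> gmx h c x = s x *: gmx g c x].

Record CO_structure (R : realType) (n : nat) (M : manifold R n.+1) := COStructure {
  CO_metrics : set (metric M);
  CO_class : exists2 g, lorentzian g &
    forall h, CO_metrics h <-> conformal g h }.

Definition isotropic_cone (R : realType) (n : nat) (M : manifold R n)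
    (g : metric M) (c : chart R M n) (x : M) : set 'rV[R]_n :=
  [set v | gform g c x v v = 0].

(* Tangent hyperplane of the isotropic cone along the generator spanned by xi:
   the kernel of the differential at xi of the quadratic form. *)
Definition cone_tangent (R : realType) (n : nat) (M : manifold R n)
    (g : metric M) (c : chart R M n) (x : M) (xi : 'rV[R]_n) : set 'rV[R]_n :=
  [set v | 'D_v (fun z : 'rV[R]_n => gform g c x z z) xi = 0].

(* A hypersurface is the image of an injective immersion of a manifold of
   one dimension less; embedded hypersurfaces are a particular case. *)
Definition hypersurface (R : realType) (n : nat)
    (V : manifold R n) (M : manifold R n.+1) (iota : V -> M) :=
  [/\ smooth_map iota, injective iota &
      forall p b c, chart_at p b -> chart_at (iota p) c ->
        injective (differential iota b c p)].

Definition lightlike (R : realType) (n : nat)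
    (V : manifold R n) (M : manifold R n.+1) (C : CO_structure M)
    (iota : V -> M) :=
  forall g p b c, CO_metrics C g -> chart_at p b -> chart_at (iota p) c ->
    exists xi, [/\ xi != 0, isotropic_cone g c (iota p) xi &
      range (differential iota b c p) = cone_tangent g c (iota p) xi].

Definition open_interval (R : realType) (I : set R) :=
  [/\ open I, is_interval I & I !=set0].

Definition smooth_curve (R : realType) (n : nat) (M : manifold R n)
    (I : set R) (x : R -> M) :=
  (forall t, I t -> {for t, continuous x}) /\
  forall c, atlas c -> smooth_on (I `&` x @^-1` cdom c) (cmap c \o x).

Definition velocity (R : realType) (n : nat) (M : manifold R n)
    (c : chart R M n) (x : R -> M) : R -> 'rV[R]_n := derive1 (cmap c \o x).

Definition regular_curve (R : realType) (n : nat) (M : manifold R n)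
    (I : set R) (x : R -> M) :=
  smooth_curve I x /\
  forall t c, I t -> chart_at (x t) c -> velocity c x t != 0.

Definition dgmx (R : realType) (n : nat) (M : manifold R n) (g : metric M)
    (c : chart R M n) (x : M) (l i j : 'I_n) : R :=
  'D_(delta_mx 0 l : 'rV[R]_n) (fun u => gmx g c (cinv c u) i j : R) (cmap c x).

(* Christoffel symbol Gamma^k_ij of the Levi-Civita connection of g. *)
Definition christoffel (R : realType) (n : nat) (M : manifold R n)
    (g : metric M) (c : chart R M n) (x : M) (k i j : 'I_n) : R :=
  2^-1 * \sum_l invmx (gmx g c x) k l *
    (dgmx g c x i j l + dgmx g c x j i l - dgmx g c x l i j).

(* Components in the chart c of the covariant derivative of x' along x. *)
Definition acceleration (R : realType) (n : nat) (M : manifold R n)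
    (g : metric M) (c : chart R M n) (x : R -> M) (t : R) : 'rV[R]_n :=
  derive1 (velocity c x) t +
  \row_k \sum_i \sum_j christoffel g c (x t) k i j *
    velocity c x t 0 i * velocity c x t 0 j.

Definition geodesic (R : realType) (n : nat) (M : manifold R n)
    (g : metric M) (I : set R) (x : R -> M) :=
  regular_curve I x /\
  exists phi : R -> R, forall t c, I t -> chart_at (x t) c ->
    acceleration g c x t = phi t *: velocity c x t.

Definition isotropic_geodesic (R : realType) (n : nat) (M : manifold R n.+1)
    (C : CO_structure M) (I : set R) (x : R -> M) :=
  exists2 g, CO_metrics C g & geodesic g I x /\
    forall t c, I t -> chart_at (x t) c ->
      isotropic_cone g c (x t) (velocity c x t).

(* A smooth foliation by curves: a partition F of V into connected leaves such
   that around each point there is a chart (u_0, u_1, ...) of V, of domain U, in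
   which the connected components of L `&` U, for every leaf L, are the slices
   u_1 = const, u_2 = const, ... *)
Definition foliation_by_curves (R : realType) (k : nat) (V : manifold R k)
    (F : set (set V)) :=
  [/\ forall p, exists! L, F L /\ L p,
      forall L, F L -> L !=set0 /\ connected L &
      forall p, exists2 c, chart_at p c &
        forall L q, F L -> (L `&` cdom c) q ->
          connected_component (L `&` cdom c) q =
          [set r | cdom c r /\
            forall i : 'I_k, (0 < i)%N -> cmap c r 0 i = cmap c q 0 i]].

(* Main.v *)
(* The degeneracy of g on V singles out a null line in each tangent space of V.
   In charts this line field is spanned by a smooth field X, and smooth
   dependence of solutions of ODEs on initial values gives flow-box charts of V
   in which X is a coordinate field e.  For a null field X tangent to V, the
   formula
     <nabla_X X, W> = X<X, W> - 1/2 W<X, X>,   [X, W] = 0,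
   shows that nabla_X X is orthogonal to V, hence proportional to X: integral
   curves of X are geodesics up to parametrization.  In a flow box a null curve
   with position u, where u' = b e, has zero acceleration iff b' = - phi b^2, a
   first order system in (u, b); affinely parametrized null geodesics are thus
   determined by their initial velocity and glue to maximal ones, whose images
   are the leaves.  In a flow box, a leaf contains the whole slice through each
   of its points, and its transversal coordinates take countably many values,
   so the slices are the components of its trace. *)

(* The null line field need not be orientable, so in general no global field spans it and integral
   curves have no common parameter. Affine parametrization for one fixed metric of the class
   supplies one, unique up to s -> a s + b; this is what lets local arcs glue into a single curve on
   an interval whose image is the whole leaf. Straightening uses no inverse function theorem: the
   null field is normalized so that one of its coordinates is 1, and its flow then gives the flow
   box and its inverse explicitly. Initial value problems are solved on [0, 1] only. Other times,
   negative ones included, come from multiplying the field by the time, so that smoothness in time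
   and initial point reduces to smoothness of a time-one map. A leaf may be dense in a flow box, so
   its slices there need not be isolated; this is why its components are separated by a countability
   argument. *)
Require Import Defs.
From HB Require Import structures.
From mathcomp Require Import all_boot all_order all_algebra.
From mathcomp Require Import all_classical all_reals all_analysis.
From mathcomp Require Import perm ring lra.
Set Implicit Arguments.
Unset Strict Implicit.
Unset Printing Implicit Defensive.
Import Order.TTheory GRing.Theory Num.Theory.
Import numFieldNormedType.Exports.
Local Open Scope classical_set_scope.
Local Open Scope ring_scope.

(** * Derivatives and the class C^k *)

Section mx_norm_facts.
Context {R : realType} {m n : nat}.
Implicit Types A : 'M[R]_(m, n).

Lemma mx_norm_coord A i j : `|A i j| <= `|A|.
Proof.
rewrite [leRHS]/Num.Def.normr/= mx_normrE.
exact: (le_bigmax _ (fun ij => `|A ij.1 ij.2|) (i, j)).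
Qed.

Lemma mx_norm_leP A e : 0 <= e -> (forall i j, `|A i j| <= e) -> `|A| <= e.
Proof.
move=> e0 H; rewrite [leLHS]/Num.Def.normr/= mx_normrE.
by rewrite (bigmax_le _ e0)//= => -[i j] _; exact: H.
Qed.

Lemma continuous_mxP (T : topologicalType) (f : T -> 'M[R]_(m, n)) x :
  {for x, continuous f} <-> forall i j, {for x, continuous (fun y => f y i j)}.
Proof.
split=> [cf i j|cf].
  by apply: (@continuous_comp _ _ _ f (fun M : 'M[R]_(m, n) => M i j));
    [exact: cf|exact: coord_continuous].
apply/cvgrPdist_le => e e0; near=> y.
apply: mx_norm_leP => [|i j]; first exact: ltW.
rewrite !mxE; move: i j; near: y.
apply: filter_forall => i; apply: filter_forall => j.
by have /cvgrPdist_le/(_ e e0) := cf i j.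
Unshelve. all: by end_near. Qed.

End mx_norm_facts.

Lemma cvg_sumr (K : numFieldType) (V : normedModType K) T (F : set_system T)
    (FF : Filter F) I (r : seq I) (P : pred I) (f : I -> T -> V) (a : I -> V) :
  (forall i, P i -> f i @ F --> a i) ->
  (fun x => \sum_(i <- r | P i) f i x) @ F --> \sum_(i <- r | P i) a i.
Proof.
move=> fa; elim: r => [|i r IH].
  by rewrite big_nil; under eq_fun do rewrite big_nil; exact: cvg_cst.
rewrite big_cons; under eq_fun do rewrite big_cons.
by case: ifPn => // Pi; apply: cvgD => //; exact: fa.
Qed.

Section derive_facts.
Context {R : realType}.

Lemma is_derive_mxP (E : normedModType R) m n (f : E -> 'M[R]_(m, n)) x v df :
  is_derive x v f df <->
  forall i j, is_derive x v (fun y => f y i j) (df i j).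
Proof.
split=> [[fv <-] i j|H].
  split; first by move/derivable_mxP : fv.
  by rewrite derive_mx// mxE.
have fv : derivable f x v by apply/derivable_mxP => i j; have [] := H i j.
split=> //; rewrite derive_mx//; apply/matrixP => i j; rewrite mxE.
by have [] := H i j.
Qed.

Lemma is_derive_lineP (E F : normedModType R) (f : E -> F) x v t df :
  is_derive (t *: v + x) v f df <->
  is_derive t 1 (fun s : R => f (s *: v + x)) df.
Proof.
have E1 : (fun h : R => h^-1 *: ((f \o shift (t *: v + x)) (h *: v)
    - f (t *: v + x))) =
  (fun h : R => h^-1 *: (((fun s : R => f (s *: v + x)) \o shift t) (h *: (1 : R))
    - f (t *: v + x))).
  by apply/funext => h /=; rewrite [h *: 1]mulr1 scalerDl addrA.
by split=> -[H1 H2]; split; move: H1 H2; rewrite /derivable /derive E1.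
Qed.

(** Only derivability of [f] along [v] is assumed: restricted to the line through [x], [f] is a
    function of one real variable, for which derivability and differentiability coincide. *)
Lemma is_derive_comp (E E' F : normedModType R) (f : E -> E') (g : E' -> F)
    x v df :
  is_derive x v f df -> differentiable g (f x) ->
  is_derive x v (g \o f) ('d g (f x) df).
Proof.
move=> fd gd.
have {fd} : is_derive (0 *: v + x) v f df by rewrite scale0r add0r.
move/is_derive_lineP => [/derivable1_diffP fd fE].
have := fE; rewrite deriveE// => fE'.
have gd' : differentiable g (f ((0 : R) *: v + x)) by rewrite scale0r add0r.
suff : is_derive (0 *: v + x) v (g \o f) ('d g (f x) df).
  by rewrite scale0r add0r.
apply/is_derive_lineP.
have gf : differentiable (g \o (fun s : R => f (s *: v + x))) 0.
  exact: differentiable_comp.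
split; first by apply/derivable1_diffP.
rewrite -[LHS]/('D_1 (g \o (fun s : R => f (s *: v + x))) 0).
by rewrite deriveE// diff_comp//= fE' scale0r add0r.
Qed.

Lemma is_derive_scalev (E F : normedModType R) (f : E -> F) x v (a : R) df :
  is_derive x v f df -> is_derive x (a *: v) f (a *: df).
Proof.
move=> fd.
have : is_derive (0 *: v + x) v f df by rewrite scale0r add0r.
move/is_derive_lineP => fd'.
suff : is_derive (0 *: (a *: v) + x) (a *: v) f (a *: df).
  by rewrite scale0r add0r.
apply/is_derive_lineP.
have -> : (fun s : R => f (s *: (a *: v) + x)) =
    (fun s : R => f (s *: v + x)) \o (fun s : R => s * a).
  by apply/funext => s /=; rewrite scalerA.
case: fd' => /derivable1_diffP fd' fE.
have H : is_derive (0 : R) (1 : R) (fun s : R => s * a) a.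
  rewrite (_ : (fun s => _) = a *: (id : R -> R)); last first.
    by apply/funext => s; rewrite [RHS]/GRing.scale/= mulrC.
  apply: is_derive_eq; by rewrite [_ *: _]mulr1.
have fd'' : differentiable (fun s : R => f (s *: v + x)) ((fun s : R => s * a) 0).
  by rewrite mul0r.
have := is_derive_comp H fd''.
rewrite mul0r -deriveE// => /is_derive_eq; apply.
rewrite -fE; rewrite deriveE// -[X in 'd _ _ X]mulr1 linearZ/=.
by rewrite deriveE.
Qed.

Lemma mvt_line (E : normedModType R) (f : E -> R) x v :
  (forall t : R, 0 <= t <= 1 -> derivable f (t *: v + x) v) ->
  exists2 t : R, 0 <= t <= 1 & f (v + x) - f x = 'D_v f (t *: v + x).
Proof.
move=> H.
have H' (t : R) : 0 <= t <= 1 ->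
    is_derive t 1 (fun s : R => f (s *: v + x)) ('D_v f (t *: v + x)).
  by move=> t01; apply: (is_derive_lineP f x v t _).1; apply: derivableP; exact: H t01.
have [|||t] := @MVT_segment R (fun s : R => f (s *: v + x))
  (fun t => 'D_v f (t *: v + x)) 0 1.
- exact: ler01.
- by move=> t; rewrite in_itv/= => /andP[t0 t1]; apply: H'; rewrite !ltW.
- apply: derivable_within_continuous => t; rewrite in_itv/= => t01.
  by have [] := H' _ t01.
rewrite in_itv/= => t01; rewrite scale1r scale0r add0r subr0 mulr1 => ->.
by exists t.
Qed.

Lemma row_sum_e n (v : 'rV[R]_n) :
  v = \sum_j v 0 j *: (delta_mx 0 j : 'rV[R]_n).
Proof. exact: row_sum_delta. Qed.

Lemma derive_sum_e n (F : normedModType R) (g : 'rV[R]_n -> F) y w :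
  differentiable g y ->
  'D_w g y = \sum_j w 0 j *: 'D_(delta_mx 0 j : 'rV[R]_n) g y.
Proof.
move=> gd; rewrite deriveE// {1}(row_sum_e w) linear_sum/=.
by apply: eq_bigr => j _; rewrite linearZ/= deriveE.
Qed.

(** In the sup norm, dropping coordinates of [h] or shrinking them does not increase the norm; this
    confines the edge path of [strict_diff_scalar] to a ball. *)
Lemma norm_prefix n (h : 'rV[R]_n) (P : pred 'I_n) (c : 'I_n -> R) :
  (forall j, `|c j| <= 1) ->
  `|\sum_(j | P j) (c j * h 0 j) *: (delta_mx 0 j : 'rV[R]_n)| <= `|h|.
Proof.
move=> c1; apply: mx_norm_leP => // i j; rewrite ord1 summxE.
have [Pj|Pj] := boolP (P j).
  rewrite (bigD1 j)//= big1 => [|k /andP[_ kj]]; last first.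
    by rewrite !mxE eqxx/= eq_sym (negPf kj) mulr0.
  rewrite !mxE !eqxx mulr1 addr0 normrM.
  rewrite -[leRHS]mul1r ler_pM//; exact: mx_norm_coord.
rewrite big1 ?normr0// => k Pk; rewrite !mxE eqxx/=.
by case: eqP => [jk|]; [move: Pj; rewrite jk Pk|rewrite mulr0].
Qed.

Lemma near0_forall_le (P : R -> Prop) :
  (exists2 d, 0 < d & P d) -> (forall d e, d <= e -> P e -> P d) ->
  \forall d \near 0^'+, P d.
Proof.
move=> [d d0 Pd] mon; near=> e; apply: mon Pd; near: e; exact: nbhs_right_le.
Unshelve. all: by end_near. Qed.

(** The increment from [y] to [h + y] is split along coordinate edges, with the mean value theorem
    on each. The base point [y] is free, not fixed at [x]: this is strict differentiability, which
    also yields local Lipschitz bounds. *)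
Lemma strict_diff_scalar n (f : 'rV[R]_n -> R) (U : set 'rV[R]_n) x (e : R) :
  open U -> U x -> 0 < e ->
  (forall (j : 'I_n) y, U y -> derivable f y (delta_mx 0 j : 'rV[R]_n)) ->
  (forall j : 'I_n, {for x, continuous ('D_(delta_mx 0 j : 'rV[R]_n) f)}) ->
  \forall d \near 0^'+, forall y h, `|y - x| <= d -> `|h| <= d ->
    `|f (h + y) - f y - \sum_j h 0 j * 'D_(delta_mx 0 j : 'rV[R]_n) f x|
    <= e * `|h|.
Proof.
move=> oU Ux e0 fd fc.
apply: near0_forall_le; last first.
  by move=> d d' dd' H y h yd hd; apply: H; exact: le_trans dd'.
(* One share of [e] per coordinate; [n.+1] instead of [n] keeps the divisor nonzero. *)
pose e1 := e / n.+1%:R.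
have e10 : 0 < e1 by rewrite divr_gt0.
have : \forall z \near x, U z /\ forall j : 'I_n,
    `|'D_(delta_mx 0 j : 'rV[R]_n) f x - 'D_(delta_mx 0 j : 'rV[R]_n) f z| <= e1.
  apply: filterI; first exact: open_nbhs_nbhs.
  by apply: (@filter_forall _ _ _ (nbhs x)) => j; have /cvgrPdist_le/(_ _ e10) := fc j.
move=> /nbhs_ballP[r /= r0 Hr].
(* [y] is within r/3 of [x] and the edge path within r/3 of [y], so the path stays in the ball of
   radius r. *)
exists (r / 3); first by rewrite divr_gt0.
move=> y h yx hr.
have Hz z : `|z - y| <= `|h| -> U z /\ forall j : 'I_n,
    `|'D_(delta_mx 0 j : 'rV[R]_n) f x - 'D_(delta_mx 0 j : 'rV[R]_n) f z| <= e1.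
  move=> zy; apply: Hr; rewrite -ball_normE/=.
  rewrite distrC -(subrKA y) (le_lt_trans (ler_normD _ _))//.
  apply: (@le_lt_trans _ _ (r / 3 + r / 3)); last lra.
  by rewrite lerD// (le_trans zy).
pose p k : 'rV[R]_n := \sum_(j < n | (j < k)%N) h 0 j *: (delta_mx 0 j : 'rV[R]_n).
have p0 : p 0%N = 0 by rewrite /p big1.
have pn : p n = h.
  by rewrite [RHS]row_sum_e /p; apply: eq_bigl => j; rewrite ltn_ord.
have pS (k : 'I_n) : p k.+1 = h 0 k *: (delta_mx 0 k : 'rV[R]_n) + p k.
  rewrite /p (bigD1 k)/= ?ltnSn//; congr (_ + _); apply: eq_bigl => j.
  by rewrite ltnS ltn_neqAle andbC -val_eqE.
have tel : f (h + y) - f y = \sum_(k < n) (f (p k.+1 + y) - f (p k + y)).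
  have -> : f (h + y) - f y = f (p n + y) - f (p 0%N + y).
    by rewrite pn p0 add0r.
  by rewrite -(big_mkord xpredT (fun k => f (p k.+1 + y) - f (p k + y)))
    telescope_sumr.
rewrite tel -sumrB.
apply: (@le_trans _ _ (\sum_(k < n) e1 * `|h|)); last first.
  rewrite sumr_const card_ord -mulr_natr mulrAC ler_wpM2r//.
  by rewrite /e1 mulrAC ler_pdivrMr ?ltr0n// ler_wpM2l ?(ltW e0) ?ler_nat//.
apply: (le_trans (ler_norm_sum _ _ _)); apply: ler_sum => k _.
pose v := h 0 k *: (delta_mx 0 k : 'rV[R]_n).
have Uv (t : R) : 0 <= t <= 1 -> `|t *: v + (p k + y) - y| <= `|h|.
  move=> /andP[t0 t1]; rewrite addrA addrK.
  (* A point of the k-th edge carries all earlier coordinates of [h] and the fraction [t] of the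
     k-th. *)
  pose c (j : 'I_n) := if j == k then t else 1.
  have -> : t *: v + p k = \sum_(j < n | (j < k.+1)%N)
      (c j * h 0 j) *: (delta_mx 0 j : 'rV[R]_n).
    rewrite [RHS](bigD1 k)/= ?ltnSn// /c eqxx scalerA; congr (_ + _).
    rewrite /p; apply: eq_big => [j|j jk].
      by rewrite ltnS ltn_neqAle andbC -val_eqE.
    by rewrite -val_eqE/= ltn_eqF// mul1r.
  apply: norm_prefix => j; rewrite /c; case: ifPn => _; last by rewrite normr1.
  by rewrite ger0_norm.
have [|t t01] := @mvt_line _ f (p k + y) v.
  move=> t /Uv/Hz[Ut _]; have [] // := is_derive_scalev (h 0 k) (derivableP (fd k _ Ut)).
have [Ut Dt] := Hz _ (Uv t t01).
rewrite {1}/v addrA -pS => ->.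
have [_ ->] := is_derive_scalev (h 0 k) (derivableP (fd k _ Ut)).
rewrite -[_ *: _]/(_ * _) -mulrBr normrM mulrC distrC ler_pM//; first exact: mx_norm_coord.
Qed.

Lemma C1_differentiable_scalar n (f : 'rV[R]_n -> R) (U : set 'rV[R]_n) x :
  open U -> U x ->
  (forall (j : 'I_n) y, U y -> derivable f y (delta_mx 0 j : 'rV[R]_n)) ->
  (forall j : 'I_n, {for x, continuous ('D_(delta_mx 0 j : 'rV[R]_n) f)}) ->
  differentiable f x.
Proof.
move=> oU Ux fd fc.
pose L (h : 'rV[R]_n) := \sum_j h 0 j * 'D_(delta_mx 0 j : 'rV[R]_n) f x.
have Llin : linear L.
  move=> a u v; rewrite /L scaler_sumr -big_split/=; apply: eq_bigr => j _.
  by rewrite !mxE mulrDl -[_ *: _]/(_ * _) mulrA.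
pose LM := GRing.isLinear.Build _ _ _ _ _ Llin.
pose LL : {linear 'rV[R]_n -> R} := HB.pack L LM.
have Lc : continuous LL.
  move=> z; rewrite /continuous_at/= /L.
  by apply: (@cvg_sumr _ _ _ (nbhs z)) => j _; apply: cvgMr_tmp; exact: coord_continuous.
have H : f \o shift x = cst (f x) + LL +o_ (0 : 'rV[R]_n) id.
  apply/eqaddoP => e e0.
  have := strict_diff_scalar oU Ux e0 fd fc => Hd.
  have [d /= [d0 {}Hd]] := filter_ex (filterI (nbhs_right_gt (0 : R)) Hd).
  have hd : \forall h \near (0 : 'rV[R]_n), `|h| <= d by exact: nbhs0_le.
  apply: filterS hd => h hd.
  rewrite -[_ h]/(f (h + x) - (f x + L h)) opprD addrA.
  by apply: Hd => //; rewrite subrr normr0 ltW.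
have dE := diff_unique Lc H.
by apply/diff_locallyP; rewrite dE; split.
Qed.

End derive_facts.

(** * Closure properties of the class C^k *)

Section Ck_toolkit.
Context {R : realType}.
Implicit Types E F : normedModType R.

Lemma open_near_eq (T : topologicalType) (S : Type) (U : set T) (f g : T -> S) x :
  open U -> U x -> (forall y, U y -> f y = g y) -> \forall y \near x, f y = g y.
Proof. by move=> oU Ux fg; apply: filterS (open_nbhs_nbhs (conj oU Ux)). Qed.

Lemma near_continuous_eq (T S : topologicalType) (f g : T -> S) x :
  (\forall y \near x, f y = g y) -> {for x, continuous f} ->
  {for x, continuous g}.
Proof.
move=> fg cf; rewrite /prop_for /continuous_at -(nbhs_singleton fg).
by apply: cvg_trans cf; apply: near_eq_cvg.
Qed.

Lemma Ck_continuous E F k (U : set E) (f : E -> F) x :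
  Ck k U f -> U x -> {for x, continuous f}.
Proof. by case: k => [|k] [+ _] => /[apply]. Qed.

Lemma Ck_derive E F k (U : set E) (f : E -> F) v :
  Ck k.+1 U f -> Ck k U ('D_v f).
Proof. by move=> [_ /(_ v)[]]. Qed.

Lemma Ck_is_derive E F k (U : set E) (f : E -> F) v x :
  Ck k.+1 U f -> U x -> is_derive x v f ('D_v f x).
Proof. by move=> [_ /(_ v)[+ _]] => /[apply] /derivableP. Qed.

Lemma Ck_pred E F k (U : set E) (f : E -> F) : Ck k.+1 U f -> Ck k U f.
Proof.
elim: k f => [|k IH] f [cf H]; first by split.
by split=> // v; have [fd Hk] := H v; split=> //; exact: IH.
Qed.

Lemma Ck_sub E F k (U V : set E) (f : E -> F) :
  V `<=` U -> Ck k U f -> Ck k V f.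
Proof.
move=> VU; elim: k f => [|k IH] f [cf H]; split; try by move=> x /VU /cf.
- by [].
- by move=> v; have [fd Hk] := H v; split; [move=> x /VU /fd|exact: IH].
Qed.

Lemma Ck_ext E F k (U : set E) (f g : E -> F) :
  open U -> (forall x, U x -> f x = g x) -> Ck k U f -> Ck k U g.
Proof.
move=> oU; elim: k f g => [|k IH] f g fg [cf H]; split.
- by move=> x Ux; apply: near_continuous_eq (cf x Ux); exact: open_near_eq fg.
- by [].
- by move=> x Ux; apply: near_continuous_eq (cf x Ux); exact: open_near_eq fg.
- move=> v; have [fd Hk] := H v; split=> [x Ux|].
    by apply: near_eq_derivable (fd x Ux); exact: open_near_eq fg.
  apply: IH Hk => x Ux; apply: near_eq_derive; exact: open_near_eq fg.
Qed.

Lemma Ck_local E F k (U : set E) (f : E -> F) :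
  (forall x, U x -> exists W, [/\ open W, W x & Ck k W f]) -> Ck k U f.
Proof.
elim: k f => [|k IH] f H; split.
- by move=> x Ux; have [W [_ Wx [+ _]]] := H x Ux; apply.
- by [].
- by move=> x Ux; have [W [_ Wx [+ _]]] := H x Ux; apply.
- move=> v; split=> [x Ux|].
    by have [W [_ Wx [_ /(_ v)[+ _]]]] := H x Ux; apply.
  by apply: IH => x /H [W [oW Wx fW]]; exists W; split=> //; exact: Ck_derive.
Qed.

(** Lets ['D_v f] be replaced by a closed form known only on [U]; openness makes the two agree near
    each point, so higher derivatives agree as well. *)
Lemma Ck_intro E F k (U : set E) (f : E -> F) (g : E -> E -> F) : open U ->
  (forall x, U x -> {for x, continuous f}) ->
  (forall v x, U x -> is_derive x v f (g v x)) ->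
  (forall v, Ck k U (g v)) -> Ck k.+1 U f.
Proof.
move=> oU cf fd gk; split=> // v; split=> [x Ux|]; first by have [] := fd v x Ux.
by apply: Ck_ext (gk v) => // x Ux; have [] := fd v x Ux.
Qed.

Lemma Ck_cst E F k (U : set E) (a : F) : Ck k U (cst a : E -> F).
Proof.
elim: k a => [|k IH] a; split=> //; try by move=> x _; exact: cst_continuous.
move=> v; split=> [x _|]; first exact: derivable_cst.
have -> : 'D_v (cst a : E -> F) = cst (0 : F) by apply/funext => x; rewrite derive_cst.
exact: IH.
Qed.

Lemma linear_is_derive E F (L : {linear E -> F}) x v : continuous L ->
  is_derive x v L (L v).
Proof.
move=> cL; have Ld : differentiable L x by exact: linear_differentiable.
by split; [exact: diff_derivable|rewrite deriveE// diff_lin].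
Qed.

Lemma Ck_linear E F k (U : set E) (L : {linear E -> F}) :
  continuous L -> Ck k U L.
Proof.
move=> cL; case: k => [|k]; split=> //; try by move=> x _; exact: cL.
move=> v; split=> [x _|]; first by have [] := linear_is_derive x v cL.
have -> : 'D_v L = cst (L v) by apply/funext => x; have [] := linear_is_derive x v cL.
exact: Ck_cst.
Qed.

Lemma Ck_id E k (U : set E) : Ck k U (id : E -> E).
Proof. by have := @Ck_linear E E k U idfun; apply; move=> x. Qed.

Lemma CkD E F k (U : set E) (f g : E -> F) : open U ->
  Ck k U f -> Ck k U g -> Ck k U (fun x => f x + g x).
Proof.
move=> oU; elim: k f g => [|k IH] f g fk gk.
  split=> // x Ux; apply: continuousD; first exact: Ck_continuous fk Ux.
  exact: Ck_continuous gk Ux.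
apply: (@Ck_intro _ _ _ _ _ (fun v x => 'D_v f x + 'D_v g x)) => //.
- move=> x Ux; apply: continuousD; first exact: Ck_continuous fk Ux.
  exact: Ck_continuous gk Ux.
- by move=> v x Ux; apply: is_deriveD; [exact: Ck_is_derive fk Ux|exact: Ck_is_derive gk Ux].
- by move=> v; apply: IH; exact: Ck_derive.
Qed.

Lemma CkM E k (U : set E) (f g : E -> R) : open U ->
  Ck k U f -> Ck k U g -> Ck k U (fun x => f x * g x).
Proof.
move=> oU; elim: k f g => [|k IH] f g fk gk.
  split=> // x Ux; apply: continuousM; first exact: Ck_continuous fk Ux.
  exact: Ck_continuous gk Ux.
apply: (@Ck_intro _ _ _ _ _ (fun v x => f x * 'D_v g x + g x * 'D_v f x)) => //.
- move=> x Ux; apply: continuousM; first exact: Ck_continuous fk Ux.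
  exact: Ck_continuous gk Ux.
- by move=> v x Ux; apply: is_deriveM; [exact: Ck_is_derive fk Ux|exact: Ck_is_derive gk Ux].
- by move=> v; apply: CkD => //; apply: IH; [exact: Ck_pred|exact: Ck_derive|exact: Ck_pred|exact: Ck_derive].
Qed.

Lemma CkN E k (U : set E) (f : E -> R) : open U ->
  Ck k U f -> Ck k U (fun x => - f x).
Proof.
move=> oU fk; apply: (@Ck_ext _ _ _ _ (fun x => cst (-1) x * f x)) => //.
  by move=> x _; rewrite /cst mulN1r.
by apply: CkM => //; exact: Ck_cst.
Qed.

Lemma Ck_sum E F k (U : set E) I (r : seq I) (P : pred I) (f : I -> E -> F) :
  open U -> (forall i, P i -> Ck k U (f i)) ->
  Ck k U (fun x => \sum_(i <- r | P i) f i x).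
Proof.
move=> oU fk; elim: r => [|i r IH].
  by under eq_fun do rewrite big_nil; exact: Ck_cst.
under eq_fun do rewrite big_cons.
have [Pi|//] := boolP (P i); apply: CkD => //; exact: fk.
Qed.

Lemma Ck_prod E k (U : set E) I (r : seq I) (P : pred I) (f : I -> E -> R) :
  open U -> (forall i, P i -> Ck k U (f i)) ->
  Ck k U (fun x => \prod_(i <- r | P i) f i x).
Proof.
move=> oU fk; elim: r => [|i r IH].
  by under eq_fun do rewrite big_nil; exact: Ck_cst.
under eq_fun do rewrite big_cons.
have [Pi|//] := boolP (P i); apply: CkM => //; exact: fk.
Qed.

Lemma CkV E k (U : set E) (f : E -> R) : open U ->
  (forall x, U x -> f x != 0) -> Ck k U f -> Ck k U (fun x => (f x)^-1).
Proof.
move=> oU f0; elim: k f f0 => [|k IH] f f0 fk.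
  by split=> // x Ux; apply: continuousV; [exact: f0|exact: Ck_continuous fk Ux].
apply: (@Ck_intro _ _ _ _ _ (fun v x => (cst (-1) x * ((f x)^-1 * (f x)^-1)) * 'D_v f x)) => //.
- by move=> x Ux; apply: continuousV; [exact: f0|exact: Ck_continuous fk Ux].
- move=> v x Ux; have [fd _] := Ck_is_derive v fk Ux; split.
    by apply: derivableV; [exact: f0|].
  rewrite deriveV ?f0//; rewrite -[_ *: _]/(_ * _) /cst mulN1r.
  by rewrite -exprVn expr2.
- have fkV := IH f f0 (Ck_pred fk).
  move=> v; apply: CkM => //; last exact: Ck_derive.
  by apply: CkM => //; [exact: Ck_cst|exact: CkM].
Qed.

Lemma Ck_mxP E k (U : set E) m n (f : E -> 'M[R]_(m, n)) : open U ->
  Ck k U f <-> forall i j, Ck k U (fun x => f x i j).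
Proof.
move=> oU; elim: k f => [|k IH] f; split.
- by move=> [cf _] i j; split=> // x Ux; move/continuous_mxP : (cf x Ux).
- move=> cf; split=> // x Ux; apply/continuous_mxP => i j.
  exact: Ck_continuous (cf i j) Ux.
- move=> fk i j; apply: (@Ck_intro _ _ _ _ _ (fun v x => 'D_v f x i j)) => //.
  + by move=> x Ux; have /continuous_mxP := Ck_continuous fk Ux; exact.
  + by move=> v x Ux; have /is_derive_mxP := Ck_is_derive v fk Ux; exact.
  + by move=> v; have /IH := Ck_derive v fk; exact.
- move=> fk; apply: (@Ck_intro _ _ _ _ _ (fun v x => \matrix_(i, j) 'D_v (fun y => f y i j) x)) => //.
  + by move=> x Ux; apply/continuous_mxP => i j; exact: Ck_continuous (fk i j) Ux.
  + move=> v x Ux; apply/is_derive_mxP => i j; rewrite mxE.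
    exact: Ck_is_derive (fk i j) Ux.
  + move=> v; apply/IH => i j.
    apply: (@Ck_ext _ _ _ _ ('D_v (fun y => f y i j))) => //; first by move=> x _; rewrite mxE.
    exact: Ck_derive.
Qed.

Lemma Ck_rVP E k (U : set E) n (f : E -> 'rV[R]_n) : open U ->
  Ck k U f <-> forall j, Ck k U (fun x => f x 0 j).
Proof.
move=> oU; rewrite (Ck_mxP _ _ oU); split=> [H j|H i j]; first exact: H.
by rewrite ord1.
Qed.

Lemma C1_differentiable n (U : set 'rV[R]_n) (f : 'rV[R]_n -> R) x :
  open U -> U x -> Ck 1 U f -> differentiable f x.
Proof.
move=> oU Ux fk; apply: (C1_differentiable_scalar oU Ux) => [j y Uy|j].
  by have [] := Ck_is_derive (delta_mx 0 j : 'rV[R]_n) fk Uy.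
exact: Ck_continuous (Ck_derive _ fk) Ux.
Qed.

Lemma C1_differentiable_mx n p q (U : set 'rV[R]_n) (f : 'rV[R]_n -> 'M[R]_(p, q)) x :
  open U -> U x -> Ck 1 U f -> differentiable f x.
Proof.
move=> oU Ux /(Ck_mxP _ _ oU) fk.
rewrite (_ : f = \sum_(ij : 'I_p * 'I_q) (fun y => f y ij.1 ij.2 *: delta_mx ij.1 ij.2)); last first.
  apply/funext => y; rewrite fct_sumE [LHS]matrix_sum_delta pair_big/=.
  by apply: eq_bigr => -[].
elim/big_ind : _ => [|g h gd hd|ij _].
- exact: differentiable_cst.
- exact: differentiableD.
- by apply: differentiableZl; exact: C1_differentiable (fk _ _).
Qed.

Lemma C1_derive_sum n p q (U : set 'rV[R]_n) (f : 'rV[R]_n -> 'M[R]_(p, q)) x v :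
  open U -> U x -> Ck 1 U f ->
  'D_v f x = \sum_j v 0 j *: 'D_(delta_mx 0 j : 'rV[R]_n) f x.
Proof. by move=> oU Ux fk; apply: derive_sum_e; exact: C1_differentiable_mx fk. Qed.

Lemma C1_derive_sum_scalar n (U : set 'rV[R]_n) (f : 'rV[R]_n -> R) x v :
  open U -> U x -> Ck 1 U f ->
  'D_v f x = \sum_j v 0 j * 'D_(delta_mx 0 j : 'rV[R]_n) f x.
Proof. by move=> oU Ux fk; apply: derive_sum_e; exact: C1_differentiable fk. Qed.

Lemma is_derive_chain E n F (f : E -> 'rV[R]_n) (g : 'rV[R]_n -> F) x v df :
  is_derive x v f df -> differentiable g (f x) ->
  is_derive x v (fun y => g (f y)) ('D_df g (f x)).
Proof. by move=> fd gd; rewrite deriveE//; exact: is_derive_comp. Qed.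

(** By the chain rule the derivative of the composite is a sum of products of derivatives of [f]
    with composites of the same shape, hence the induction on [k] with [g] general. The middle space
    is R^n because the chain rule wants [g] differentiable, which [C1_differentiable] provides. *)
Lemma Ck_comp_scalar E n k (U : set E) (W : set 'rV[R]_n) (f : E -> 'rV[R]_n)
    (g : 'rV[R]_n -> R) : open U -> open W -> (forall x, U x -> W (f x)) ->
  Ck k U f -> Ck k W g -> Ck k U (fun x => g (f x)).
Proof.
move=> oU oW UW; elim: k g => [|k IH] g fk gk.
  split=> // x Ux; apply: continuous_comp; first exact: Ck_continuous fk Ux.
  exact: Ck_continuous gk (UW _ Ux).
have gk1 : Ck 1 W g by elim: (k) gk => // k' IH' /Ck_pred.
have gd x : U x -> differentiable g (f x).
  by move=> Ux; exact: C1_differentiable (UW _ Ux) gk1.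
apply: (@Ck_intro _ _ _ _ _ (fun v x => \sum_j 'D_v f x 0 j * 'D_(delta_mx 0 j : 'rV[R]_n) g (f x))) => //.
- move=> x Ux; apply: continuous_comp; first exact: Ck_continuous fk Ux.
  exact: Ck_continuous gk (UW _ Ux).
- move=> v x Ux; rewrite -(C1_derive_sum_scalar _ oW (UW _ Ux) gk1).
  exact: (is_derive_chain (Ck_is_derive v fk Ux) (gd _ Ux)).
- move=> v; apply: Ck_sum => // j _; apply: CkM => //.
    by have /(Ck_rVP _ _ oU) := Ck_derive v fk; exact.
  exact: (IH _ (Ck_pred fk) (Ck_derive _ gk)).
Qed.

Lemma Ck_comp E n p q k (U : set E) (W : set 'rV[R]_n) (f : E -> 'rV[R]_n)
    (g : 'rV[R]_n -> 'M[R]_(p, q)) : open U -> open W ->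
  (forall x, U x -> W (f x)) ->
  Ck k U f -> Ck k W g -> Ck k U (fun x => g (f x)).
Proof.
move=> oU oW UW fk /(Ck_mxP _ _ oW) gk; apply/(Ck_mxP _ _ oU) => i j.
exact: (Ck_comp_scalar oU oW UW fk (gk i j)).
Qed.

End Ck_toolkit.

(** * Gronwall's inequality and Picard iteration *)

Section Gronwall.
Context {R : realType}.

(** Initial value problems are posed on this interval; a flow time s enters as a factor of the field
    instead. *)
Definition unit_itv : set R := [set t | 0 <= t <= 1].

Lemma derive_ge0_le (f df : R -> R) :
  (forall t, unit_itv t -> is_derive t 1 f (df t)) ->
  (forall t, unit_itv t -> 0 <= df t) ->
  forall t, unit_itv t -> f 0 <= f t.
Proof.
move=> fd f0 t /andP[t0 t1].
have sub s : 0 <= s <= t -> unit_itv s.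
  by move=> /andP[s0 st]; rewrite /unit_itv/= s0 (le_trans st).
have [|||s] := @MVT_segment R f df 0 t.
- exact: t0.
- by move=> s; rewrite in_itv/= => /andP[s0 st]; apply: fd; apply: sub; rewrite !ltW.
- apply: derivable_within_continuous => s; rewrite in_itv/= => st.
  by have [] := fd _ (sub _ st).
rewrite in_itv/= => /sub s01 E.
by rewrite -subr_ge0 E subr0 mulr_ge0// f0.
Qed.

(** Stands in for bounding an integral by the integral of a bound. Each coordinate is compared with
    [G] from both sides, the norm being the maximum of the coordinates. *)
Lemma mean_value_inequality n (F dF : R -> 'rV[R]_n) (G dG : R -> R) :
  (forall t, unit_itv t -> is_derive t 1 F (dF t)) ->
  (forall t, unit_itv t -> is_derive t 1 G (dG t)) ->
  (forall t, unit_itv t -> `|dF t| <= dG t) ->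
  forall t, unit_itv t -> `|F t - F 0| <= G t - G 0.
Proof.
move=> Fd Gd FG t t01.
have H (f df : R -> R) : (forall t, unit_itv t -> is_derive t 1 f (df t)) ->
    (forall t, unit_itv t -> df t <= dG t) -> f t - f 0 <= G t - G 0.
  move=> fd fG.
  have : (G - f) 0 <= (G - f) t.
    apply: (@derive_ge0_le _ (fun s => dG s - df s)) => // s s01.
      by apply: is_deriveB; [exact: Gd|exact: fd].
    by rewrite subr_ge0 fG.
  rewrite -[(G - f) 0]/(G 0 - f 0) -[(G - f) t]/(G t - f t); lra.
have G0 : 0 <= G t - G 0.
  rewrite subr_ge0; apply: (derive_ge0_le Gd) => // s s01.
  by apply: le_trans (FG _ s01).
apply: mx_norm_leP => // i j; rewrite !mxE ler_norml; apply/andP; split.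
  rewrite lerNl.
  have := H (fun s => - F s i j) (fun s => - dF s i j); rewrite opprB opprK addrC; apply.
    by move=> s s01; apply: is_deriveN; have /is_derive_mxP := Fd _ s01; exact.
  move=> s s01; apply: le_trans (FG _ s01).
  by apply: le_trans (mx_norm_coord _ i j); rewrite -normrN ler_norm.
apply: (H (fun s => F s i j) (fun s => dF s i j)).
  by move=> s s01; have /is_derive_mxP := Fd _ s01; exact.
move=> s s01; apply: le_trans (FG _ s01).
by apply: le_trans (mx_norm_coord _ i j); rewrite ler_norm.
Qed.

Lemma is_derive_expRM (K t : R) :
  is_derive t 1 (fun s : R => expR (K * s)) (K * expR (K * t)).
Proof.
have H : is_derive t 1 (fun s : R => K * s) K.
  by apply: is_derive_eq; rewrite [_ *: _]mulr1.
have : is_derive t 1 (expR \o (fun s : R => K * s)) (K *: expR (K * t)).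
  by apply: is_derive_eq; rewrite -[_ *: _]/(_ * _) mulrC.
by [].
Qed.

(** The sup norm is not differentiable, so the estimate is run on the sum of squares [q], for which
    q' <= K (q + e^2). The constant depends only on [n] and [L]. *)
Lemma gronwall n (L : R) : 0 <= L -> exists2 C : R, 1 <= C &
  forall (d dd : R -> 'rV[R]_n) (e : R), 0 <= e ->
  (forall t, unit_itv t -> is_derive t 1 d (dd t)) ->
  (forall t, unit_itv t -> `|dd t| <= L * `|d t| + e) ->
  forall t, unit_itv t -> `|d t| <= C * (`|d 0| + e).
Proof.
(* Per coordinate, 2 |d| (L |d| + e) <= (2 L + 1) (|d|^2 + e^2), because 2 |d| e <= |d|^2 + e^2. *)
move=> L0; pose K : R := n%:R * (2 * L + 1).
have K0 : 0 <= K by rewrite mulr_ge0 ?ler0n// addr_ge0// mulr_ge0.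
(* [n.+1] pays for q 0 <= n |d 0|^2 and for e^2. The squares are bounded with factor C, hence with
   C^2 as C >= 1, so the same C serves after taking roots. *)
pose C : R := n.+1%:R * expR K.
have C1 : 1 <= C.
  rewrite /C -[leLHS]mulr1 ler_pM ?ler1n//.
  by rewrite -expR0 ler_expR.
exists C => // d dd e e0 dD dL t t01.
pose q s := \sum_(j < n) (d s 0 j) ^+ 2.
have coord s : unit_itv s -> forall j, is_derive s 1 (fun s => d s 0 j) (dd s 0 j).
  by move=> s01 j; have /is_derive_mxP := dD _ s01; exact.
have qD s : unit_itv s -> is_derive s 1 q (\sum_(j < n) 2 * (d s 0 j * dd s 0 j)).
  move=> s01; rewrite (_ : q = \sum_(j < n) (fun s => (d s 0 j) ^+ 2)); last first.
    by apply/funext => r; rewrite fct_sumE.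
  apply: is_derive_sum => j; have H := coord _ s01 j.
  under eq_fun do rewrite expr2.
  have := is_deriveM H H.
  by move/is_derive_eq; apply; rewrite -[_ *: _]/(_ * _) mulr_natl mulr2n.
have qle s : `|d s| ^+ 2 <= q s + 0.
  rewrite addr0; have [n0|] := pselect (forall i j, d s i j = 0).
    suff -> : `|d s| = 0 by rewrite expr0n/= sumr_ge0// => j _; exact: sqr_ge0.
    by apply/eqP; rewrite normr_eq0; apply/eqP/matrixP => i j; rewrite n0 mxE.
  move=> ne; have : mx_norm (d s) != 0.
    apply: contra_not_neq ne => /mx_norm_eq0 -> i j; by rewrite mxE.
  move=> /mx_norm_neq0[[i j]]; rewrite ord1/= -[mx_norm _]/(`|d s|) => ->.
  rewrite -normrX ger0_norm ?sqr_ge0// /q (bigD1 j)//= lerDl.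
  by apply: sumr_ge0 => k _; exact: sqr_ge0.
have qge s : q s <= n%:R * `|d s| ^+ 2.
  rewrite /q; apply: (@le_trans _ _ (\sum_(j < n) `|d s| ^+ 2)).
    apply: ler_sum => j _; rewrite -[leLHS]ger0_norm ?sqr_ge0// normrX.
    by rewrite ler_sqr ?nnegrE//; exact: mx_norm_coord.
  by rewrite sumr_const card_ord mulr_natl.
have dq s : unit_itv s ->
    \sum_(j < n) 2 * (d s 0 j * dd s 0 j) <= K * (q s + e ^+ 2).
  move=> s01; apply: (@le_trans _ _ (\sum_(j < n) (2 * L + 1) * (q s + e ^+ 2))).
    apply: ler_sum => j _.
    apply: (@le_trans _ _ (2 * (`|d s| * (L * `|d s| + e)))).
      rewrite ler_wpM2l//; apply: (le_trans (ler_norm _)); rewrite normrM.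
      rewrite ler_pM ?mx_norm_coord//.
      by apply: le_trans (dL _ s01); exact: mx_norm_coord.
    have := qle s; rewrite addr0 => qs.
    apply: (@le_trans _ _ ((2 * L + 1) * (`|d s| ^+ 2 + e ^+ 2))); last first.
      by rewrite ler_wpM2l ?lerD2r//; lra.
    have : 0 <= (`|d s| - e) ^+ 2 by exact: sqr_ge0.
    have : 0 <= L * e ^+ 2 by rewrite mulr_ge0 ?sqr_ge0.
    rewrite !expr2; nra.
  by rewrite sumr_const card_ord -[_ *+ n]mulr_natl /K mulrA.
(* The sign makes [p] nondecreasing, the form that [derive_ge0_le] handles. *)
pose p s := (- (q s + e ^+ 2)) * expR (- K * s).
have pD s : unit_itv s -> is_derive s 1 p
    ((K * (q s + e ^+ 2) - \sum_(j < n) 2 * (d s 0 j * dd s 0 j)) * expR (- K * s)).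
  move=> s01.
  have H1 : is_derive s 1 (fun s => - (q s + e ^+ 2)) (- \sum_(j < n) 2 * (d s 0 j * dd s 0 j)).
    apply: is_deriveN; have H := qD _ s01.
    have := is_deriveD H (is_derive_cst (e ^+ 2) s 1).
    by rewrite addr0.
  have := is_deriveM H1 (is_derive_expRM (- K) s).
  move=> /is_derive_eq; apply; rewrite -![_ *: _]/(_ * _); ring.
have : p 0 <= p t.
  apply: (derive_ge0_le pD) => // s s01.
  by rewrite mulr_ge0 ?expR_ge0// subr_ge0 dq.
rewrite /p mulr0 expR0 mulr1 mulNr lerN2 => H.
have : q t + e ^+ 2 <= (q 0 + e ^+ 2) * expR K.
  apply: (@le_trans _ _ ((q 0 + e ^+ 2) * expR (K * t))); last first.
    rewrite ler_wpM2l ?addr_ge0 ?sqr_ge0 ?sumr_ge0// => [j _|]; first exact: sqr_ge0.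
    by rewrite ler_expR ler_piMr//; case/andP: t01.
  rewrite -ler_pdivrMr ?expR_gt0// -expRN -mulNr.
  exact: H.
move=> H2.
have : `|d t| ^+ 2 <= (C * (`|d 0| + e)) ^+ 2.
  have := qle t; have := qge 0; rewrite addr0 => q1 q2.
  apply: (le_trans q2); apply: (@le_trans _ _ ((q 0 + e ^+ 2) * expR K)).
    by apply: le_trans H2; rewrite lerDl sqr_ge0.
  apply: (@le_trans _ _ (C * (`|d 0| + e) ^+ 2)).
    rewrite /C -mulrA [expR K * _]mulrC mulrA ler_wpM2r ?expR_ge0//.
    apply: (@le_trans _ _ (n%:R * `|d 0| ^+ 2 + e ^+ 2)); first by rewrite lerD2r.
    have : 0 <= `|d 0| * e by rewrite mulr_ge0.
    have : (0 : R) <= n%:R by [].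
    rewrite -[n.+1%:R]natr1 !expr2 => n0 de.
    have : 0 <= n%:R * (`|d 0| * e) by rewrite mulr_ge0.
    have : 0 <= n%:R * (e * e) by rewrite mulr_ge0// mulr_ge0.
    have : 0 <= `|d 0| * `|d 0| by rewrite mulr_ge0.
    nra.
  rewrite exprMn ler_wpM2r ?sqr_ge0// expr2 ler_peMr//; exact: le_trans C1.
rewrite ler_sqr ?nnegrE// mulr_ge0//; first exact: le_trans C1.
by rewrite addr_ge0.
Qed.

End Gronwall.

(** * Initial value problems by Picard iteration *)

Section Picard.
Context {R : realType}.

Lemma primitive_exists (f : R -> R) : continuous f ->
  exists F : R -> R, forall t, unit_itv t -> is_derive t 1 F (f t).
Proof.
move=> cf.
(* The integral starts at -1 and the fundamental theorem is applied up to 2, so that 0 and 1 are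
   interior and the derivative there is two-sided. *)
exists (fun x => \int[lebesgue_measure]_(t in `[(-1), x]) f t)%R.
move=> t /andP[t0 t1].
have [||||H1 H2] := @continuous_FTC1_closed R f (-1) t 2.
- by lra.
- apply: continuous_compact_integrable; first exact: segment_compact.
  exact: continuous_subspaceT.
- by lra.
- exact: cf.
apply: DeriveDef; first exact: H1.
by rewrite -derive1E; exact: H2.
Qed.

Lemma primitive_exists_rV n (f : R -> 'rV[R]_n) : continuous f ->
  exists F : R -> 'rV[R]_n, forall t, unit_itv t -> is_derive t 1 F (f t).
Proof.
move=> cf.
have H (j : 'I_n) : exists F : R -> R,
    forall t, unit_itv t -> is_derive t 1 F (f t 0 j).
  by apply: primitive_exists => x; have /continuous_mxP := cf x; exact.
have [F HF] := choice H.
exists (fun t => \row_j F j t) => t t01; apply/is_derive_mxP => i j.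
rewrite ord1; under eq_fun do rewrite mxE; exact: HF.
Qed.

(** Some primitive of [f] on [0, 1]; [picard] uses only its increments from 0. *)
Definition prim n (f : R -> 'rV[R]_n) : R -> 'rV[R]_n :=
  xget 0 [set F | forall t, unit_itv t -> is_derive t 1 F (f t)].

Lemma primP n (f : R -> 'rV[R]_n) : continuous f ->
  forall t, unit_itv t -> is_derive t 1 (prim f) (f t).
Proof. by move=> /primitive_exists_rV H; exact: (xgetPex 0 H). Qed.

(** Retraction of the line onto [0, 1]: precomposing with it turns data controlled on [0, 1] into
    continuous functions on the whole line, as [primitive_exists] requires. *)
Definition clamp (t : R) : R := Num.max 0 (Num.min t 1).

Lemma clamp01 t : unit_itv (clamp t).
Proof.
rewrite /unit_itv/clamp/= le_max lexx/= ge_max ler01/=.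
by rewrite ge_min lexx orbT.
Qed.

Lemma clampE t : unit_itv t -> clamp t = t.
Proof. by move=> /andP[t0 t1]; rewrite /clamp min_l// max_r. Qed.

Lemma clamp_continuous : continuous clamp.
Proof.
move=> t; apply: (@continuous_max R R (cst 0) (fun t : R => Num.min t 1)).
  exact: cst_continuous.
apply: (@continuous_min R R id (cst 1)); last exact: cst_continuous.
exact: cvg_id.
Qed.

Lemma clampK t : clamp (clamp t) = clamp t.
Proof. by rewrite clampE//; exact: clamp01. Qed.

Lemma is_derive1_continuous n (f : R -> 'rV[R]_n) (t : R) df :
  is_derive t 1 f df -> {for t, continuous f}.
Proof.
by move=> [fd _]; apply: differentiable_continuous; apply/derivable1_diffP.
Qed.

Lemma clamp_comp_continuous n (f df : R -> 'rV[R]_n) :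
  (forall t, unit_itv t -> is_derive t 1 f (df t)) -> continuous (f \o clamp).
Proof.
move=> fd t; apply: continuous_comp; first exact: clamp_continuous.
exact: is_derive1_continuous (fd _ (clamp01 t)).
Qed.

Lemma geometric_le0 (x B : R) : (forall k, x <= B / 2 ^+ k) -> x <= 0.
Proof.
move=> H; rewrite leNgt; apply/negP => x0.
have B0 : 0 < B by have := H 0%N; rewrite expr0 divr1; exact: lt_le_trans.
have := H (Num.truncn (B / x)).+1; rewrite leNgt => /negP; apply.
rewrite ltr_pdivrMr ?exprn_gt0// mulrC -ltr_pdivrMr//.
apply: (lt_le_trans (truncnS_gt _)).
by rewrite -natrX ler_nat ltnW// ltn_expl.
Qed.

(** The intervals [w k, U k] are nested, so the supremum of their left ends lies in all of them; the
    rate of convergence comes with the limit. *)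
Lemma geometric_limit_scalar (u : nat -> R) A :
  (forall k, `|u k.+1 - u k| <= A / 2 ^+ k) ->
  exists l, forall k, `|l - u k| <= 2 * A / 2 ^+ k.
Proof.
move=> H; pose w k := u k - 2 * A / 2 ^+ k; pose U k := u k + 2 * A / 2 ^+ k.
have step k : 2 * A / 2 ^+ k.+1 = A / 2 ^+ k.
  by rewrite exprS; field; rewrite ?expf_neq0.
have A0 : 0 <= A by have := H 0%N; rewrite expr0 divr1; exact: le_trans.
have Ak k : 0 <= A / 2 ^+ k by rewrite divr_ge0// exprn_ge0.
have Ek k : 2 * A / 2 ^+ k = A / 2 ^+ k + A / 2 ^+ k by rewrite -mulrA mulr_natl mulr2n.
have wS k : w k <= w k.+1.
  rewrite /w step Ek; have := H k; rewrite ler_norml => /andP[]; lra.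
have US k : U k.+1 <= U k.
  rewrite /U step Ek; have := H k; rewrite ler_norml => /andP[]; lra.
have wm : {homo w : i j / (i <= j)%N >-> i <= j}.
  by apply: homo_leq => //; exact: le_trans.
have Um i j : (i <= j)%N -> U j <= U i.
  move=> /subnK <-; elim: (j - i)%N => // k IH.
  by rewrite addSn (le_trans (US _)).
have wU i j : w i <= U j.
  apply: (@le_trans _ _ (w (maxn i j))); first by apply: wm; exact: leq_maxl.
  apply: (@le_trans _ _ (U (maxn i j))); last by apply: Um; exact: leq_maxr.
  by rewrite /w /U Ek; have := Ak (maxn i j); lra.
have hs : has_sup (range w).
  by split; [exists (w 0%N), 0%N|exists (U 0%N) => _ [i _ <-]].
exists (sup (range w)) => k.
have h1 : w k <= sup (range w) by apply: ub_le_sup; [case: hs|exists k].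
have h2 : sup (range w) <= U k.
  by apply: ge_sup; [case: hs|move=> _ [i _ <-]].
move: h1 h2; rewrite /w /U ler_norml => h1 h2.
by apply/andP; split; [rewrite lerBrDl; lra|lra].
Qed.

Lemma geometric_limit n (u : nat -> 'rV[R]_n) A :
  (forall k, `|u k.+1 - u k| <= A / 2 ^+ k) ->
  exists l, forall k, `|l - u k| <= 2 * A / 2 ^+ k.
Proof.
move=> H; have A0 : 0 <= A by have := H 0%N; rewrite expr0 divr1; exact: le_trans.
have H' (j : 'I_n) : exists l, forall k, `|l - u k 0 j| <= 2 * A / 2 ^+ k.
  apply: geometric_limit_scalar => k; apply: le_trans (H k).
  by have := mx_norm_coord (u k.+1 - u k) 0 j; rewrite !mxE.
have [l Hl] := choice H'.
exists (\row_j l j) => k; apply: mx_norm_leP => [|i j].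
  by rewrite divr_ge0 ?mulr_ge0 ?exprn_ge0.
by rewrite ord1 !mxE.
Qed.

(** Weighting distances by exp(2 L1 t) makes the integral operator contract by 1/2 whatever the
    Lipschitz constant, so the solution is obtained on all of [0, 1] at once. *)
Lemma picard n (f : R -> 'rV[R]_n -> 'rV[R]_n) (L : R) :
  (forall y : R -> 'rV[R]_n, continuous y -> continuous (fun t => f t (y t))) ->
  (forall t a b, unit_itv t -> `|f t a - f t b| <= L * `|a - b|) ->
  forall z, exists y : R -> 'rV[R]_n, y 0 = z /\
    forall t, unit_itv t -> is_derive t 1 y (f t (y t)).
Proof.
move=> fc fL0 z.
(* [L] carries no sign hypothesis, so a positive Lipschitz constant replaces it. *)
pose L1 : R := `|L| + 1.
have L10 : 0 < L1 by rewrite ltr_pwDr.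
have fL t a b : unit_itv t -> `|f t a - f t b| <= L1 * `|a - b|.
  move=> t01; apply: (le_trans (fL0 t a b t01)); rewrite ler_wpM2r//.
  by rewrite (le_trans (ler_norm L))// lerDl.
have u0 : unit_itv (0 : R) by rewrite /unit_itv/= lexx ler01.
pose v (y : R -> 'rV[R]_n) t := z + (prim (fun s => f s (y s)) t - prim (fun s => f s (y s)) 0).
have vD y : continuous y -> forall t, unit_itv t -> is_derive t 1 (v y) (f t (y t)).
  move=> cy t t01; have H := primP (fc _ cy) t01.
  have H1 := is_deriveB H (is_derive_cst (prim (fun s => f s (y s)) 0) t 1).
  have := is_deriveD (is_derive_cst z t 1) H1.
  by rewrite add0r subr0.
have v0 y : v y 0 = z by rewrite /v subrr addr0.
have vcmp y1 y2 (G dG : R -> R) : continuous y1 -> continuous y2 ->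
    (forall s, unit_itv s -> is_derive s 1 G (dG s)) ->
    (forall s, unit_itv s -> `|f s (y1 s) - f s (y2 s)| <= dG s) ->
    forall t, unit_itv t -> `|v y1 t - v y2 t| <= G t - G 0.
  move=> c1 c2 GD fG t t01.
  have D s : unit_itv s -> is_derive s 1 (v y1 - v y2) (f s (y1 s) - f s (y2 s)).
    by move=> s01; exact: is_deriveB (vD _ c1 _ s01) (vD _ c2 _ s01).
  have := mean_value_inequality D GD fG t01.
  rewrite -[(v y1 - v y2) t]/(v y1 t - v y2 t) -[(v y1 - v y2) 0]/(v y1 0 - v y2 0).
  by rewrite !v0 subrr subr0.
have linD (c s : R) : is_derive s 1 (fun s : R => c * s) c.
  have := is_deriveZ c (is_derive_id s (1 : R)).
  by rewrite [c *: (1 : R)]mulr1.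
(* Clamping after each step keeps the iterates continuous on the whole line, as [fc] demands. *)
pose u k := iter k (fun y => v y \o clamp) (cst z).
have cu k : continuous (u k).
  elim: k => [|k IH]; first by move=> t; exact: cst_continuous.
  by apply: clamp_comp_continuous (vD _ IH).
have u_0 k : u k 0 = z by case: k => [//|k]; rewrite /u/= clampE.
have uE k t : unit_itv t -> u k.+1 t = v (u k) t by move=> t01; rewrite /u/= clampE.
have uc k t : u k (clamp t) = u k t by case: k => [//|k]; rewrite /u/= clampK.
have [B B0 HB] : exists2 B : R, 0 <= B & forall t, unit_itv t -> `|f t z| <= B.
  have cg : continuous (fun t => `|f t z|).
    by move=> t; apply: cvg_norm; apply: (fc (cst z)); move=> s; exact: cst_continuous.
  have [|c c01 Hc] := @EVT_max R (fun t => `|f t z|) 0 1 (@ler01 R).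
    exact: continuous_subspaceT.
  by exists `|f c z|.
pose E (t : R) := expR (2 * L1 * t).
have E1 t : unit_itv t -> 1 <= E t <= E 1.
  move=> /andP[t0 t1]; rewrite /E -{1}expR0 !ler_expR mulr1.
  have h0 : 0 <= 2 * L1 by rewrite mulr_ge0// ltW.
  by rewrite mulr_ge0//= ler_piMr.
have du k t : unit_itv t -> `|u k.+1 t - u k t| <= B / 2 ^+ k * E t.
  elim: k t => [|k IH] t t01.
    rewrite expr0 divr1 uE//.
    have -> : u 0%N t = v (u 0%N) 0 by rewrite v0.
    apply: (@le_trans _ _ (B * t - B * 0)).
      exact: (mean_value_inequality (vD _ (cu 0%N)) (fun s _ => linD B s) HB t01).
    rewrite mulr0 subr0 ler_wpM2l//.
    by have /andP[+ _] := E1 _ t01; apply: le_trans; case/andP: t01.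
  rewrite !uE//.
  have c0 : 0 <= B / 2 ^+ k.+1 by rewrite divr_ge0// exprn_ge0.
  pose c := B / 2 ^+ k.+1.
  have GD s : unit_itv s -> is_derive s 1 (fun s => c * E s) (c * (2 * L1 * E s)).
    by move=> s01; exact: (is_deriveZ c (is_derive_expRM (2 * L1) s)).
  have fG s : unit_itv s -> `|f s (u k.+1 s) - f s (u k s)| <= c * (2 * L1 * E s).
    move=> s01; apply: (le_trans (fL _ _ _ s01)).
    rewrite (le_trans (ler_wpM2l (ltW L10) (IH _ s01)))//.
    rewrite /c exprS -subr_ge0 le_eqVlt; apply/orP; left; apply/eqP; field.
    by rewrite expf_neq0.
  apply: (le_trans (vcmp _ _ _ _ (cu k.+1) (cu k) GD fG t t01)).
  by rewrite gerBl mulr_ge0// expR_ge0.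
have du' k t : `|u k.+1 t - u k t| <= B * E 1 / 2 ^+ k.
  rewrite -(uc k.+1) -(uc k) (le_trans (du _ _ (clamp01 t)))// mulrAC ler_wpM2r//.
  by rewrite ler_wpM2l//; have /andP[] := E1 _ (clamp01 t).
have [y Hy] := choice (fun t => geometric_limit (fun k => du' k t)).
set A := 2 * (B * E 1) in Hy.
have A0 : 0 <= A by rewrite !mulr_ge0// expR_ge0.
have cy : continuous y.
  move=> t; apply/cvgrPdist_le => e e0.
  have [k Hk] : exists k, A / 2 ^+ k <= e / 3.
    apply: contrapT => /forallNP H.
    have : e / 3 <= 0.
      by apply: (@geometric_le0 _ A) => k; have /negP := H k; rewrite -ltNge => /ltW.
    by rewrite leNgt divr_gt0.
  have /cvgrPdist_le/(_ (e / 3)) := cu k t; rewrite divr_gt0// => /(_ isT).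
  apply: filterS => s Hs.
  have -> : y t - y s = (y t - u k t) + (u k t - u k s) + (u k s - y s).
    by rewrite !subrKA.
  rewrite (le_trans (ler_normD _ _))//.
  apply: (@le_trans _ _ ((e / 3 + e / 3) + e / 3)); last lra.
  rewrite lerD//; last by rewrite distrC (le_trans (Hy _ _)).
  by rewrite (le_trans (ler_normD _ _))// lerD// (le_trans (Hy _ _)).
(* [y] is constant outside [0, 1] and may lack a two-sided derivative at the ends; [v y] has one and
   equals [y] on [0, 1]. *)
exists (v y); split=> [|t t01]; first exact: v0.
suff vy : v y t = y t by rewrite vy; exact: vD.
apply/eqP; rewrite -subr_eq0 -normr_le0.
apply: (@geometric_le0 _ (L1 * A + A / 2)) => k.
rewrite -(subrKA (u k.+1 t)) (le_trans (ler_normD _ _))//.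
rewrite mulrDl lerD//; last first.
  by rewrite distrC (le_trans (Hy _ _))// exprS invfM mulrA.
rewrite uE//.
pose c := L1 * A / 2 ^+ k.
have c0 : 0 <= c by rewrite /c divr_ge0 ?exprn_ge0// mulr_ge0// ltW.
have fG s : unit_itv s -> `|f s (y s) - f s (u k s)| <= c.
  by move=> s01; rewrite (le_trans (fL _ _ _ s01))// /c -mulrA ler_wpM2l// ltW.
apply: (le_trans (vcmp _ _ _ _ cy (cu k) (fun s _ => linD c s) fG t t01)).
by rewrite mulr0 subr0 ler_piMr//; case/andP: t01.
Qed.

End Picard.

(** * Smooth dependence on initial values *)

Section flow_of_a_field.
Context {R : realType}.

Lemma strict_diff_rV n p (Z : 'rV[R]_n -> 'rV[R]_p) (U : set 'rV[R]_n) x (e : R) :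
  open U -> U x -> 0 < e -> Ck 1 U Z ->
  \forall d \near 0^'+, forall y h, `|y - x| <= d -> `|h| <= d ->
    `|Z (h + y) - Z y - 'D_h Z x| <= e * `|h|.
Proof.
move=> oU Ux e0 Zk.
have Zj (j : 'I_p) : Ck 1 U (fun y => Z y 0 j) by move/(Ck_rVP _ _ oU) : Zk; exact.
have : \forall d \near (0:R)^'+, forall j : 'I_p, forall y h, `|y - x| <= d -> `|h| <= d ->
    `|Z (h + y) 0 j - Z y 0 j - 'D_h (fun y => Z y 0 j) x| <= e * `|h|.
  apply: filter_forall => j.
  have := strict_diff_scalar oU Ux e0 (fun k y Uy => @ex_derive _ _ _ _ _ _ _ (Ck_is_derive (delta_mx 0 k : 'rV[R]_n) (Zj j) Uy))
    (fun k => Ck_continuous (Ck_derive (delta_mx 0 k : 'rV[R]_n) (Zj j)) Ux).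
  apply: filterS => d H y h yd hd.
  by rewrite (C1_derive_sum_scalar _ oU Ux (Zj j)); exact: H.
apply: filterS => d H y h yd hd; apply: mx_norm_leP => [|i j].
  by rewrite mulr_ge0// ltW.
rewrite ord1 !mxE.
have [_ ] := Ck_is_derive h Zk Ux; have /is_derive_mxP/(_ 0 j)[_ <-] := Ck_is_derive h Zk Ux.
by move=> _; exact: H.
Qed.

(** The bound is uniform in the direction [h]: the derivative is linear in [h], so control in the n
    basis directions suffices. *)
Lemma derive_continuous_unif n p (Z : 'rV[R]_n -> 'rV[R]_p) (U : set 'rV[R]_n) x (e : R) :
  open U -> U x -> 0 < e -> Ck 1 U Z ->
  \forall y \near x, forall h, `|'D_h Z y - 'D_h Z x| <= e * `|h|.
Proof.
move=> oU Ux e0 Zk.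
pose e1 := e / n.+1%:R.
have e10 : 0 < e1 by rewrite divr_gt0.
have H : \forall y \near x, forall j : 'I_n,
    `|'D_(delta_mx 0 j : 'rV[R]_n) Z x - 'D_(delta_mx 0 j : 'rV[R]_n) Z y| <= e1.
  apply: (@filter_forall _ _ _ (nbhs x)) => j.
  by have /cvgrPdist_le/(_ _ e10) := Ck_continuous (Ck_derive (delta_mx 0 j : 'rV[R]_n) Zk) Ux.
apply: filterS2 H (open_nbhs_nbhs (conj oU Ux)) => y H Uy h.
rewrite (C1_derive_sum _ oU Uy Zk) (C1_derive_sum _ oU Ux Zk) -sumrB.
apply: (le_trans (ler_norm_sum _ _ _)).
apply: (@le_trans _ _ (\sum_(j < n) e1 * `|h|)).
  apply: ler_sum => j _; rewrite -scalerBr normrZ mulrC distrC.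
  by apply: ler_pM => //; exact: mx_norm_coord.
rewrite sumr_const card_ord -[_ *+ n]mulr_natr mulrAC ler_wpM2r//.
by rewrite /e1 mulrAC ler_pdivrMr ?ltr0n// ler_wpM2l ?(ltW e0) ?ler_nat.
Qed.

Lemma derive_bound n p (Z : 'rV[R]_n -> 'rV[R]_p) (U : set 'rV[R]_n) x :
  open U -> U x -> Ck 1 U Z ->
  exists2 B : R, 0 <= B & forall h, `|'D_h Z x| <= B * `|h|.
Proof.
move=> oU Ux Zk.
exists (\sum_(j < n) `|'D_(delta_mx 0 j : 'rV[R]_n) Z x|); first by apply: sumr_ge0.
move=> h; rewrite (C1_derive_sum _ oU Ux Zk) mulr_suml.
apply: (le_trans (ler_norm_sum _ _ _)); apply: ler_sum => j _.
by rewrite normrZ mulrC ler_wpM2l//; exact: mx_norm_coord.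
Qed.

(** A single parameter [d] serves both as a radius [d] and as a bound [d^-1]. Shrinking it relaxes
    both requirements, so statements near 0 combine radii and constants at once. *)
Lemma near0_inv_ge (B : R) : \forall d \near 0^'+, B <= d^-1.
Proof.
have [B0|B0] := leP B 0.
  near=> d; rewrite (le_trans B0)// invr_ge0.
  by near: d; exact: nbhs_right_ge.
near=> d.
have d0 : 0 < d by near: d; exact: nbhs_right_gt.
rewrite -[B]invrK lef_pV2 ?posrE ?invr_gt0//.
by near: d; apply: nbhs_right_le; rewrite invr_gt0.
Unshelve. all: by end_near. Qed.

Lemma local_lipschitz n (Z : 'rV[R]_n -> 'rV[R]_n) (U : set 'rV[R]_n) x :
  open U -> U x -> Ck 1 U Z ->
  \forall d \near 0^'+, forall y y', `|y - x| <= d -> `|y' - x| <= d ->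
    U y /\ `|Z y - Z y'| <= d^-1 * `|y - y'|.
Proof.
move=> oU Ux Zk.
have [B B0 HB] := derive_bound oU Ux Zk.
have H := strict_diff_rV oU Ux ltr01 Zk.
have [d0 /= [d00 Hd0]] := filter_ex (filterI (nbhs_right_gt (0 : R)) H).
have /nbhs_ballP[r /= r0 Hr] := open_nbhs_nbhs (conj oU Ux).
near=> d => y y' yd yd'.
split.
  apply: Hr; rewrite -ball_normE/= distrC (le_lt_trans yd)//.
have hd : `|y - y'| <= d0.
  rewrite -(subrKA x) (le_trans (ler_normD _ _))//.
  rewrite [`|x - y'|]distrC (le_trans (lerD yd yd'))//.
  have : d <= d0 / 2 by near: d; apply: nbhs_right_le; rewrite divr_gt0.
  lra.
have := Hd0 y' (y - y'); rewrite subrK => /(_ _ hd) H1.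
apply: (@le_trans _ _ ((1 + B) * `|y - y'|)); last first.
  by rewrite ler_wpM2r//; near: d; exact: near0_inv_ge.
rewrite mulrDl -[Z y - Z y'](subrK ('D_(y - y') Z x)) (le_trans (ler_normD _ _))// lerD//.
apply: H1; rewrite (le_trans yd')//; near: d; exact: nbhs_right_le.
Unshelve. all: by end_near. Qed.

(** Compactness of [0, 1]: a bound valid around each time becomes valid at all times with one
    [d]. *)
Lemma near_unit_itv (P : R -> R -> Prop) :
  (forall t, unit_itv t -> exists2 A : set R, nbhs t A &
    \forall d \near 0^'+, forall t', A t' -> P d t') ->
  \forall d \near 0^'+, forall t, unit_itv t -> P d t.
Proof.
move=> H.
have /compact_near_coveringP/(_ R (0 : R)^'+ P _) := @segment_compact R 0 1.
apply.
move=> t; rewrite /= in_itv/= => t01.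
have [A tA HA] := H t t01.
exists (A, [set d | forall t', A t' -> P d t']); first by split.
by move=> [t' d] [/= At' Hd]; exact: Hd.
Qed.

Definition is_sol n (U : set 'rV[R]_n) (Z : 'rV[R]_n -> 'rV[R]_n) (y : R -> 'rV[R]_n) :=
  forall t, unit_itv t -> U (y t) /\ is_derive t 1 y (Z (y t)).

Lemma unit0 : unit_itv (0 : R).
Proof. by rewrite /unit_itv/= lexx ler01. Qed.

Lemma unit1 : unit_itv (1 : R).
Proof. by rewrite /unit_itv/= lexx ler01. Qed.

Lemma near_comp (T S : topologicalType) (f : T -> S) t (P : set S) :
  {for t, continuous f} -> (\forall z \near f t, P z) ->
  \forall s \near t, P (f s).
Proof. by move=> cf HP; exact: cf. Qed.

Section one_solution.
Context {n : nat} (U : set 'rV[R]_n) (Z : 'rV[R]_n -> 'rV[R]_n) (y : R -> 'rV[R]_n).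
Hypotheses (oU : open U) (Zk : Ck 1 U Z) (ys : is_sol U Z y).

Lemma sol_continuous t : unit_itv t -> {for t, continuous y}.
Proof. by move=> /ys[_]; exact: is_derive1_continuous. Qed.

Lemma sol_near t (d : R) : unit_itv t -> 0 < d ->
  nbhs t [set t' | `|y t' - y t| <= d].
Proof.
move=> /sol_continuous /cvgrPdist_le /[apply].
by apply: filterS => s; rewrite /= distrC.
Qed.

Lemma sol_tube : \forall d \near 0^'+, forall t, unit_itv t ->
  forall h h', `|h| <= d -> `|h'| <= d ->
    U (h + y t) /\ `|Z (h + y t) - Z (h' + y t)| <= d^-1 * `|h - h'|.
Proof.
apply: near_unit_itv => t t01.
have [d0 /= [d00 Hd0]] := filter_ex (filterI (nbhs_right_gt (0 : R))
  (local_lipschitz oU (ys t01).1 Zk)).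
exists [set t' | `|y t' - y t| <= d0 / 2]; first by apply: sol_near => //; rewrite divr_gt0.
near=> d => t' /= tt' h h' hd hd'.
have d2 : d <= d0 / 2 by near: d; apply: nbhs_right_le; rewrite divr_gt0.
have B k : `|k| <= d -> `|k + y t' - y t| <= d0.
  move=> kd; rewrite -addrA (le_trans (ler_normD _ _))//.
  by have := lerD kd tt'; lra.
have [Uh Zh] := Hd0 _ _ (B _ hd) (B _ hd').
split=> //; apply: (le_trans Zh); rewrite opprD addrACA subrr addr0 ler_wpM2r//.
by near: d; exact: near0_inv_ge.
Unshelve. all: by end_near. Qed.

Lemma sol_derive_bound : exists2 B : R, 0 <= B & forall t, unit_itv t ->
  forall h, `|'D_h Z (y t)| <= B * `|h|.
Proof.
have H : \forall d \near 0^'+, forall t, unit_itv t ->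
  forall h, `|'D_h Z (y t)| <= d^-1 * `|h|.
  apply: near_unit_itv => t t01.
  have [Ut _] := ys t01.
  have [B B0 HB] := derive_bound oU Ut Zk.
  have H := derive_continuous_unif oU Ut ltr01 Zk.
  exists [set t' | forall h, `|'D_h Z (y t') - 'D_h Z (y t)| <= 1 * `|h|].
    exact: (near_comp (sol_continuous t01) H).
  have := near0_inv_ge (1 + B); apply: filterS => d dB t' /= tt' h.
  apply: (@le_trans _ _ ((1 + B) * `|h|)); last by rewrite ler_wpM2r.
  rewrite mulrDl -['D_h Z (y t')](subrK ('D_h Z (y t))).
  by rewrite (le_trans (ler_normD _ _))// lerD.
have [d /= [d0 Hd]] := filter_ex (filterI (nbhs_right_gt (0 : R)) H).
by exists d^-1 => //; rewrite invr_ge0 ltW.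
Qed.

Lemma sol_unif_diff (e : R) : 0 < e -> \forall d \near 0^'+, forall t, unit_itv t ->
  forall h, `|h| <= d -> `|Z (h + y t) - Z (y t) - 'D_h Z (y t)| <= e * `|h|.
Proof.
move=> e0; have e20 : 0 < e / 2 by rewrite divr_gt0.
apply: near_unit_itv => t t01; have [Ut _] := ys t01.
have [d0 /= [d00 Hd0]] := filter_ex (filterI (nbhs_right_gt (0 : R))
  (strict_diff_rV oU Ut e20 Zk)).
exists ([set t' | `|y t' - y t| <= d0] `&`
   [set t' | forall h, `|'D_h Z (y t') - 'D_h Z (y t)| <= e / 2 * `|h|]).
  apply: filterI; first exact: sol_near.
  exact: (near_comp (sol_continuous t01) (derive_continuous_unif oU Ut e20 Zk)).
near=> d => t' [/= tt' DD] h hd.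
have H1 := Hd0 (y t') h tt'.
rewrite -[_ - 'D_h Z (y t')](subrKA ('D_h Z (y t))) (le_trans (ler_normD _ _))//.
rewrite [leRHS](_ : _ = e / 2 * `|h| + e / 2 * `|h|); last by rewrite -mulrDl -splitr.
rewrite lerD//; last by rewrite distrC.
by apply: H1; rewrite (le_trans hd)//; near: d; exact: nbhs_right_le.
Unshelve. all: by end_near. Qed.

(** Projection onto the sup-norm ball of radius [d]; acting coordinatewise, it increases no
    distance. *)
Definition clampv (d : R) (w : 'rV[R]_n) : 'rV[R]_n :=
  \row_j Num.max (- d) (Num.min d (w 0 j)).

Lemma clampv_norm d w : 0 <= d -> `|clampv d w| <= d.
Proof.
move=> d0; apply: mx_norm_leP => // i j; rewrite !mxE ler_norml.
rewrite le_max lexx/= ge_max ge_min lexx/= andbT; lra.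
Qed.

Lemma clampv_id d w : `|w| <= d -> clampv d w = w.
Proof.
move=> wd; apply/rowP => j; rewrite !mxE.
have := le_trans (mx_norm_coord w 0 j) wd; rewrite ler_norml => /andP[w1 w2].
by rewrite min_r// max_r.
Qed.

Lemma clampv_lip d w w' : 0 <= d -> `|clampv d w - clampv d w'| <= `|w - w'|.
Proof.
move=> d0; apply: mx_norm_leP => // i j; rewrite ord1.
apply: (le_trans _ (mx_norm_coord _ 0 j)); rewrite !mxE.
move: (w 0 j) (w' 0 j) => a b.
have N1 := ler_norm (a - b); have N2 := ler_norm (b - a).
rewrite distrC in N2; rewrite ler_norml.
by rewrite /Num.max /Num.min; do !case: ifPn; rewrite -?leNgt => *;
  apply/andP; split; lra.
Qed.

End one_solution.
End flow_of_a_field.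

(** * The time-one map: existence nearby, uniqueness, first derivative *)

Section time_one_map.
Context {R : realType}.

Lemma continuous_normI (E F : normedModType R) (f : E -> F) x :
  (forall e : R, 0 < e -> \forall y \near x, `|f x - f y| <= e) ->
  {for x, continuous f}.
Proof. by move=> H; apply/cvgrPdist_le. Qed.

Lemma near_norm_le (E : normedModType R) (x : E) (e : R) :
  0 < e -> \forall y \near x, `|x - y| <= e.
Proof.
by move=> e0; apply/nbhs_ballP; exists e => // y; rewrite -ball_normE/= => /ltW.
Qed.

Lemma clampv_continuous n (d : R) : 0 <= d -> continuous (@clampv R n d).
Proof.
move=> d0 w; apply: continuous_normI => e e0.
have H := near_norm_le w e0.
by apply: filterS H => w' H; apply: le_trans (clampv_lip _ _ d0) H.
Qed.

Lemma flow_nearby n (U : set 'rV[R]_n) Z y0 : open U -> Ck 1 U Z -> is_sol U Z y0 ->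
  exists2 C : R, 0 < C & exists2 r : R, 0 < r & forall z, `|z - y0 0| <= r ->
    exists y, [/\ is_sol U Z y, y 0 = z &
      forall t, unit_itv t -> `|y t - y0 t| <= C * `|z - y0 0|].
Proof.
move=> oU Zk ys.
(* Z is truncated to a tube around y0, where it is Lipschitz; for z close to
   y0 0, Gronwall's inequality keeps the solution inside the tube. *)
have [d /= [d0 Hd]] := filter_ex (filterI (nbhs_right_gt (0 : R)) (sol_tube oU Zk ys)).
have [C C1 HC] := @gronwall R n d^-1 (ltW (eq_ind_r is_true d0 (invr_gt0 d))).
have C0 : 0 < C by exact: lt_le_trans C1.
exists C => //; exists (d / C); first by rewrite divr_gt0.
move=> z zr.
pose f t (a : 'rV[R]_n) := Z (clampv d (a - y0 (clamp t)) + y0 (clamp t)).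
have cy0 : continuous (fun t => y0 (clamp t)).
  by apply: clamp_comp_continuous => t t01; exact: (ys t t01).2.
have [w cw|t a b t01|y [yz yD]] := @picard R n f d^-1 _ _ z.
- have ci : continuous (fun t => clampv d (w t - y0 (clamp t)) + y0 (clamp t)).
    move=> t; apply: cvgD; last exact: cy0.
    apply: (@continuous_comp _ _ _ (fun t => w t - y0 (clamp t)) (clampv d)).
      by apply: cvgB; [exact: cw|exact: cy0].
    exact/clampv_continuous/ltW.
  move=> t; apply: (@continuous_comp _ _ _ (fun t => clampv d (w t - y0 (clamp t)) + y0 (clamp t)) Z).
    exact: ci.
  have [|] := Hd _ (clamp01 t) (clampv d (w t - y0 (clamp t))) 0 (clampv_norm _ (ltW d0)).
    by rewrite normr0 ltW.
  by move=> Ut _; exact: Ck_continuous Zk Ut.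
- have [_ H] := Hd _ (clamp01 t) _ _ (clampv_norm (a - y0 (clamp t)) (ltW d0))
    (clampv_norm (b - y0 (clamp t)) (ltW d0)).
  apply: (le_trans H); rewrite ler_wpM2l ?invr_ge0 ?(ltW d0)//.
  apply: (le_trans (clampv_lip _ _ (ltW d0))).
  by rewrite opprB addrA subrK.
have close t : unit_itv t -> `|y t - y0 t| <= C * `|z - y0 0|.
  move=> t01.
  have := HC (y - y0) (fun t => f t (y t) - Z (y0 t)) 0 (lexx 0) _ _ t t01.
  rewrite addr0 -[(y - y0) t]/(y t - y0 t) -[(y - y0) 0]/(y 0 - y0 0) yz; apply.
    move=> s s01; apply: is_deriveB; first exact: yD.
    exact: (ys s s01).2.
  move=> s s01; rewrite addr0 -[(y - y0) s]/(y s - y0 s).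
  rewrite /f clampE//.
  have [|_ H] := Hd _ s01 _ 0 (clampv_norm (y s - y0 s) (ltW d0)).
    by rewrite normr0 ltW.
  rewrite add0r subr0 in H; apply: (le_trans H).
  rewrite ler_wpM2l ?invr_ge0 ?(ltW d0)//.
  have := clampv_lip (y s - y0 s) 0 (ltW d0).
  by rewrite subr0 (@clampv_id _ _ d 0) ?subr0// normr0 ltW.
exists y; split=> // t t01.
have yd : `|y t - y0 t| <= d.
  by rewrite (le_trans (close _ t01))// -ler_pdivlMl// mulrC.
have := yD _ t01; rewrite /f clampE// clampv_id// subrK => yt; split=> //.
have [|+ _] := Hd _ t01 _ 0 yd; first by rewrite normr0 ltW.
by rewrite subrK.
Qed.

(** Gronwall needs one constant comparing |Z y1 - Z y2| with |y1 - y2| along the pair, though [U]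
    may contain no segment between the two points. Around a time where the curves meet, the local
    Lipschitz bound serves; where they differ, their distance stays away from 0 while the difference
    of [Z] is bounded. *)
Lemma sol_unique n (U : set 'rV[R]_n) Z y1 y2 : open U -> Ck 1 U Z ->
  is_sol U Z y1 -> is_sol U Z y2 -> y1 0 = y2 0 ->
  forall t, unit_itv t -> y1 t = y2 t.
Proof.
move=> oU Zk s1 s2 y12.
have : \forall d \near 0^'+, forall t, unit_itv t ->
    `|Z (y1 t) - Z (y2 t)| <= d^-1 * `|y1 t - y2 t|.
  apply: near_unit_itv => t t01.
  have [U1 _] := s1 t t01; have [U2 _] := s2 t t01.
  have [yt|yt] := eqVneq (y1 t) (y2 t).
    have [d0 /= [d00 Hd0]] := filter_ex (filterI (nbhs_right_gt (0 : R))
      (local_lipschitz oU U1 Zk)).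
    exists ([set t' | `|y1 t' - y1 t| <= d0] `&` [set t' | `|y2 t' - y2 t| <= d0]).
      by apply: filterI; [exact: (sol_near s1)|exact: (sol_near s2)].
    near=> d => t' [/= n1 n2].
    rewrite -yt in n2; have [_ H] := Hd0 _ _ n1 n2.
    apply: (le_trans H); rewrite ler_wpM2r//; near: d; exact: near0_inv_ge.
  pose c := `|y1 t - y2 t|.
  have c0 : 0 < c by rewrite normr_gt0 subr_eq0.
  have c4 : 0 < c / 4 by rewrite divr_gt0.
  (* Near [t] each of the two values of [Z] moves by at most 1, and each curve by at most c / 4,
     which leaves a distance of at least c / 2. *)
  pose B := `|Z (y1 t) - Z (y2 t)| + 2.
  have Zn y : is_sol U Z y -> nbhs t [set t' | `|Z (y t') - Z (y t)| <= 1].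
    move=> sy.
    have cZ : {for t, continuous (fun t => Z (y t))}.
      apply: (@continuous_comp _ _ _ y Z); first exact: (sol_continuous sy).
      exact: Ck_continuous Zk (sy t t01).1.
    have /cvgrPdist_le/(_ _ (@ltr01 R)) := cZ.
    by apply: filterS => r; rewrite /= distrC.
  exists (([set t' | `|y1 t' - y1 t| <= c / 4] `&` [set t' | `|y2 t' - y2 t| <= c / 4])
    `&` ([set t' | `|Z (y1 t') - Z (y1 t)| <= 1] `&` [set t' | `|Z (y2 t') - Z (y2 t)| <= 1])).
    apply: filterI; first by apply: filterI; [exact: (sol_near s1)|exact: (sol_near s2)].
    by apply: filterI; exact: Zn.
  near=> d => t' [/= [n1 n2] [z1 z2]].
  have h1 : c / 2 <= `|y1 t' - y2 t'|.
    have : c <= `|y1 t - y1 t'| + `|y1 t' - y2 t'| + `|y2 t' - y2 t|.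
      rewrite /c -(subrKA (y2 t')) (le_trans (ler_normD _ _))// lerD2r.
      by rewrite -(subrKA (y1 t')) (le_trans (ler_normD _ _)).
    rewrite distrC in n1; lra.
  have h2 : `|Z (y1 t') - Z (y2 t')| <= B.
    have : `|Z (y1 t') - Z (y2 t')| <= `|Z (y1 t') - Z (y1 t)| + `|Z (y1 t) - Z (y2 t)| + `|Z (y2 t) - Z (y2 t')|.
      rewrite -(subrKA (Z (y2 t))) (le_trans (ler_normD _ _))// lerD2r.
      by rewrite -(subrKA (Z (y1 t))) (le_trans (ler_normD _ _)).
    rewrite distrC in z2; rewrite /B; lra.
  apply: (le_trans h2); apply: (@le_trans _ _ (d^-1 * (c / 2))).
    rewrite -ler_pdivrMr ?divr_gt0//; near: d; exact: near0_inv_ge.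
  by rewrite ler_wpM2l// invr_ge0; near: d; exact: nbhs_right_ge.
move=> H; have [d /= [d0 Hd]] := filter_ex (filterI (nbhs_right_gt (0 : R)) H).
have di : 0 <= d^-1 by rewrite invr_ge0 ltW.
have [C C1 HC] := @gronwall R n d^-1 di.
move=> t t01; apply/eqP; rewrite -subr_eq0 -normr_le0.
have := HC (y1 - y2) (fun t => Z (y1 t) - Z (y2 t)) 0 (lexx 0) _ _ t t01.
rewrite -[(y1 - y2) t]/(y1 t - y2 t) -[(y1 - y2) 0]/(y1 0 - y2 0) y12 subrr normr0 addr0 mulr0; apply.
  by move=> s s01; apply: is_deriveB; [exact: (s1 s s01).2|exact: (s2 s s01).2].
by move=> s s01; rewrite addr0; exact: Hd.
Unshelve. all: by end_near. Qed.

Definition flow_domain n (U : set 'rV[R]_n) Z : set 'rV[R]_n :=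
  [set z | exists2 y, is_sol U Z y & y 0 = z].

(** Default 0 outside [flow_domain]; inside, [time1E] shows the value independent of the solution
    picked. *)
Definition time1 n (U : set 'rV[R]_n) Z z : 'rV[R]_n :=
  xget 0 [set w | exists2 y, is_sol U Z y & y 0 = z /\ y 1 = w].

Lemma time1E n (U : set 'rV[R]_n) Z y : open U -> Ck 1 U Z -> is_sol U Z y ->
  time1 U Z (y 0) = y 1.
Proof.
move=> oU Zk ys; rewrite /time1; case: xgetP => [w _ [y' ys' [y0 <-]]|H].
  by apply: (sol_unique oU Zk ys' ys y0); exact: unit1.
by have := H (y 1); case; exists y.
Qed.

Lemma flow_domain_open n (U : set 'rV[R]_n) Z : open U -> Ck 1 U Z ->
  open (flow_domain U Z).
Proof.
move=> oU Zk; rewrite openE => z [y ys yz].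
have [C C0 [r r0 Hr]] := flow_nearby oU Zk ys.
apply/nbhs_ballP; exists r => // z'; rewrite -ball_normE/= => zz'.
have [|y' [ys' y'z _]] := Hr z'; first by rewrite yz distrC ltW.
by exists y'.
Qed.

Lemma time1_continuous n (U : set 'rV[R]_n) Z z : open U -> Ck 1 U Z ->
  flow_domain U Z z -> {for z, continuous (time1 U Z)}.
Proof.
move=> oU Zk [y ys yz].
have [C C0 [r r0 Hr]] := flow_nearby oU Zk ys.
apply: continuous_normI => e e0.
have H : \forall z' \near z, `|z - z'| <= Num.min r (e / C).
  by apply: near_norm_le; rewrite lt_min r0 divr_gt0.
apply: filterS H => z'; rewrite le_min => /andP[zr ze].
have [|y' [ys' y'z Hy]] := Hr z'; first by rewrite yz distrC.
rewrite -yz -y'z !time1E//.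
rewrite distrC (le_trans (Hy _ unit1))// yz distrC -ler_pdivlMl//.
by rewrite mulrC.
Qed.

Lemma derive_dirZ n p (Z : 'rV[R]_n -> 'rV[R]_p) (U : set 'rV[R]_n) x (c : R) a :
  open U -> U x -> Ck 1 U Z -> 'D_(c *: a) Z x = c *: 'D_a Z x.
Proof.
move=> oU Ux Zk; have Zd := C1_differentiable_mx oU Ux Zk.
by rewrite !deriveE// linearZ.
Qed.

Lemma derive_dirB n p (Z : 'rV[R]_n -> 'rV[R]_p) (U : set 'rV[R]_n) x a b :
  open U -> U x -> Ck 1 U Z -> 'D_(a - b) Z x = 'D_a Z x - 'D_b Z x.
Proof.
move=> oU Ux Zk; have Zd := C1_differentiable_mx oU Ux Zk.
by rewrite !deriveE// linearB.
Qed.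

(** The variational equation is linear with coefficients bounded along the trajectory, hence
    globally Lipschitz: its solution lasts for all of [0, 1]. *)
Lemma sol_variation n (U : set 'rV[R]_n) Z y v : open U -> Ck 1 U Z ->
  is_sol U Z y -> exists w : R -> 'rV[R]_n, w 0 = v /\
    forall t, unit_itv t -> is_derive t 1 w ('D_(w t) Z (y t)).
Proof.
move=> oU Zk ys.
have [B B0 HB] := sol_derive_bound oU Zk ys.
pose f t (a : 'rV[R]_n) := 'D_a Z (y (clamp t)).
have cy : continuous (fun t => y (clamp t)).
  by apply: clamp_comp_continuous => t t01; exact: (ys t t01).2.
have [w cw|t a b t01|w [w0 wD]] := @picard R n f B _ _ v.
- move=> t; rewrite /f.
  have -> : (fun t => 'D_(w t) Z (y (clamp t))) = (fun t => \sum_(j < n) w t 0 j *: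
      'D_(delta_mx 0 j : 'rV[R]_n) Z (y (clamp t))).
    by apply/funext => s; rewrite (C1_derive_sum _ oU (ys _ (clamp01 s)).1 Zk).
  apply: (@cvg_sumr _ _ _ (nbhs t)) => j _; apply: cvgZ.
    by have /continuous_mxP := cw t; exact.
  apply: (@continuous_comp _ _ _ (fun t => y (clamp t)) ('D_(delta_mx 0 j : 'rV[R]_n) Z)).
    exact: cy.
  exact: Ck_continuous (Ck_derive _ Zk) (ys _ (clamp01 t)).1.
- rewrite /f -(derive_dirB _ _ oU (ys _ (clamp01 t)).1 Zk).
  exact: HB (clamp01 t) _.
exists w; split=> // t t01.
by have := wD t t01; rewrite /f clampE.
Qed.

Lemma is_derive_norm_bound n p (f : 'rV[R]_n -> 'rV[R]_p) x v df :
  (forall e : R, 0 < e -> exists2 d, 0 < d & forall h : R, `|h| <= d ->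
    `|f (h *: v + x) - f x - h *: df| <= e * `|h|) ->
  is_derive x v f df.
Proof.
move=> H.
have cv : (fun h : R => h^-1 *: ((f \o shift x) (h *: v) - f x)) @ 0^' --> df.
  apply/cvgrPdist_le => e e0; have [d d0 Hd] := H e e0.
  near=> h.
  have h0 : h != 0 by near: h; exact: nbhs_dnbhs_neq.
  have hd : `|h| <= d by near: h; exact: dnbhs0_le.
  rewrite -(ler_pM2r (_ : 0 < `|h|)) ?normr_gt0//.
  rewrite mulrC -normrZ scalerBr scalerA divff// scale1r distrC /=.
  exact: Hd.
by split; [apply/cvg_ex; exists df|exact/cvg_lim].
Unshelve. all: by end_near. Qed.

(** The remainder yh - y - h w vanishes at time 0 and solves the variational equation up to an o(h)
    error, so by Gronwall it is o(h) at time 1. *)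
Lemma time1_derive n (U : set 'rV[R]_n) Z y w : open U -> Ck 1 U Z ->
  is_sol U Z y ->
  (forall t, unit_itv t -> is_derive t 1 w ('D_(w t) Z (y t))) ->
  is_derive (y 0) (w 0) (time1 U Z) (w 1).
Proof.
move=> oU Zk ys wD.
have [C C0 [r r0 Hr]] := flow_nearby oU Zk ys.
have [B B0 HB] := sol_derive_bound oU Zk ys.
have [C2 C21 HC2] := @gronwall R n B B0.
have C20 : 0 < C2 by exact: lt_le_trans C21.
apply: is_derive_norm_bound => e e0.
pose N := `|w 0| + 1.
have N0 : 0 < N by rewrite ltr_pwDr.
(* [N] bounds the initial displacement per unit of [h], [C] the separation of trajectories and [C2]
   is the Gronwall factor; their product cancels at the end. *)
pose e1 := e / (C2 * C * N).
have e10 : 0 < e1 by rewrite divr_gt0// !mulr_gt0.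
have [d /= [d0 Hd]] := filter_ex (filterI (nbhs_right_gt (0 : R)) (sol_unif_diff oU Zk ys e10)).
(* The first bound puts the displaced start in the range of [flow_nearby], the second keeps the
   displaced trajectory within [d]. *)
exists (Num.min (r / N) (d / (C * N))).
  by rewrite lt_min !divr_gt0// mulr_gt0.
move=> h; rewrite le_min => /andP[hr hd].
have hw : `|h *: w 0| <= `|h| * N by rewrite normrZ ler_wpM2l// lerDl.
have [|yh [yhs yh0 Hyh]] := Hr (h *: w 0 + y 0).
  by rewrite addrK (le_trans hw)// -ler_pdivlMr.
rewrite -yh0 !time1E//.
rewrite addrK in Hyh.
have eta t : unit_itv t -> `|yh t - y t| <= C * (`|h| * N).
  by move=> t01; rewrite (le_trans (Hyh _ t01))// ler_wpM2l// ltW.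
have CN0 : 0 <= C * (`|h| * N) by rewrite !mulr_ge0// ltW.
pose dl := yh - y - (fun t => h *: w t).
have dlD t : unit_itv t -> is_derive t 1 dl (Z (yh t) - Z (y t) - h *: 'D_(w t) Z (y t)).
  move=> t01; apply: is_deriveB.
    by apply: is_deriveB; [exact: (yhs t t01).2|exact: (ys t t01).2].
  by apply: is_deriveZ; exact: wD.
have dlE t : dl t = yh t - y t - h *: w t by [].
have := HC2 dl _ (e1 * (C * (`|h| * N))) _ dlD _ 1 unit1.
rewrite !dlE yh0 addrK subrr normr0 add0r => /(_ _ _) H.
apply: (le_trans (H _ _)).
- by rewrite mulr_ge0// ltW.
- move=> t t01.
  have -> : Z (yh t) - Z (y t) - h *: 'D_(w t) Z (y t) =
      'D_(dl t) Z (y t) + (Z ((yh t - y t) + y t) - Z (y t) - 'D_(yh t - y t) Z (y t)).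
    have Uy := (ys t t01).1.
    rewrite subrK dlE (derive_dirB _ _ oU Uy Zk) (derive_dirZ _ _ oU Uy Zk).
    by rewrite [RHS]addrC addrA subrK.
  rewrite (le_trans (ler_normD _ _))// lerD//; first exact: HB.
  rewrite (le_trans (Hd _ t01 _ _))//.
    rewrite (le_trans (eta _ t01))// mulrA [C * _]mulrC -mulrA -ler_pdivlMr ?mulr_gt0//.
  by rewrite ler_wpM2l ?(ltW e10)// eta.
- rewrite /e1 le_eqVlt; apply/orP; left; apply/eqP; field.
  by rewrite !gt_eqF.
Qed.

End time_one_map.

(** * Smoothness of the flow in time and initial point *)

Section smooth_flow.
Context {R : realType}.

Lemma Ck_coord n k (U : set 'rV[R]_n) j : open U -> Ck k U (fun v : 'rV[R]_n => v 0 j).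
Proof. by move=> oU; have /(Ck_rVP _ _ oU) := @Ck_id R _ k U; exact. Qed.

Lemma Ck_lsubmx n p k (U : set 'rV[R]_(n + p)) : open U ->
  Ck k U (lsubmx : 'rV[R]_(n + p) -> 'rV_n).
Proof.
move=> oU; apply/(Ck_rVP _ _ oU) => j; under eq_fun do rewrite mxE.
exact: Ck_coord.
Qed.

Lemma Ck_rsubmx n p k (U : set 'rV[R]_(n + p)) : open U ->
  Ck k U (rsubmx : 'rV[R]_(n + p) -> 'rV_p).
Proof.
move=> oU; apply/(Ck_rVP _ _ oU) => j; under eq_fun do rewrite mxE.
exact: Ck_coord.
Qed.

Lemma lsubmx_continuous n p : continuous (lsubmx : 'rV[R]_(n + p) -> 'rV_n).
Proof. by move=> v; exact: (Ck_continuous (Ck_lsubmx 0 openT)). Qed.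

Lemma rsubmx_continuous n p : continuous (rsubmx : 'rV[R]_(n + p) -> 'rV_p).
Proof. by move=> v; exact: (Ck_continuous (Ck_rsubmx 0 openT)). Qed.

Lemma Ck_row_mx (E : normedModType R) n p k (U : set E) (f : E -> 'rV[R]_n)
    (g : E -> 'rV[R]_p) : open U -> Ck k U f -> Ck k U g ->
  Ck k U (fun x => row_mx (f x) (g x)).
Proof.
move=> oU /(Ck_rVP _ _ oU) fk /(Ck_rVP _ _ oU) gk; apply/(Ck_rVP _ _ oU) => j.
case: (split_ordP j) => i ->.
  by under eq_fun do rewrite row_mxEl.
by under eq_fun do rewrite row_mxEr.
Qed.

Lemma is_derive_row_mx (E : normedModType R) n p (f : E -> 'rV[R]_n)
    (g : E -> 'rV[R]_p) x v df dg :
  is_derive x v f df -> is_derive x v g dg ->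
  is_derive x v (fun y => row_mx (f y) (g y)) (row_mx df dg).
Proof.
move=> /is_derive_mxP fd /is_derive_mxP gd; apply/is_derive_mxP => i j.
case: (split_ordP j) => l ->.
  by under eq_fun do rewrite row_mxEl; rewrite row_mxEl.
by under eq_fun do rewrite row_mxEr; rewrite row_mxEr.
Qed.

Lemma is_derive_rsubmx (E : normedModType R) n p (f : E -> 'rV[R]_(n + p)) x v df :
  is_derive x v f df -> is_derive x v (fun y => rsubmx (f y)) (rsubmx df).
Proof.
move=> /is_derive_mxP fd; apply/is_derive_mxP => i j.
by under eq_fun do rewrite mxE; rewrite mxE.
Qed.

Lemma Ck_scale (E : normedModType R) n k (U : set E) (c : E -> R) (f : E -> 'rV[R]_n) :
  open U -> Ck k U c -> Ck k U f -> Ck k U (fun x => c x *: f x).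
Proof.
move=> oU ck /(Ck_rVP _ _ oU) fk; apply/(Ck_rVP _ _ oU) => j.
by under eq_fun do rewrite mxE; exact: CkM.
Qed.

Lemma Ck_leq (E F : normedModType R) k l (U : set E) (f : E -> F) :
  (l <= k)%N -> Ck k U f -> Ck l U f.
Proof. by move=> /subnK <-; elim: (k - l)%N => // m IH; rewrite addSn => /Ck_pred. Qed.

Section tangent_lift.
Variables (n : nat) (U : set 'rV[R]_n) (Z : 'rV[R]_n -> 'rV[R]_n).

Definition lift_set : set 'rV[R]_(n + n) := [set p | U (lsubmx p)].

(** The tangent lift of [Z]: its integral curves pair an integral curve of [Z] with a solution of
    the variational equation along it. *)
Definition lift_field (p : 'rV[R]_(n + n)) : 'rV[R]_(n + n) :=
  row_mx (Z (lsubmx p)) ('D_(rsubmx p) Z (lsubmx p)).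

Lemma lift_set_open : open U -> open lift_set.
Proof. by move=> oU; apply: open_comp oU => p _; exact: lsubmx_continuous. Qed.

Lemma Ck_lift_field k : open U -> Ck k.+1 U Z -> Ck k lift_set lift_field.
Proof.
move=> oU Zk; have oT := lift_set_open oU.
have Z1 : Ck 1 U Z by exact: Ck_leq Zk.
apply: Ck_row_mx => //.
  by apply: (Ck_comp oT oU (fun p Up => Up)); [exact: Ck_lsubmx|exact: Ck_pred].
apply: (@Ck_ext _ _ _ _ _ (fun p => \sum_(j < n) (rsubmx p) 0 j *:
    'D_(delta_mx 0 j : 'rV[R]_n) Z (lsubmx p))) => //.
  by move=> p Up; rewrite (C1_derive_sum _ oU Up Z1).
apply: Ck_sum => // j _; apply: Ck_scale => //.
  by have /(Ck_rVP _ _ oT) := @Ck_rsubmx n n k _ oT; exact.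
exact: (Ck_comp oT oU (fun p Up => Up) (Ck_lsubmx _ oT) (Ck_derive _ Zk)).
Qed.

Lemma is_sol_lift y w : is_sol U Z y ->
  (forall t, unit_itv t -> is_derive t 1 w ('D_(w t) Z (y t))) ->
  is_sol lift_set lift_field (fun t => row_mx (y t) (w t)).
Proof.
move=> ys wD t t01; split.
  by rewrite /lift_set/= row_mxKl; exact: (ys t t01).1.
rewrite /lift_field row_mxKl row_mxKr.
by apply: is_derive_row_mx; [exact: (ys t t01).2|exact: wD].
Qed.

End tangent_lift.

(* The derivative of the time-one map of Z is the second component of the
   time-one map of [lift_field Z], a field of the same kind: hence the
   induction on the order of differentiability. *)
Lemma time1_Ck k n (U : set 'rV[R]_n) Z : open U -> smooth_on U Z ->
  Ck k (flow_domain U Z) (time1 U Z).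
Proof.
elim: k n U Z => [|k IH] n U Z oU Zs.
  by split=> // z Dz; exact: (time1_continuous oU (Zs 1%N)).
have Z1 := Zs 1%N.
have oD := flow_domain_open oU Z1.
have oT := lift_set_open oU.
have Ts : smooth_on (lift_set U) (lift_field Z) by move=> l; exact: Ck_lift_field (Zs l.+1).
have lift_dom z v : flow_domain U Z z ->
    flow_domain (lift_set U) (lift_field Z) (row_mx z v) /\
    is_derive z v (time1 U Z) (rsubmx (time1 (lift_set U) (lift_field Z) (row_mx z v))).
  move=> [y ys yz]; have [w [w0 wD]] := sol_variation v oU Z1 ys.
  have ls := is_sol_lift ys wD.
  split; first by exists (fun t => row_mx (y t) (w t)); rewrite // yz w0.
  have -> : row_mx z v = (fun t => row_mx (y t) (w t)) 0 by rewrite yz w0.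
  rewrite (time1E oT (Ts 1%N) ls) row_mxKr -yz -w0.
  exact: time1_derive.
apply: (@Ck_intro _ _ _ _ _ _ (fun v z => rsubmx (time1 (lift_set U) (lift_field Z) (row_mx z v)))) => //.
- by move=> z Dz; exact: (time1_continuous oU Z1).
- by move=> v z Dz; have [] := lift_dom z v Dz.
move=> v; have oDT := flow_domain_open oT (Ts 1%N).
have H : Ck k (flow_domain U Z) (fun z => time1 (lift_set U) (lift_field Z) (row_mx z v)).
  apply: (Ck_comp oD oDT (fun z Dz => (lift_dom z v Dz).1)); last exact: IH.
  apply: Ck_row_mx => //; first exact: Ck_id.
  exact: Ck_cst.
exact: (Ck_comp oD openT (fun _ _ => I) H (Ck_rsubmx _ openT)).
Qed.

(** Points of R x R^n: a time before a position for flows, and later a speed before a position in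
    [state]. *)
Definition pr n (s : R) (z : 'rV[R]_n) : 'rV[R]_(1 + n) := row_mx (s%:M : 'rV[R]_1) z.

Lemma prE n (p : 'rV[R]_(1 + n)) : p = pr (p 0 0) (rsubmx p).
Proof.
rewrite /pr -{1}[p]hsubmxK; congr row_mx; apply/rowP => j.
by rewrite ord1 !mxE eqxx mulr1n; congr (p _ _); apply: val_inj.
Qed.

Lemma pr_inj n s s' (z z' : 'rV[R]_n) : pr s z = pr s' z' -> s = s' /\ z = z'.
Proof.
move=> /eq_row_mx[/rowP/(_ 0) + ->]; by rewrite !mxE eqxx !mulr1n.
Qed.

Lemma pr_line n (s : R) (z : 'rV[R]_n) : pr s z = s *: pr 1 0 + pr 0 z.
Proof.
rewrite /pr scale_row_mx scaler0 add_row_mx add0r scale_scalar_mx mulr1.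
by rewrite raddf0 addr0.
Qed.

Lemma pr00 n (s : R) (z : 'rV[R]_n) : pr s z 0 0 = s.
Proof.
have -> : (0 : 'I_(1 + n)) = lshift n (0 : 'I_1) by exact: val_inj.
by rewrite /pr row_mxEl mxE eqxx mulr1n.
Qed.

Lemma constant_unit (f : R -> R) :
  (forall t, unit_itv t -> is_derive t 1 f 0) -> forall t, unit_itv t -> f t = f 0.
Proof.
move=> fd t t01; apply/eqP; rewrite eq_le; apply/andP; split; last first.
  exact: (derive_ge0_le fd).
rewrite -lerN2; apply: (@derive_ge0_le R (fun t => - f t) (fun=> 0)) => // s s01.
have := is_deriveN (fd s s01); by rewrite oppr0.
Qed.

Section scaled_field.
Variables (n : nat) (U : set 'rV[R]_n) (X : 'rV[R]_n -> 'rV[R]_n).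
Hypotheses (oU : open U) (Xs : smooth_on U X).

Definition ext_set : set 'rV[R]_(1 + n) := [set p | U (rsubmx p)].

(* The time-one map of this field sends (s, z) to (s, the flow of X from z for
   time s). *)
Definition ext_field (p : 'rV[R]_(1 + n)) : 'rV[R]_(1 + n) :=
  row_mx 0 (p 0 0 *: X (rsubmx p)).

Lemma ext_set_open : open ext_set.
Proof. by apply: open_comp oU => p _; exact: rsubmx_continuous. Qed.

Lemma ext_field_smooth : smooth_on ext_set ext_field.
Proof.
move=> k; have oT := ext_set_open.
apply: Ck_row_mx => //; first exact: Ck_cst.
apply: Ck_scale => //; first exact: Ck_coord.
by apply: (Ck_comp oT oU (fun p Up => Up)); [exact: Ck_rsubmx|exact: Xs].
Qed.

Lemma is_sol_ext s y : (forall t, unit_itv t -> U (y t) /\ is_derive t 1 y (s *: X (y t))) ->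
  is_sol ext_set ext_field (fun t => pr s (y t)).
Proof.
move=> H t t01; have [Uy yD] := H t t01; split.
  by rewrite /ext_set/= row_mxKr.
by rewrite /ext_field row_mxKr pr00; apply: is_derive_row_mx.
Qed.

Lemma is_sol_extE y : is_sol ext_set ext_field y ->
  forall t, unit_itv t -> [/\ y t = pr (y 0 0 0) (rsubmx (y t)), U (rsubmx (y t)) &
    is_derive t 1 (fun t => rsubmx (y t)) (y 0 0 0 *: X (rsubmx (y t)))].
Proof.
move=> ys t t01; have [Uy yD] := ys t t01.
have y00 : y t 0 0 = y 0 0 0.
  apply: (constant_unit (f := fun t => y t 0 0)) => // s s01.
  have [_ /is_derive_mxP/(_ 0 0)] := ys s s01.
  by rewrite [X in is_derive _ _ _ X](_ : _ = 0)//
    (_ : (0 : 'I_(1 + n)) = lshift n (0 : 'I_1)) ?row_mxEl ?mxE//; exact: val_inj.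
split=> //; first by rewrite -y00; exact: prE.
by have := is_derive_rsubmx yD; rewrite row_mxKr y00.
Qed.

End scaled_field.

(** [phi (pr s z)] is the flow of [X] from [z] for time [s], read off the time-one map of
    [ext_field]; joint smoothness is then [time1_Ck]. The last clause, for fields with i-th
    coordinate 1, is what makes [flow_box] explicit. *)
Theorem flow_exists n (U : set 'rV[R]_n) (X : 'rV[R]_n -> 'rV[R]_n) :
  open U -> smooth_on U X ->
  exists (D : set 'rV[R]_(1 + n)) (phi : 'rV[R]_(1 + n) -> 'rV[R]_n),
  [/\ open D, smooth_on D phi,
    forall z, U z -> D (pr 0 z) /\ phi (pr 0 z) = z,
    forall s z, D (pr s z) -> [/\ U z, U (phi (pr s z)) &
      is_derive s 1 (fun s : R => phi (pr s z)) (X (phi (pr s z)))] &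
    forall s z, D (pr s z) -> [/\ D (pr (- s) (phi (pr s z))),
      phi (pr (- s) (phi (pr s z))) = z &
      forall i, (forall x, U x -> X x 0 i = 1) -> phi (pr s z) 0 i = z 0 i + s]].
Proof.
move=> oU Xs.
pose T := ext_set U; pose Z := ext_field X.
have oT : open T by exact: ext_set_open.
have Zs : smooth_on T Z by exact: ext_field_smooth.
have Z1 := Zs 1%N.
have oD := flow_domain_open oT Z1.
have phiE y : is_sol T Z y -> rsubmx (time1 T Z (y 0)) = rsubmx (y 1).
  by move=> ys; rewrite (time1E oT Z1 ys).
exists (flow_domain T Z), (fun p => rsubmx (time1 T Z p)); split=> //.
- move=> k; exact: (Ck_comp oD openT (fun _ _ => I) (time1_Ck _ oT Zs) (Ck_rsubmx _ openT)).
- move=> z Uz.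
  have s0 : is_sol T Z (fun t => pr 0 z).
    apply: is_sol_ext => t _; split=> //; rewrite scale0r; exact: is_derive_cst.
  split; first by exists (fun t => pr 0 z).
  by rewrite (phiE _ s0) row_mxKr.
- move=> s z [y ys y0].
  have H t t01 := is_sol_extE ys (t := t) t01.
  rewrite y0 pr00 in H.
  rewrite -y0 (phiE _ ys).
  have [_ U0 _] := H 0 unit0; have [_ U1 _] := H 1 unit1.
  split=> //; first by move: U0; rewrite y0 row_mxKr.
  (* The position at parameter [t] is the flow for time s t, whose derivative in [s] is t X. So [w]
     is the candidate solution of the variational equation with initial value (1, 0). *)
  pose c t := rsubmx (y t); pose w t : 'rV[R]_(1 + n) := row_mx (1%:M : 'rV[R]_1) (t *: X (c t)).
  have ZE := Zs 1%N.
  have wD t : unit_itv t -> is_derive t 1 w ('D_(w t) Z (y t)).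
    move=> t01; have [yt Ut ct] := H t t01.
    have X1 := Xs 1%N.
    have Xd := C1_differentiable_mx oU Ut X1.
    have dX : is_derive t 1 (fun t => X (c t)) (s *: 'D_(X (c t)) X (c t)).
      rewrite -(derive_dirZ _ _ oU Ut X1).
      exact: (is_derive_chain ct Xd).
    have -> : 'D_(w t) Z (y t) = row_mx 0 (X (c t) + s *: 'D_(t *: X (c t)) X (c t)).
      suff [_ ->] : is_derive (y t) (w t) Z (row_mx 0 (X (c t) + s *: 'D_(t *: X (c t)) X (c t))) by [].
      apply: (@is_derive_row_mx _ _ _ (fun=> 0) (fun p : 'rV[R]_(1 + n) => p 0 0 *: X (rsubmx p))).
      have H1 : is_derive (y t) (w t) (fun p : 'rV[R]_(1 + n) => p 0 0) (1 : R).
        have /is_derive_mxP/(_ 0 0) := is_derive_id (y t) (w t).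
        by rewrite /w -[row_mx _ _]/(pr 1 (t *: X (c t))) pr00.
      have H2 : is_derive (y t) (w t) (fun p : 'rV[R]_(1 + n) => X (rsubmx p)) ('D_(t *: X (c t)) X (c t)).
        have := is_derive_rsubmx (is_derive_id (y t) (w t)).
        rewrite /w row_mxKr => H2; exact: (is_derive_chain H2 Xd).
      apply/is_derive_mxP => i j; rewrite !mxE ord1.
      under eq_fun do rewrite mxE.
      have /is_derive_mxP/(_ 0 j) H3 := H2.
      have := is_deriveM H1 H3; move/is_derive_eq; apply.
      have yt0 : y t 0 0 = s by rewrite yt pr00.
      by rewrite yt0 [_%:A]mulr1 addrC.
    apply: is_derive_row_mx.
    rewrite (derive_dirZ _ _ oU Ut X1).
    apply/is_derive_mxP => i j; rewrite !mxE.
    under eq_fun do rewrite mxE.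
    have /is_derive_mxP/(_ i j) H3 := dX.
    have := is_deriveM (is_derive_id t (1 : R)) H3; move/is_derive_eq; apply.
    rewrite [_%:A]mulr1 addrC !mxE; congr (_ + _).
    by rewrite -[LHS]/(_ * _) mulrCA.
  have := time1_derive oT Z1 ys wD.
  have -> : w 0 = pr 1 0 by rewrite /w scale0r.
  rewrite y0 pr_line => /is_derive_lineP => dl.
  have := is_derive_rsubmx dl; rewrite /w row_mxKr scale1r.
  by under eq_fun do rewrite -pr_line.
- move=> s z [y ys y0].
  have H t t01 := is_sol_extE ys (t := t) t01.
  rewrite y0 pr00 in H.
  rewrite -y0 (phiE _ ys).
  pose c t := rsubmx (y t).
  have refl (t : R) : unit_itv t -> unit_itv (1 - t).
    by move=> /andP[t0 t1]; rewrite /unit_itv/=; apply/andP; split; lra.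
  (* The trajectory run backwards belongs to time - s and starts at the former endpoint. *)
  have s1 : is_sol T Z (fun t => pr (- s) (c (1 - t))).
    apply: (@is_sol_ext _ _ _ _ (fun t => c (1 - t))) => t t01.
    have [_ Ut ct] := H _ (refl _ t01); split=> //.
    have dt : is_derive t 1 (fun t : R => 1 - t) (-1).
      have := is_deriveB (is_derive_cst (1 : R) t (1 : R)) (is_derive_id t (1 : R)).
      by rewrite sub0r.
    have cd : differentiable c (1 - t) by apply/derivable1_diffP; case: ct.
    have := is_derive_comp dt cd; move/is_derive_eq; apply.
    rewrite -deriveE// scaleNr.
    have -> : (-1 : R) = (-1) *: (1 : R) by rewrite [RHS]mulr1.
    by have [_ ->] := is_derive_scalev (-1) ct; rewrite scaleN1r.
  have e1 : pr (- s) (rsubmx (y 1)) = (fun t => pr (- s) (c (1 - t))) 0 by rewrite subr0.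
  split.
  + by exists (fun t => pr (- s) (c (1 - t))).
  + by rewrite e1 (phiE _ s1) row_mxKr subrr /c y0 row_mxKr.
  move=> i Xi.
  have fD t : unit_itv t -> is_derive t 1 (fun t => c t 0 i - s * t) 0.
    move=> t01; have [_ Ut /is_derive_mxP/(_ 0 i) ct] := H t t01.
    have sd : is_derive t 1 (fun t : R => s * t) s.
      have := is_deriveZ s (is_derive_id t (1 : R)).
      by rewrite [s *: (1 : R)]mulr1.
    have := is_deriveB ct sd; move/is_derive_eq; apply.
    by rewrite mxE Xi// mulr1 subrr.
  have := constant_unit fD unit1; rewrite /c y0 row_mxKr mulr0 mulr1 subr0 => E.
  by rewrite -E subrK.
Qed.

End smooth_flow.

(** * Flow boxes *)

Section flow_box.
Context {R : realType}.

Lemma open_preimage_in (T S : topologicalType) (A : set T) (B : set S) (f : T -> S) :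
  open A -> open B -> (forall x, A x -> {for x, continuous f}) ->
  open (A `&` f @^-1` B).
Proof.
move=> oA oB cf; rewrite openE => x [Ax Bx]; apply: filterI.
  exact: open_nbhs_nbhs.
by apply: cf => //; exact: open_nbhs_nbhs.
Qed.

(** As X has i-th coordinate 1, flowing for time s raises the i-th coordinate by exactly s, so the
    inverse is explicit: [lam] projects u along e_i to the hyperplane w_i = z_i and flows for time
    u_i - z_i; [kap] flows back to that hyperplane and translates along e_i. *)
Lemma flow_box n (U : set 'rV[R]_n) (X : 'rV[R]_n -> 'rV[R]_n) z i :
  open U -> smooth_on U X -> U z -> (forall x, U x -> X x 0 i = 1) ->
  exists (e : R) (W : set 'rV[R]_n) (kap lam : 'rV[R]_n -> 'rV[R]_n),
  [/\ 0 < e, open W, W `<=` U & W z] /\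
  [/\ smooth_on W kap, smooth_on (ball z e) lam,
    forall u, ball z e u -> W (lam u) /\ kap (lam u) = u,
    forall w, W w -> ball z e (kap w) /\ lam (kap w) = w &
    forall u, ball z e u -> is_derive u (delta_mx 0 i : 'rV[R]_n) lam (X (lam u))].
Proof.
move=> oU Xs Uz X1.
have [D [phi [oD phis phi0 phiX phiV]]] := flow_exists oU Xs.
pose a := z 0 i; pose ei : 'rV[R]_n := delta_mx 0 i.
pose pt (u : 'rV[R]_n) := pr (u 0 i - a) (u - (u 0 i - a) *: ei).
pose qt (w : 'rV[R]_n) := pr (a - w 0 i) w.
pose lam u := phi (pt u).
pose kap w := phi (qt w) + (w 0 i - a) *: ei.
have ptk k : Ck k setT pt.
  have h1 : Ck k setT (fun u : 'rV[R]_n => u 0 i - a).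
    by apply: CkD; [exact: openT|exact: (Ck_coord _ _ openT)|exact: Ck_cst].
  apply: Ck_row_mx; first exact: openT.
    apply/(Ck_rVP _ _ openT) => j; rewrite ord1.
    by apply: (Ck_ext openT _ h1) => u _; rewrite mxE eqxx mulr1n.
  apply: CkD; [exact: openT|exact: Ck_id|].
  apply: (@Ck_ext _ _ _ _ _ (fun u : 'rV[R]_n => (- (u 0 i - a)) *: ei)); first exact: openT.
    by move=> u _; rewrite scaleNr.
  apply: Ck_scale; [exact: openT|exact: (CkN openT h1)|exact: Ck_cst].
have qtk k : Ck k setT qt.
  have h1 : Ck k setT (fun u : 'rV[R]_n => a - u 0 i).
    apply: CkD; [exact: openT|exact: Ck_cst|].
    exact: (CkN openT (Ck_coord _ _ openT)).
  apply: Ck_row_mx; [exact: openT| |exact: Ck_id].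
  apply/(Ck_rVP _ _ openT) => j; rewrite ord1.
  by apply: (Ck_ext openT _ h1) => u _; rewrite mxE eqxx mulr1n.
have oD1 : open (setT `&` pt @^-1` D).
  by apply: open_preimage_in => // [|u _]; [exact: openT|exact: (Ck_continuous (ptk 0%N))].
have oD2 : open (setT `&` qt @^-1` D).
  by apply: open_preimage_in => // [|u _]; [exact: openT|exact: (Ck_continuous (qtk 0%N))].
have ptz : pt z = pr 0 z by rewrite /pt subrr scale0r subr0.
have /nbhs_ballP[e /= e0 He] : nbhs z (setT `&` pt @^-1` D).
  apply: open_nbhs_nbhs; split=> //; split=> //=.
  by rewrite ptz; have [] := phi0 z Uz.
have kaps k : Ck k (setT `&` qt @^-1` D) kap.
  apply: CkD => //.
    exact: (Ck_comp oD2 oD (fun u Hu => Hu.2) (Ck_sub (fun _ _ => I) (qtk k)) (phis k)).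
  apply: Ck_scale => //; last exact: Ck_cst.
  by apply: CkD => //; [exact: Ck_coord|exact: Ck_cst].
have oB : open (ball z e) by exact: ball_open.
(* Taking the preimage of the ball under [kap] makes [kap] and [lam] inverse bijections between [W]
   and the ball. *)
pose W := (setT `&` qt @^-1` D) `&` kap @^-1` (ball z e).
have oW : open W.
  by apply: open_preimage_in => // w Dw; exact: (Ck_continuous (kaps 0%N)).
have eii : ei 0 i = 1 by rewrite /ei mxE !eqxx.
have lamK u : ball z e u -> W (lam u) /\ kap (lam u) = u.
  move=> Bu; have [_ /=] := He u Bu; rewrite /pt => Du.
  set s := u 0 i - a in Du *; set v := u - s *: ei in Du *.
  have [Dr phir phii] := phiV _ _ Du.
  have lamE : lam u = phi (pr s v) by [].
  have lami : lam u 0 i = u 0 i.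
    by rewrite lamE (phii i X1) /v !mxE eqxx eqxx mulr1 subrK.
  have qtE : qt (lam u) = pr (- s) (phi (pr s v)).
    by rewrite /qt lami /s opprB lamE.
  have kapE : kap (lam u) = u.
    by rewrite /kap qtE phir lami -/s /v subrK.
  split=> //; split; last by rewrite /= kapE.
  by split=> //=; rewrite qtE.
have kapK w : W w -> ball z e (kap w) /\ lam (kap w) = w.
  move=> [[_ /= Dw] Bw]; split=> //.
  rewrite /qt in Dw; have [Dr phir phii] := phiV _ _ Dw.
  have vi := phii i X1.
  have ki : kap w 0 i = w 0 i.
    by rewrite /kap mxE vi !mxE !eqxx mulr1; ring.
  rewrite /lam /pt ki.
  have -> : kap w - (w 0 i - a) *: ei = phi (qt w) by rewrite /kap addrK.
  by have := phir; rewrite opprB.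
exists e, W, kap, lam; split; split=> //.
- by move=> w [[_ Dw] _]; have [] := phiX _ _ Dw.
- have [] := lamK z (ballxx z e0).
  suff -> : lam z = z by [].
  by rewrite /lam ptz; have [_ ->] := phi0 z Uz.
- by move=> k; apply: (Ck_sub _ (kaps k)) => w [].
- move=> k; exact: (Ck_comp oB oD (fun u Hu => (He u Hu).2) (Ck_sub (fun _ _ => I) (ptk k)) (phis k)).
- move=> u /He[_ /=]; rewrite /pt => Du.
  set s := u 0 i - a in Du *; set v := u - s *: ei in Du *.
  have [_ _ dphi] := phiX _ _ Du.
  suff H : is_derive (0 *: ei + u) ei lam (X (lam u)) by rewrite scale0r add0r in H.
  apply/is_derive_lineP.
  (* Moving along e_i changes the flow time only; the projection to the hyperplane stays [v]. *)
  have -> : (fun h : R => lam (h *: ei + u)) = (fun h : R => phi (pr (h *: 1 + s) v)).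
    apply/funext => h; rewrite /lam /pt.
    have -> : (h *: ei + u) 0 i - a = h *: 1 + s.
      by rewrite !mxE !eqxx /= addrA.
    congr (phi (pr _ _)); rewrite /v scalerDl opprD addrACA.
    by rewrite [h *: 1]mulr1 subrr add0r.
  apply/(is_derive_lineP (fun s : R => phi (pr s v))).
  by rewrite scale0r add0r.
Qed.

(** * New charts from diffeomorphisms of chart images *)

Section charts.
Variables (n : nat) (M : manifold R n).
Implicit Types b c d : chart R M n.

Lemma chart_image_open c (A : set M) : open A -> A `<=` cdom c -> open (cmap c @` A).
Proof.
move=> oA Ac.
suff -> : cmap c @` A = cimg c `&` cinv c @^-1` A.
  apply: open_preimage_in => //; first exact: cimg_open.
  exact: cinv_continuous.
apply/seteqP; split=> [_ [x Ax <-]|_ [[x cx <-] /=]].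
  by split; [exists x => //; exact: Ac|rewrite /= cmapK//; exact: Ac].
by rewrite cmapK// => Ax; exists x.
Qed.

Lemma cinvK c u : cimg c u -> cmap c (cinv c u) = u.
Proof. by move=> [x cx <-]; rewrite cmapK. Qed.

Lemma cinv_dom c u : cimg c u -> cdom c (cinv c u).
Proof. by move=> [x cx <-]; rewrite cmapK. Qed.

(** Membership in the atlas comes from its maximality: the transitions of the new chart are those of
    [b] composed with [lam] or [kap]. *)
Lemma chart_diffeo b (W Q : set 'rV[R]_n) (kap lam : 'rV[R]_n -> 'rV[R]_n) :
  atlas b -> open W -> open Q -> W `<=` cimg b ->
  smooth_on W kap -> smooth_on Q lam ->
  (forall u, Q u -> W (lam u) /\ kap (lam u) = u) ->
  (forall w, W w -> Q (kap w) /\ lam (kap w) = w) ->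
  exists c : chart R M n, [/\ atlas c, cdom c = cdom b `&` cmap b @^-1` W,
    cmap c = kap \o cmap b, cinv c = cinv b \o lam & cimg c = Q].
Proof.
move=> Ab oW oQ Wb kaps lams lamK kapK.
pose Dm := cdom b `&` cmap b @^-1` W.
have oDm : open Dm.
  by apply: open_preimage_in => //; [exact: cdom_open|exact: cmap_continuous].
have imQ : (kap \o cmap b) @` Dm = Q.
  apply/seteqP; split=> [_ [x [bx Wx] <-]|u Qu]; first by have [] := kapK _ Wx.
  have [Wu ku] := lamK _ Qu; have bu := Wb _ Wu.
  exists (cinv b (lam u)); last by rewrite /= cinvK.
  by split; [exact: cinv_dom|rewrite /= cinvK].
have oI : open ((kap \o cmap b) @` Dm) by rewrite imQ.
have mK x : Dm x -> (cinv b \o lam) ((kap \o cmap b) x) = x.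
  by move=> [bx Wx] /=; have [_ ->] := kapK _ Wx; rewrite cmapK.
have mc x : Dm x -> {for x, continuous (kap \o cmap b)}.
  move=> [bx Wx]; apply: continuous_comp; first exact: cmap_continuous.
  exact: (Ck_continuous (kaps 0%N)).
have ic u : ((kap \o cmap b) @` Dm) u -> {for u, continuous (cinv b \o lam)}.
  rewrite imQ => Qu; apply: continuous_comp; first exact: (Ck_continuous (lams 0%N)).
  by apply: cinv_continuous; apply: Wb; have [] := lamK _ Qu.
exists (Chart oDm oI mK mc ic); split=> //.
apply: atlas_maximal => d Ad.
have [bd db] := atlas_compatible Ab Ad.
have obd : open (cmap b @` (cdom b `&` cdom d)).
  by apply: chart_image_open => [|x []//]; apply: openI; exact: cdom_open.
have odb : open (cmap d @` (cdom b `&` cdom d)).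
  by apply: chart_image_open => [|x []//]; apply: openI; exact: cdom_open.
split=> k.
- have -> : cmap (Chart oDm oI mK mc ic) @` (cdom (Chart oDm oI mK mc ic) `&` cdom d) =
      Q `&` lam @^-1` (cmap b @` (cdom b `&` cdom d)).
    apply/seteqP; split=> [_ [x [[bx Wx] dx] <-]|u [Qu [x [bx dx] xu]]] /=.
      have [Qx lx] := kapK _ Wx; split=> //=; rewrite lx; exists x => //.
    have [Wu ku] := lamK _ Qu.
    by exists x; [split=> //; split=> //=; rewrite xu|rewrite xu].
  have oS : open (Q `&` lam @^-1` (cmap b @` (cdom b `&` cdom d))).
    by apply: open_preimage_in => // u Qu; exact: (Ck_continuous (lams 0%N)).
  by apply: (Ck_comp oS obd (fun u Hu => Hu.2) _ (bd k)); apply: (Ck_sub _ (lams k)) => u [].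
- have sub : cmap d @` (cdom (Chart oDm oI mK mc ic) `&` cdom d) `<=`
      cmap d @` (cdom b `&` cdom d).
    by move=> _ [x [[bx _] dx] <-]; exists x.
  have oS : open (cmap d @` (cdom (Chart oDm oI mK mc ic) `&` cdom d)).
    by apply: chart_image_open => [|x []//]; apply: openI; exact: cdom_open.
  apply: (Ck_comp oS oW _ (Ck_sub sub (db k)) (kaps k)).
  by move=> _ [x [[bx Wx] dx] <-]; rewrite /transition/= cmapK.
Qed.

End charts.
End flow_box.

(** * Acceleration and the metric *)

Section Schwarz.
Context {R : realType}.

(** A second difference over a small parallelogram is, up to the factor h^2, a value near [x] of
    either mixed derivative; continuity at [x] makes the two agree up to [e]. *)
Lemma Schwarz (E : normedModType R) (U : set E) (f : E -> R) x v w :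
  open U -> U x -> Ck 2 U f -> 'D_v ('D_w f) x = 'D_w ('D_v f) x.
Proof.
have tri (e A B C : R) : `|A - C| <= e / 2 -> `|B - C| <= e / 2 -> `|B - A| <= e.
  by rewrite !ler_norml => /andP[? ?] /andP[? ?]; apply/andP; split; lra.
move=> oU Ux fk.
suff H (e : R) : 0 < e -> `|'D_v ('D_w f) x - 'D_w ('D_v f) x| <= e.
  apply/eqP; rewrite -subr_eq0 -normr_le0; apply/ler_addgt0Pr => e e0.
  by rewrite add0r; exact: H.
move=> e0.
have e20 : 0 < e / 2 by rewrite divr_gt0.
have c1 := Ck_continuous (Ck_derive w (Ck_derive v fk)) Ux.
have c2 := Ck_continuous (Ck_derive v (Ck_derive w fk)) Ux.
have key (p q : E -> R) : {for x, continuous p} -> {for x, continuous q} ->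
    \forall y \near x, [/\ U y, `|p x - p y| <= e / 2 & `|q x - q y| <= e / 2].
  move=> /cvgrPdist_le/(_ _ e20) h1 /cvgrPdist_le/(_ _ e20) h2.
  have h3 := open_nbhs_nbhs (conj oU Ux).
  by near=> y; split; near: y.
have := key _ _ c1 c2.
move=> /nbhs_ballP[r /= r0 Hr].
pose N := `|v| + `|w| + 1.
have N0 : 0 < N by rewrite ltr_pwDr// addr_ge0.
(* With this [h] the parallelogram spanned by h v and h w at [x] lies in the ball of radius [r]. *)
have [h h0 hN] : exists2 h : R, 0 < h & h * N = r / 2.
  by exists (r / 2 / N); rewrite ?divr_gt0// divfK ?gt_eqF.
have inb (s t : R) : 0 <= s <= 1 -> 0 <= t <= 1 ->
    ball x r (s *: (h *: v) + (t *: (h *: w) + x)).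
  move=> /andP[s0 s1] /andP[t0 t1]; rewrite -ball_normE/= distrC addrA addrK.
  apply: (@le_lt_trans _ _ (h * `|v| + h * `|w|)).
    rewrite (le_trans (ler_normD _ _))// !normrZ.
    by apply: lerD; rewrite !ger0_norm ?(ltW h0)// ler_piMl// mulr_ge0// ltW.
  rewrite -mulrDr.
  apply: (@lt_le_trans _ _ (h * N)); last by rewrite hN; lra.
  by rewrite ltr_pM2l// ltrDl.
have z01 : 0 <= (0 : R) <= 1 by rewrite lexx ler01.
have o01 : 0 <= (1 : R) <= 1 by rewrite lexx ler01.
have shiftD (g : E -> R) a y z dg : is_derive (y + a) z g dg -> is_derive y z (fun y => g (y + a)) dg.
  move=> [gd gE]; have E1 : (fun k : R => k^-1 *: ((g \o shift (y + a)) (k *: z) - g (y + a))) =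
     (fun k : R => k^-1 *: (((fun y => g (y + a)) \o shift y) (k *: z) - g (y + a))).
    by apply/funext => k /=; rewrite addrA.
  by split; move: gd gE; rewrite /derivable /derive E1.
(* the second difference of f along (h v, h w), evaluated in two orders *)
have aux a b : (forall s t : R, 0 <= s <= 1 -> 0 <= t <= 1 ->
      U (s *: (h *: a) + (t *: (h *: b) + x))) ->
    exists2 st : R * R, (0 <= st.1 <= 1) && (0 <= st.2 <= 1) &
    f (h *: a + (h *: b + x)) - f (h *: b + x) - (f (h *: a + x) - f x) =
    h * (h * 'D_b ('D_a f) (st.1 *: (h *: a) + (st.2 *: (h *: b) + x))).
  move=> inU.
  have fD y z : U y -> is_derive y (h *: z) f (h * 'D_z f y).
    by move=> Uy; exact: (is_derive_scalev h (Ck_is_derive z fk Uy)).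
  have U0 (s : R) : 0 <= s <= 1 -> U (s *: (h *: a) + x).
    by move=> s01; have := inU s 0 s01 z01; rewrite scale0r add0r.
  have U1 (s : R) : 0 <= s <= 1 -> U (s *: (h *: a) + (h *: b + x)).
    by move=> s01; have := inU s 1 s01 o01; rewrite scale1r.
  pose g y := f (y + h *: b) - f y.
  have gD (s : R) : 0 <= s <= 1 -> is_derive (s *: (h *: a) + x) (h *: a) g
      (h * 'D_a f (s *: (h *: a) + x + h *: b) - h * 'D_a f (s *: (h *: a) + x)).
    move=> s01; apply: is_deriveB; last by apply: fD; exact: U0.
    by apply: shiftD; apply: fD; rewrite -addrA [x + _]addrC; exact: U1.
  have [s s01 E1] := mvt_line (fun s s01 => @ex_derive _ _ _ _ _ _ _ (gD s s01)).
  have [_ gE] := gD s s01; rewrite gE in E1.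
  have dD (t : R) : 0 <= t <= 1 -> is_derive (t *: (h *: b) + (s *: (h *: a) + x)) (h *: b) ('D_a f)
      (h * 'D_b ('D_a f) (t *: (h *: b) + (s *: (h *: a) + x))).
    move=> t01; apply: is_derive_scalev; apply: (Ck_is_derive b (Ck_derive a fk)).
    by rewrite addrCA; exact: inU.
  have [t t01 E2] := mvt_line (fun t t01 => @ex_derive _ _ _ _ _ _ _ (dD t t01)).
  have [_ dE] := dD t t01; rewrite dE in E2.
  exists (s, t) => /=; first by rewrite s01.
  have ea : s *: (h *: a) + (t *: (h *: b) + x) = t *: (h *: b) + (s *: (h *: a) + x).
    by rewrite addrCA.
  have eb : s *: (h *: a) + x + h *: b = h *: b + (s *: (h *: a) + x) by rewrite addrC.
  rewrite eb -mulrBr E2 in E1; rewrite ea -E1 /g.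
  have ec : h *: a + x + h *: b = h *: a + (h *: b + x) by rewrite -addrA [x + _]addrC.
  by rewrite ec [x + h *: b]addrC; ring.
have [[s t] /= /andP[s01 t01] Eq1] := aux v w (fun s t s01 t01 => let: And3 H _ _ := Hr _ (inb s t s01 t01) in H).
have inb' (s1 t1 : R) : 0 <= s1 <= 1 -> 0 <= t1 <= 1 ->
    ball x r (s1 *: (h *: w) + (t1 *: (h *: v) + x)).
  by move=> s01' t01'; rewrite addrCA; exact: inb.
have [[s' t'] /= /andP[s01' t01'] Eq2] := aux w v (fun s t s01 t01 => let: And3 H _ _ := Hr _ (inb' s t s01 t01) in H).
have : h * (h * 'D_w ('D_v f) (s *: (h *: v) + (t *: (h *: w) + x))) =
       h * (h * 'D_v ('D_w f) (s' *: (h *: w) + (t' *: (h *: v) + x))).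
  apply: (etrans (esym Eq1)); apply: (etrans _ Eq2).
  by rewrite [h *: v + (h *: w + x)]addrCA; ring.
have h0' : h != 0 by rewrite gt_eqF.
move=> /(mulfI h0') /(mulfI h0') Eq.
have [_ b1 _] := Hr _ (inb s t s01 t01).
have [_ _ b2] := Hr _ (inb' s' t' s01' t01').
rewrite -Eq in b2.
exact: tri b1 b2.
Unshelve. all: by end_near. Qed.

Lemma Schwarz_rV (E : normedModType R) n (U : set E) (f : E -> 'rV[R]_n) x v w :
  open U -> U x -> Ck 2 U f -> 'D_v ('D_w f) x = 'D_w ('D_v f) x.
Proof.
move=> oU Ux fk; apply/rowP => j.
have H a b : ('D_a ('D_b f) x) 0 j = 'D_a ('D_b (fun y => f y 0 j)) x.
  have /is_derive_mxP/(_ 0 j)[_ <-] := Ck_is_derive a (Ck_derive b fk) Ux.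
  apply: near_eq_derive; apply: open_near_eq oU Ux _ => y Uy.
  by have /is_derive_mxP/(_ 0 j)[_ <-] := Ck_is_derive b fk Uy.
have fj : Ck 2 U (fun y => f y 0 j) by move/(Ck_rVP _ _ oU) : fk; exact.
have S := Schwarz v w oU Ux fj.
by apply: (etrans (H v w)); apply: (etrans S); exact/esym/H.
Qed.

End Schwarz.

Section bilinear_forms.
Context {R : realType} {n : nat}.
Implicit Types (A : 'M[R]_n) (a b : 'rV[R]_n).

Definition bform A a b : R := (a *m A *m b^T) 0 0.

Lemma bformE A a b : bform A a b = \sum_i \sum_j a 0 i * A i j * b 0 j.
Proof.
rewrite /bform !mxE exchange_big/=; apply: eq_bigr => j _.
by rewrite !mxE mulr_suml.
Qed.

Lemma bformDl A a a' b : bform A (a + a') b = bform A a b + bform A a' b.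
Proof. by rewrite /bform !mulmxDl mxE. Qed.

Lemma bformBl A a a' b : bform A (a - a') b = bform A a b - bform A a' b.
Proof. by rewrite /bform !mulmxBl !mxE. Qed.

Lemma bformZl A (c : R) a b : bform A (c *: a) b = c * bform A a b.
Proof. by rewrite /bform -!scalemxAl mxE. Qed.

Lemma bformDr A a b b' : bform A a (b + b') = bform A a b + bform A a b'.
Proof. by rewrite /bform linearD/= mulmxDr mxE. Qed.

Lemma bformZr A (c : R) a b : bform A a (c *: b) = c * bform A a b.
Proof. by rewrite /bform linearZ/= -scalemxAr mxE. Qed.

Lemma bform_sym A a b : A^T = A -> bform A a b = bform A b a.
Proof.
move=> As; rewrite /bform -{2}As.
have -> : (b *m A^T *m a^T) = (a *m A *m b^T)^T by rewrite !trmx_mul trmxK mulmxA.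
by rewrite [RHS]mxE.
Qed.

Lemma bform_delta A a j : bform A a (delta_mx 0 j) = (a *m A) 0 j.
Proof.
rewrite /bform trmx_delta !mxE (bigD1 j)//= big1 => [|k kj].
  by rewrite !mxE !eqxx mulr1 addr0.
by rewrite !mxE (negPf kj) mulr0.
Qed.

Lemma bform_eq0 A a : A \in unitmx -> (forall b, bform A a b = 0) -> a = 0.
Proof.
move=> Au H.
have aA : a *m A = 0 by apply/rowP => j; rewrite -bform_delta H mxE.
by rewrite -[a](mulmxK Au) aA mul0mx.
Qed.

Lemma is_derive_bform (E : normedModType R) (F G : E -> 'rV[R]_n) (A : E -> 'M[R]_n)
    x v dF dG dA :
  is_derive x v F dF -> is_derive x v A dA -> is_derive x v G dG ->
  is_derive x v (fun y => bform (A y) (F y) (G y))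
    (bform (A x) dF (G x) + bform dA (F x) (G x) + bform (A x) (F x) dG).
Proof.
move=> /is_derive_mxP fd /is_derive_mxP ad /is_derive_mxP gd.
have H i j : is_derive x v (fun y => F y 0 i * A y i j * G y 0 j)
    (dF 0 i * A x i j * G x 0 j + F x 0 i * dA i j * G x 0 j + F x 0 i * A x i j * dG 0 j).
  have := is_deriveM (is_deriveM (fd 0 i) (ad i j)) (gd 0 j).
  move/is_derive_eq; apply.
  rewrite -[X in X + _]/(F x 0 i * A x i j * dG 0 j).
  rewrite -[X in _ + X]/(G x 0 j * (F x 0 i * dA i j + A x i j * dF 0 i)); ring.
have S (h : 'I_n -> E -> R) (dh : 'I_n -> R) :
    (forall i, is_derive x v (h i) (dh i)) ->
    is_derive x v (fun y => \sum_i h i y) (\sum_i dh i).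
  move=> hd; have -> : (fun y => \sum_i h i y) = \sum_i h i.
    by apply/funext => y; rewrite fct_sumE.
  exact: is_derive_sum.
rewrite !bformE -!big_split/=.
under eq_fun do rewrite bformE.
apply: (S (fun i y => \sum_j F y 0 i * A y i j * G y 0 j)) => i; rewrite -!big_split/=.
apply: (S (fun j y => F y 0 i * A y i j * G y 0 j)) => j; exact: H.
Qed.

End bilinear_forms.

(** * Covariant acceleration in charts *)

Section acceleration_calculus.
Context {R : realType}.

(** When [A] is a Gram matrix, the left side is the covariant second derivative of [f] along [v]
    paired with its derivative along [w] (see [christoffel_lower]). Constant fields commute, which
    enters as Schwarz. The identity serves twice: for transition maps, to compare accelerations in
    two charts, and for the immersion, on null directions. *)
Lemma pullback_christoffel m n (O : set 'rV[R]_m) (O' : set 'rV[R]_n)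
    (f : 'rV[R]_m -> 'rV[R]_n) (A : 'rV[R]_n -> 'M[R]_n) u v w :
  open O -> open O' -> (forall y, O y -> O' (f y)) -> Ck 2 O f -> Ck 1 O' A ->
  (forall y, O' y -> (A y)^T = A y) -> O u ->
  bform (A (f u)) ('D_v ('D_v f) u) ('D_w f u) +
    (bform ('D_('D_v f u) A (f u)) ('D_v f u) ('D_w f u)
     - 2^-1 * bform ('D_('D_w f u) A (f u)) ('D_v f u) ('D_v f u)) =
  'D_v (fun y => bform (A (f y)) ('D_v f y) ('D_w f y)) u
  - 2^-1 * 'D_w (fun y => bform (A (f y)) ('D_v f y) ('D_v f y)) u.
Proof.
(* [s] stands for the pairing of D_w D_v f with D_v f: it enters once in the first derivative and
   twice in the second, which is halved. *)
have alg (p q r s : R) : p + (q - 2^-1 * r) = (p + q + s) - 2^-1 * (s + r + s).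
  by field.
move=> oO oO' OO' fk Ak Asym Ou.
have f1 := Ck_pred fk.
have Ad := C1_differentiable_mx oO' (OO' _ Ou) Ak.
have AD a : is_derive u a (fun y => A (f y)) ('D_('D_a f u) A (f u)).
  exact: (is_derive_chain (Ck_is_derive a f1 Ou) Ad).
have DD a b : is_derive u a ('D_b f) ('D_a ('D_b f) u).
  exact: (Ck_is_derive a (Ck_derive b fk) Ou).
have [_ e1] := is_derive_bform (DD v v) (AD v) (DD v w).
have [_ e2] := is_derive_bform (DD w v) (AD w) (DD w v).
have Af := Asym _ (OO' _ Ou).
apply: (etrans (alg _ _ _ (bform (A (f u)) ('D_w ('D_v f) u) ('D_v f u)))).
congr (_ - _ * _).
  apply: (etrans _ (esym e1)); congr (_ + _).
  by rewrite (Schwarz_rV v w oO Ou fk); exact: bform_sym.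
by apply: (etrans _ (esym e2)); congr (_ + _); exact: bform_sym.
Qed.

Lemma is_derive_scalerM (E : normedModType R) n (c : E -> R) (F : E -> 'rV[R]_n) x v dc dF :
  is_derive x v c dc -> is_derive x v F dF ->
  is_derive x v (fun y => c y *: F y) (dc *: F x + c x *: dF).
Proof.
move=> cD FD; apply/is_derive_mxP => i j.
have /is_derive_mxP/(_ i j) Fij := FD.
have -> : (fun y => (c y *: F y) i j) = (fun y => c y * F y i j).
  by apply/funext => y; rewrite mxE.
have := is_deriveM cD Fij; move/is_derive_eq; apply.
by rewrite !mxE addrC; congr (_ + _); exact: mulrC.
Qed.

(** The second derivative of f(u) is Df(u'') + D^2 f(u', u'). The direction u' varies with time, so
    the first derivative is expanded over basis directions before being differentiated. *)
Lemma derive1_comp_field m n (O : set 'rV[R]_m) (f : 'rV[R]_m -> 'rV[R]_n)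
    (J : set R) (u u1 : R -> 'rV[R]_m) (y : R -> 'rV[R]_n) t u2 :
  open O -> open J -> J t -> Ck 2 O f ->
  (forall s, J s -> [/\ O (u s), y s = f (u s) & is_derive s 1 u (u1 s)]) ->
  is_derive t 1 u1 u2 ->
  (forall s, J s -> derive1 y s = 'D_(u1 s) f (u s)) /\
  is_derive t 1 (derive1 y) ('D_u2 f (u t) + 'D_(u1 t) ('D_(u1 t) f) (u t)).
Proof.
move=> oO oJ Jt fk H u1D; have f1 := Ck_pred fk.
have yD s : J s -> is_derive s 1 y ('D_(u1 s) f (u s)).
  move=> Js; have [Ou ys us] := H s Js.
  apply: (@near_eq_is_derive _ _ _ (fun s => f (u s))).
    by apply: (open_near_eq oJ Js) => r /H[_ -> _].
  exact: (is_derive_chain us (C1_differentiable_mx oO Ou f1)).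
have dy s : J s -> derive1 y s = 'D_(u1 s) f (u s).
  by move=> Js; rewrite derive1E; have [] := yD s Js.
split=> //.
have [Ou _ ut] := H t Jt.
apply: (@near_eq_is_derive _ _ _ (fun s => \sum_(j < m) u1 s 0 j *:
    'D_(delta_mx 0 j : 'rV[R]_m) f (u s))).
  apply: (open_near_eq oJ Jt) => s Js; have [Os _ _] := H s Js.
  by rewrite dy// (C1_derive_sum _ oO Os f1).
have S : is_derive t 1 (fun s => \sum_(j < m) u1 s 0 j *:
    'D_(delta_mx 0 j : 'rV[R]_m) f (u s))
    (\sum_(j < m) (u2 0 j *: 'D_(delta_mx 0 j : 'rV[R]_m) f (u t) +
      u1 t 0 j *: 'D_(u1 t) ('D_(delta_mx 0 j : 'rV[R]_m) f) (u t))).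
  rewrite (_ : (fun s => _) = \sum_(j < m) (fun s => u1 s 0 j *:
    'D_(delta_mx 0 j : 'rV[R]_m) f (u s))); last by apply/funext => s; rewrite fct_sumE.
  apply: is_derive_sum => j.
  have fjD := is_derive_chain ut (C1_differentiable_mx oO Ou (Ck_derive (delta_mx 0 j : 'rV[R]_m) fk)).
  have /is_derive_mxP/(_ 0 j) uj := u1D.
  exact: is_derive_scalerM uj fjD.
move/is_derive_eq : S; apply; rewrite big_split/= -(C1_derive_sum _ oO Ou f1); congr (_ + _).
have -> : 'D_(u1 t) ('D_(u1 t) f) (u t) = 'D_(u1 t) (fun y => \sum_(j < m) u1 t 0 j *:
    'D_(delta_mx 0 j : 'rV[R]_m) f y) (u t).
  by apply: near_eq_derive; apply: (open_near_eq oO Ou) => z Oz; rewrite (C1_derive_sum _ oO Oz f1).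
rewrite (_ : (fun y => _) = \sum_(j < m) (u1 t 0 j \*: 'D_(delta_mx 0 j : 'rV[R]_m) f)); last first.
  by apply/funext => z; rewrite fct_sumE.
have jD j : is_derive (u t) (u1 t) ('D_(delta_mx 0 j : 'rV[R]_m) f)
    ('D_(u1 t) ('D_(delta_mx 0 j : 'rV[R]_m) f) (u t)).
  exact: (Ck_is_derive _ (Ck_derive (delta_mx 0 j : 'rV[R]_m) fk) Ou).
have [_ ->//] := is_derive_sum (fun j => is_deriveZ (u1 t 0 j) (jD j)).
Qed.

Section metric_in_chart.
Variables (n : nat) (M : manifold R n) (g : metric M).
Implicit Types c d : chart R M n.

Definition gram d (y : 'rV[R]_n) : 'M[R]_n := gmx g d (cinv d y).

Definition christoffel_form d (x : M) (a : 'rV[R]_n) : 'rV[R]_n :=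
  \row_k \sum_i \sum_j christoffel g d x k i j * a 0 i * a 0 j.

Lemma gram_smooth d : atlas d -> smooth_on (cimg d) (gram d).
Proof.
move=> Ad k; apply/Ck_mxP => [|i j]; first exact: cimg_open.
exact: gmx_smooth.
Qed.

Lemma chart_at_cinv d y : atlas d -> cimg d y -> chart_at (cinv d y) d.
Proof. by move=> Ad dy; split=> //; exact: cinv_dom. Qed.

Lemma gram_sym d y : atlas d -> cimg d y -> (gram d y)^T = gram d y.
Proof. by move=> Ad dy; apply: gmx_sym; exact: chart_at_cinv. Qed.

Lemma cimg_cmap d x : chart_at x d -> cimg d (cmap d x).
Proof. by move=> [_ dx]; exists x. Qed.

Lemma gram_cmap d x : chart_at x d -> gram d (cmap d x) = gmx g d x.
Proof. by move=> [_ dx]; rewrite /gram cmapK. Qed.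

Lemma dgmxE d x l i j : chart_at x d ->
  dgmx g d x l i j = ('D_(delta_mx 0 l : 'rV[R]_n) (gram d) (cmap d x)) i j.
Proof.
move=> dx; have Gk := gram_smooth dx.1 1%N.
by have /is_derive_mxP/(_ i j)[_ <-] := Ck_is_derive (delta_mx 0 l : 'rV[R]_n) Gk (cimg_cmap dx).
Qed.

Lemma derive_gram d x a i j : chart_at x d ->
  ('D_a (gram d) (cmap d x)) i j = \sum_l a 0 l * dgmx g d x l i j.
Proof.
move=> dx; have Gk := gram_smooth dx.1 1%N.
rewrite (C1_derive_sum a (@cimg_open _ _ _ d) (cimg_cmap dx) Gk) summxE.
by apply: eq_bigr => l _; rewrite mxE dgmxE.
Qed.

(** Pairing with the metric cancels the inverse Gram matrix. The first two derivative terms coincide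
    after exchanging i and j, which leaves one of them and minus half the third. *)
Lemma christoffel_lower d x a b : chart_at x d ->
  bform (gmx g d x) (christoffel_form d x a) b =
  bform ('D_a (gram d) (cmap d x)) a b - 2^-1 * bform ('D_b (gram d) (cmap d x)) a a.
Proof.
move=> dx; pose D := dgmx g d x.
pose S : 'rV[R]_n := \row_l \sum_i \sum_j (D i j l + D j i l - D l i j) * (a 0 i * a 0 j).
have -> : christoffel_form d x a = 2^-1 *: (S *m (invmx (gmx g d x))^T).
  apply/rowP => k; rewrite !mxE.
  transitivity (\sum_l 2^-1 * (invmx (gmx g d x) k l * S 0 l)); last first.
    by rewrite mulr_sumr; apply: eq_bigr => l _; rewrite !mxE; congr (_ * _); rewrite mulrC.
  transitivity (\sum_i \sum_j \sum_l 2^-1 * (invmx (gmx g d x) k l *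
      ((D i j l + D j i l - D l i j) * (a 0 i * a 0 j)))).
    apply: eq_bigr => i _; apply: eq_bigr => j _.
    rewrite /christoffel -/D -!mulrA mulr_suml mulr_sumr; apply: eq_bigr => l _.
    by rewrite !mulrA.
  under eq_bigr do rewrite exchange_big/=.
  rewrite exchange_big/=; apply: eq_bigr => l _.
  rewrite mxE !mulr_sumr; apply: eq_bigr => i _.
  by rewrite !mulr_sumr.
rewrite bformZl trmx_inv gmx_sym// /bform mulmxKV ?gmx_unit//.
have bE : (S *m b^T) 0 0 = \sum_l \sum_i \sum_j (D i j l * a 0 i * a 0 j * b 0 l)
   + \sum_l \sum_i \sum_j (D j i l * a 0 i * a 0 j * b 0 l)
   - \sum_l \sum_i \sum_j (D l i j * a 0 i * a 0 j * b 0 l).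
  rewrite mxE -big_split/= -sumrB; apply: eq_bigr => l _.
  rewrite !mxE -big_split/= -sumrB mulr_suml; apply: eq_bigr => i _.
  rewrite -big_split/= -sumrB mulr_suml; apply: eq_bigr => j _; ring.
have E1 : \sum_l \sum_i \sum_j (D i j l * a 0 i * a 0 j * b 0 l) =
    bform ('D_a (gram d) (cmap d x)) a b.
  rewrite bformE exchange_big/=.
  transitivity (\sum_i \sum_j \sum_l D i j l * a 0 i * a 0 j * b 0 l).
    by apply: eq_bigr => i _; rewrite exchange_big.
  rewrite exchange_big/=; apply: eq_bigr => j _.
  rewrite exchange_big/=; apply: eq_bigr => l _.
  rewrite derive_gram// mulr_sumr mulr_suml; apply: eq_bigr => i _.
  rewrite -/D; ring.
have E2 : \sum_l \sum_i \sum_j (D j i l * a 0 i * a 0 j * b 0 l) =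
    bform ('D_a (gram d) (cmap d x)) a b.
  rewrite -E1; apply: eq_bigr => l _; rewrite exchange_big/=.
  apply: eq_bigr => i _; apply: eq_bigr => j _; ring.
have E3 : \sum_l \sum_i \sum_j (D l i j * a 0 i * a 0 j * b 0 l) =
    bform ('D_b (gram d) (cmap d x)) a a.
  rewrite bformE exchange_big/=; apply: eq_bigr => i _.
  rewrite exchange_big/=; apply: eq_bigr => j _.
  rewrite derive_gram// mulr_sumr mulr_suml; apply: eq_bigr => l _.
  rewrite -/D; ring.
by rewrite bE E1 E2 E3 /bform; field.
Qed.

Lemma transition_open c d : open (cmap c @` (cdom c `&` cdom d)).
Proof. by apply: chart_image_open => [|x []//]; apply: openI; exact: cdom_open. Qed.

Lemma transition_smooth c d : atlas c -> atlas d ->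
  smooth_on (cmap c @` (cdom c `&` cdom d)) (transition c d).
Proof. by move=> Ac Ad; have [] := atlas_compatible Ac Ad. Qed.

Lemma transition_cmap c d x : chart_at x c -> transition c d (cmap c x) = cmap d x.
Proof. by move=> [_ cx]; rewrite /transition/= cmapK. Qed.

Lemma transition_dom c d x : chart_at x c -> chart_at x d ->
  (cmap c @` (cdom c `&` cdom d)) (cmap c x).
Proof. by move=> [_ cx] [_ dx]; exists x. Qed.

(** In particular the derivative of a transition map is onto, so vectors can be tested by pairing
    with its values. *)
Lemma transition_derivative_inv c d x z : chart_at x c -> chart_at x d ->
  'D_('D_z (transition d c) (cmap d x)) (transition c d) (cmap c x) = z.
Proof.
move=> cx dx.
have h1 := Ck_is_derive z (transition_smooth dx.1 cx.1 1%N) (transition_dom dx cx).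
have h2 : differentiable (transition c d) (transition d c (cmap d x)).
  rewrite transition_cmap//.
  have H := (C1_differentiable_mx (@transition_open c d) (transition_dom cx dx) (transition_smooth cx.1 dx.1 1%N)). exact: H.
have [_] := is_derive_chain h1 h2; rewrite transition_cmap// => <-.
have -> : 'D_z (fun y => transition c d (transition d c y)) (cmap d x) = 'D_z id (cmap d x).
  apply: near_eq_derive; apply: (open_near_eq (@transition_open d c) (transition_dom dx cx)).
  by move=> _ [y [dy cy] <-]; rewrite /transition/= cmapK// cmapK.
by rewrite derive_id.
Qed.

Lemma gram_transition c d y v w : atlas c -> atlas d ->
  (cmap c @` (cdom c `&` cdom d)) y ->
  bform (gram c y) v w =
  bform (gram d (transition c d y)) ('D_v (transition c d) y) ('D_w (transition c d) y).
Proof.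
move=> Ac Ad [x [cx dx] <-].
rewrite transition_cmap// !gram_cmap// /bform.
by rewrite (gmx_transition g v w (conj Ac cx : chart_at x c) (conj Ad dx : chart_at x d)).
Qed.

Lemma smooth_curve_chart (I : set R) (x : R -> M) c (A : set M) : open I -> smooth_curve I x ->
  atlas c -> open A -> A `<=` cdom c ->
  open (I `&` x @^-1` A) /\ smooth_on (I `&` x @^-1` A) (cmap c \o x).
Proof.
move=> oI [xc xs] Ac oA Ad.
have oJ : open (I `&` x @^-1` A) by exact: open_preimage_in.
split=> // k; apply: (Ck_sub _ (xs c Ac k)) => s [Is As]; split=> //; exact: Ad.
Qed.

(** Rests on the transformation law of the Christoffel symbols, obtained by pairing: both charts
    compute the same derivatives of the Gram matrix of [c], and nondegeneracy of the metric removes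
    the test vector. *)
Lemma acceleration_zero_chart (I : set R) (x : R -> M) t c d :
  open I -> smooth_curve I x -> I t -> chart_at (x t) c -> chart_at (x t) d ->
  acceleration g c x t = 0 -> acceleration g d x t = 0.
Proof.
move=> oI xs It ct dt a0.
have oCD : open (cdom c `&` cdom d) by apply: openI; exact: cdom_open.
have [oJ us] := smooth_curve_chart oI xs ct.1 oCD (fun y Hy => Hy.1).
set J := I `&` _ in oJ us.
have Jt : J t by split=> //; split; [exact: ct.2|exact: dt.2].
pose u := cmap c \o x; pose psi := transition c d.
set O := cmap c @` (cdom c `&` cdom d).
have oO : open O by exact: transition_open.
have psik : Ck 2 O psi by exact: transition_smooth ct.1 dt.1 2%N.
have uD s : J s -> is_derive s 1 u (derive1 u s).
  by move=> Js; rewrite derive1E; exact: (Ck_is_derive _ (us 1%N) Js).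
have u1D : is_derive t 1 (derive1 u) (derive1 (derive1 u) t).
  have := Ck_is_derive (1 : R) (Ck_derive (1 : R) (us 2%N)) Jt.
  have -> : 'D_1 u = derive1 u by apply/funext => s; rewrite derive1E.
  by rewrite -derive1E.
have Hu s : J s -> [/\ O (u s), (cmap d \o x) s = psi (u s) & is_derive s 1 u (derive1 u s)].
  move=> Js; have [Is [cs ds]] := Js; split; last exact: uD.
    by exists (x s).
  by rewrite /psi /u/= /transition/= cmapK.
have [y1 y2] := derive1_comp_field oO oJ Jt psik Hu u1D.
have {}y2 : derive1 (velocity d x) t = 'D_(derive1 (derive1 u) t) psi (u t)
    + 'D_(derive1 u t) ('D_(derive1 u t) psi) (u t).
  by rewrite derive1E; have [] := y2.
have v1 : velocity d x t = 'D_(derive1 u t) psi (u t) by exact: y1.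
rewrite /acceleration -/(christoffel_form d (x t) (velocity d x t)) y2 v1.
set v := derive1 u t in y1 y2 v1 *; set a := derive1 (derive1 u) t in y2 *.
have aE : a = - christoffel_form c (x t) v.
  by apply/eqP; rewrite -addr_eq0; apply/eqP; exact: a0.
have Ot : O (u t) by have [] := Hu t Jt.
have Gd := gram_smooth dt.1 1%N.
have Od y : O y -> cimg d (psi y) by move=> [z [cz dz] <-]; exists z => //; rewrite /psi /transition/= cmapK.
have psit : psi (u t) = cmap d (x t) by exact: transition_cmap.
have key w : bform (gmx g d (x t)) ('D_v ('D_v psi) (u t) + christoffel_form d (x t) ('D_v psi (u t))
    - 'D_(christoffel_form c (x t) v) psi (u t)) ('D_w psi (u t)) = 0.
  rewrite bformBl bformDl christoffel_lower//.
  have := pullback_christoffel v w oO (@cimg_open _ _ _ d) Od psik Gd (fun y => gram_sym dt.1) Ot.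
  rewrite psit gram_cmap// => ->.
  have hE a' b' : 'D_a' (fun y => bform (gram d (psi y)) ('D_v psi y) ('D_b' psi y)) (u t) =
      bform ('D_a' (gram c) (u t)) v b'.
    have -> : 'D_a' (fun y => bform (gram d (psi y)) ('D_v psi y) ('D_b' psi y)) (u t) =
        'D_a' (fun y => bform (gram c y) v b') (u t).
      apply: near_eq_derive; apply: (open_near_eq oO Ot) => y Oy.
      by rewrite (gram_transition v b' ct.1 dt.1 Oy).
    have h1 := Ck_is_derive a' (gram_smooth ct.1 1%N) (cimg_cmap ct).
    have [_ ->] := is_derive_bform (is_derive_cst v (u t) a') h1 (is_derive_cst b' (u t) a').
    by rewrite /bform mul0mx mul0mx trmx0 mulmx0 mxE add0r addr0.
  apply: (etrans (congr2 (fun p q => p - 2^-1 * q - _) (hE v w) (hE w v))).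
  apply/eqP; rewrite subr_eq0; apply/eqP.
  apply: (etrans (esym (christoffel_lower v w ct))).
  rewrite -(gram_cmap ct) -(gram_cmap dt) -psit.
  exact: (gram_transition _ _ ct.1 dt.1 Ot).
have : 'D_v ('D_v psi) (u t) + christoffel_form d (x t) ('D_v psi (u t))
    - 'D_(christoffel_form c (x t) v) psi (u t) = 0.
  apply: (bform_eq0 (gmx_unit g dt)) => z.
  by rewrite -(transition_derivative_inv z ct dt); exact: key.
have -> : 'D_a psi (u t) = - 'D_(christoffel_form c (x t) v) psi (u t).
  by rewrite aE -scaleN1r (derive_dirZ _ _ oO Ot (Ck_pred psik)) scaleN1r.
by move=> <-; rewrite -addrA addrC.
Qed.

End metric_in_chart.
End acceleration_calculus.

(** * The null line field of a lightlike hypersurface *)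

Section smooth_matrices.
Context {R : realType} {E : normedModType R}.
Implicit Types (U : set E) (k n : nat).

Lemma Ck_bform k n U (A : E -> 'M[R]_n) (a b : E -> 'rV[R]_n) : open U ->
  Ck k U A -> Ck k U a -> Ck k U b -> Ck k U (fun x => bform (A x) (a x) (b x)).
Proof.
move=> oU /(Ck_mxP _ _ oU) Ak /(Ck_rVP _ _ oU) ak /(Ck_rVP _ _ oU) bk.
under eq_fun do rewrite bformE.
by apply: Ck_sum => // i _; apply: Ck_sum => // j _; do 2! apply: CkM => //.
Qed.

Lemma Ck_det k n U (A : E -> 'M[R]_n) : open U ->
  Ck k U A -> Ck k U (fun x => \det (A x)).
Proof.
move=> oU /(Ck_mxP _ _ oU) Ak; rewrite /determinant.
apply: Ck_sum => // s _; apply: CkM => //; first exact: Ck_cst.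
by apply: Ck_prod.
Qed.

Lemma Ck_invmx k n U (A : E -> 'M[R]_n) : open U ->
  (forall x, U x -> A x \in unitmx) -> Ck k U A -> Ck k U (fun x => invmx (A x)).
Proof.
move=> oU Au Ak; have /(Ck_mxP _ _ oU) Aij := Ak.
have dk := Ck_det oU Ak.
apply: (@Ck_ext _ _ _ _ _ (fun x => (\det (A x))^-1 *: \adj (A x))) => //.
  by move=> x Ux; rewrite /invmx Au.
apply/(Ck_mxP _ _ oU) => i j; under eq_fun do rewrite !mxE.
apply: CkM => //.
  by apply: CkV => // x /Au; rewrite unitmxE unitfE.
rewrite /cofactor; apply: CkM => //; first exact: Ck_cst.
apply: Ck_det => //; apply/(Ck_mxP _ _ oU) => k1 k2.
by under eq_fun do rewrite !mxE.
Qed.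

End smooth_matrices.

Section kernel_algebra.
Context {R : realType}.

Lemma bform_suml n (A : 'M[R]_n) m (c : 'I_m -> R) (F : 'I_m -> 'rV[R]_n) b :
  bform A (\sum_j c j *: F j) b = \sum_j c j * bform A (F j) b.
Proof.
elim/big_rec2 : _ => [|j x y _ IH]; first by rewrite /bform !mul0mx mxE.
by rewrite bformDl bformZl IH.
Qed.

Lemma bform_sumr n (A : 'M[R]_n) m (c : 'I_m -> R) (F : 'I_m -> 'rV[R]_n) b :
  bform A b (\sum_j c j *: F j) = \sum_j c j * bform A b (F j).
Proof.
elim/big_rec2 : _ => [|j x y _ IH]; first by rewrite /bform trmx0 mulmx0 mxE.
by rewrite bformDr bformZr IH.
Qed.

(** Two linear forms are proportional when the kernel of the nonzero one lies in the kernel of the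
    other. *)
Lemma proportional_of_orthogonal n (a b : 'rV[R]_n) : b != 0 ->
  (forall y : 'rV[R]_n, (b *m y^T) 0 0 = 0 -> (a *m y^T) 0 0 = 0) ->
  exists c, a = c *: b.
Proof.
move=> b0 H.
have [j bj] : exists j, b 0 j != 0.
  by apply/existsP; apply: contraNT b0 => /existsPn b0; apply/eqP/rowP => j;
    rewrite mxE; apply/eqP; have := b0 j; rewrite negbK.
exists (a 0 j / b 0 j); apply/rowP => k; rewrite mxE.
(* A test vector orthogonal to [b]; pairing it with [a] gives the minor b_j a_k - b_k a_j. *)
pose y : 'rV[R]_n := b 0 j *: delta_mx 0 k - b 0 k *: delta_mx 0 j.
have E (v : 'rV[R]_n) : (v *m y^T) 0 0 = b 0 j * v 0 k - b 0 k * v 0 j.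
  have D i : (v *m (delta_mx 0 i : 'rV[R]_n)^T) 0 0 = v 0 i.
    by rewrite trmx_delta -colE mxE.
  rewrite /y [(_ - _)^T]linearB/= ![(_ *: _)^T]linearZ/= mulmxBr -!scalemxAr.
  by rewrite mxE [X in X + _]mxE [X in _ + X]mxE [X in _ - X]mxE !D.
have := H y; rewrite !E mulrC subrr => /(_ erefl) /eqP; rewrite subr_eq0 => /eqP ak.
by apply: (mulfI bj); rewrite ak; field.
Qed.

(* A line given as a kernel is spanned by a vector depending smoothly on H,
   since the perturbed matrix is invertible when the kernel is a line
   transverse to the i-th coordinate hyperplane. *)
Lemma kernel_row_inv n (H : 'M[R]_n) i (w : 'rV[R]_n) :
  w != 0 -> w *m H = 0 -> H + delta_mx i i \in unitmx ->
  row i (invmx (H + delta_mx i i)) *m H = 0 /\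
  row i (invmx (H + delta_mx i i)) 0 i = 1.
Proof.
move=> w0 wH Ku; set K := H + delta_mx i i in Ku *.
have wK : w *m K = w 0 i *: delta_mx 0 i.
  rewrite /K mulmxDr wH add0r; apply/rowP => k; rewrite !mxE (bigD1 i)//= big1 => [|l li].
    by rewrite !mxE eqxx addr0.
  by rewrite !mxE (negPf li) mulr0.
have wi : w 0 i != 0.
  apply: contraNneq w0 => wi; move: wK; rewrite wi scale0r => wK.
  by rewrite -[w](mulmxK Ku) wK mul0mx.
have Xw : row i (invmx K) = (w 0 i)^-1 *: w.
  have wE : w = w 0 i *: row i (invmx K) by rewrite -{1}[w](mulmxK Ku) wK -scalemxAl -rowE.
  by rewrite [X in _ *: X]wE scalerA mulVf// scale1r.
by rewrite Xw -scalemxAl wH scaler0 mxE mulVf.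
Qed.

(** If x (H + E_ii) = 0, pairing with [w], which [H] kills on both sides by symmetry, gives x_i w_i
    = 0. So x_i = 0, [x] lies in the kernel line, and a multiple of [w] whose i-th coordinate is 0
    vanishes. *)
Lemma kernel_perturb_unit n (H : 'M[R]_n) i (w : 'rV[R]_n) :
  H^T = H -> w *m H = 0 -> w 0 i != 0 ->
  (forall x : 'rV[R]_n, x *m H = 0 -> exists c, x = c *: w) ->
  H + delta_mx i i \in unitmx.
Proof.
move=> Hs wH wi Hker; rewrite unitmxE unitfE; apply/negP => /det0P[x x0 xK].
have xE : x *m (delta_mx i i : 'M[R]_n) = x 0 i *: delta_mx 0 i.
  apply/rowP => k; rewrite !mxE (bigD1 i)//= big1 => [|l li].
    by rewrite !mxE eqxx addr0.
  by rewrite !mxE (negPf li) mulr0.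
have Hw : H *m w^T = 0 by rewrite -Hs -trmx_mul wH trmx0.
have : (x *m (H + delta_mx i i) *m w^T) 0 0 = 0 by rewrite xK mul0mx mxE.
rewrite mulmxDr mulmxDl -mulmxA Hw mulmx0 add0r xE -scalemxAl -rowE !mxE => /eqP.
rewrite mulf_eq0 (negPf wi) orbF => /eqP xi.
move: xK; rewrite mulmxDr xE xi scale0r addr0 => /Hker[c xc].
move: xi; rewrite xc mxE => /eqP; rewrite mulf_eq0 (negPf wi) orbF => /eqP c0.
by move: x0; rewrite xc c0 scale0r eqxx.
Qed.

End kernel_algebra.

(** The proof works with one fixed representative of the conformal class. *)
Definition lightlike_for (R : realType) n (V : manifold R n) (M : manifold R n.+1)
    (iota : V -> M) (g : metric M) :=
  forall p b c, chart_at p b -> chart_at (iota p) c ->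
    exists xi, [/\ xi != 0, isotropic_cone g c (iota p) xi &
      range (differential iota b c p) = cone_tangent g c (iota p) xi].

(** * The radical of the induced form and its straightening *)

Section lightlike_hypersurface.
Context {R : realType} {n : nat} (V : manifold R n) (M : manifold R n.+1)
  (iota : V -> M) (g : metric M).
Hypothesis hV : hypersurface iota.
Hypothesis hL : lightlike_for iota g.

Implicit Types (b : chart R V n) (d : chart R M n.+1).

Definition loc b d : 'rV[R]_n -> 'rV[R]_n.+1 := cmap d \o iota \o cinv b.
Definition loc_dom b d : set 'rV[R]_n := cmap b @` (cdom b `&` iota @^-1` cdom d).

Lemma iota_continuous : continuous iota.
Proof. by have [[]] := hV. Qed.

Lemma iota_preimage_open b d : open (cdom b `&` iota @^-1` cdom d).
Proof.
apply: open_preimage_in; [exact: cdom_open|exact: cdom_open|].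
by move=> x _; exact: iota_continuous.
Qed.

Lemma loc_dom_open b d : open (loc_dom b d).
Proof.
by apply: chart_image_open => [|x []//]; exact: iota_preimage_open.
Qed.

Lemma loc_smooth b d : atlas b -> atlas d -> smooth_on (loc_dom b d) (loc b d).
Proof. by move=> Ab Ad; have [[_ +] _ _] := hV; apply. Qed.

Lemma loc_dom_cmap b d p : chart_at p b -> chart_at (iota p) d -> loc_dom b d (cmap b p).
Proof. by move=> [_ bp] [_ dp]; exists p. Qed.

Lemma loc_cmap b d p : chart_at p b -> loc b d (cmap b p) = cmap d (iota p).
Proof. by move=> [_ bp]; rewrite /loc/= cmapK. Qed.

Lemma loc_dom_cinv b d u : atlas b -> atlas d -> loc_dom b d u ->
  [/\ chart_at (cinv b u) b, chart_at (iota (cinv b u)) d & cmap b (cinv b u) = u].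
Proof. by move=> Ab Ad [p [bp dp] <-]; rewrite cmapK. Qed.

Lemma loc_C1 b d : atlas b -> atlas d -> Ck 1 (loc_dom b d) (loc b d).
Proof. by move=> Ab Ad; exact: loc_smooth. Qed.

Lemma differential_chart b b' d p v : chart_at p b -> chart_at p b' ->
  chart_at (iota p) d ->
  differential iota b' d p v = differential iota b d p ('D_v (transition b' b) (cmap b' p)).
Proof.
move=> bp bp' dp; rewrite /differential.
have h1 := Ck_is_derive v (transition_smooth bp'.1 bp.1 1%N) (transition_dom bp' bp).
have h2 : differentiable (loc b d) (transition b' b (cmap b' p)).
  rewrite transition_cmap//.
  exact: (C1_differentiable_mx (@loc_dom_open b d) (loc_dom_cmap bp dp) (loc_C1 bp.1 dp.1)).
have [_ e1] := is_derive_chain h1 h2.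
apply: (etrans _ (congr1 ('D_('D_v (transition b' b) (cmap b' p)) (loc b d)) (transition_cmap b bp'))).
apply: (etrans _ e1); apply: near_eq_derive.
apply: (open_near_eq (@transition_open _ _ _ b' b) (transition_dom bp' bp)).
by move=> _ [y [by' by_] <-]; rewrite /transition /loc/= !cmapK.
Qed.

Lemma differential_target b d d' p v : chart_at p b -> chart_at (iota p) d ->
  chart_at (iota p) d' ->
  differential iota b d' p v = 'D_(differential iota b d p v) (transition d d') (cmap d (iota p)).
Proof.
move=> bp dp dp'; rewrite /differential.
have h1 := Ck_is_derive v (loc_C1 bp.1 dp.1) (loc_dom_cmap bp dp).
have h2 : differentiable (transition d d') (loc b d (cmap b p)).
  rewrite loc_cmap//.
  exact: (C1_differentiable_mx (@transition_open _ _ _ d d') (transition_dom dp dp') (transition_smooth dp.1 dp'.1 1%N)).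
have [_ e1] := is_derive_chain h1 h2.
apply: (etrans _ (congr1 ('D_('D_v (loc b d) (cmap b p)) (transition d d')) (loc_cmap d bp))).
apply: (etrans _ e1); apply: near_eq_derive.
apply: (open_near_eq (@loc_dom_open b d) (loc_dom_cmap bp dp)).
by move=> _ [y [by_ dy] <-]; rewrite /transition /loc/= !cmapK.
Qed.

(** [w] lies in the radical of the form induced by [g] on the tangent space of [V]. *)
Definition null_in b d p (w : 'rV[R]_n) := forall v,
  bform (gmx g d (iota p)) (differential iota b d p w) (differential iota b d p v) = 0.

Definition null_at b p (w : 'rV[R]_n) := forall d, chart_at (iota p) d -> null_in b d p w.

Lemma null_in_at b d p w : chart_at p b -> chart_at (iota p) d ->
  null_in b d p w -> null_at b p w.
Proof.
move=> bp dp nw d' dp' v.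
rewrite !(differential_target _ bp dp dp') -(gram_cmap g dp').
rewrite -(transition_cmap d' dp).
rewrite -(gram_transition g _ _ dp.1 dp'.1 (transition_dom dp dp')) gram_cmap//.
Qed.

Lemma null_at_pullback b b' p w : chart_at p b -> chart_at p b' ->
  null_at b p ('D_w (transition b' b) (cmap b' p)) -> null_at b' p w.
Proof.
move=> bp bp' nw d dp v.
by rewrite !(differential_chart _ bp bp' dp); exact: nw.
Qed.

Lemma differentialZ b d p (c : R) v : chart_at p b -> chart_at (iota p) d ->
  differential iota b d p (c *: v) = c *: differential iota b d p v.
Proof.
move=> bp dp.
exact: (derive_dirZ _ _ (@loc_dom_open b d) (loc_dom_cmap bp dp) (loc_C1 bp.1 dp.1)).
Qed.

(** The differential at [xi] of the quadratic form is twice the pairing with [xi], so the tangent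
    hyperplane of the cone is the orthogonal of [xi]. *)
Lemma cone_tangentE d x (xi v : 'rV[R]_n.+1) : chart_at x d ->
  cone_tangent g d x xi v <-> bform (gmx g d x) xi v = 0.
Proof.
move=> dx; rewrite /cone_tangent/= /gform -/(bform _ _ _).
have [_ H] := is_derive_bform (is_derive_id xi v) (is_derive_cst (gmx g d x) xi v) (is_derive_id xi v).
have -> : 'D_v (fun z : 'rV[R]_n.+1 => (z *m gmx g d x *m z^T) 0 0) xi = 2 * bform (gmx g d x) xi v.
  apply: (etrans H); rewrite (bform_sym v xi (gmx_sym g dx)).
  by rewrite {2}/bform mulmx0 mul0mx mxE addr0 mulr_natl mulr2n.
split=> [/eqP|->]; last by rewrite mulr0.
by rewrite mulf_eq0 pnatr_eq0/= => /eqP.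
Qed.

(** The tangent space of [V] is the orthogonal of an isotropic [xi], so it contains [xi]; by
    nondegeneracy of [g] its own orthogonal is the line of [xi]. *)
Lemma null_line p b d : chart_at p b -> chart_at (iota p) d ->
  exists w0, [/\ w0 != 0, null_in b d p w0 &
    forall w, null_in b d p w -> exists c, w = c *: w0].
Proof.
move=> bp dp; have [xi [xi0 iso rg]] := hL bp dp.
have Gu := gmx_unit g dp.
have rgP v : range (differential iota b d p) v <-> bform (gmx g d (iota p)) xi v = 0.
  by rewrite rg; exact: cone_tangentE.
have [w0 _ w0xi] : range (differential iota b d p) xi by apply/rgP; exact: iso.
exists w0; split.
- apply: contra_neq xi0 => w00; rewrite -w0xi w00 /differential.
  exact: derive0.
- by move=> v; rewrite w0xi; apply/rgP; exists v.
move=> w nw.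
have b0 : xi *m gmx g d (iota p) != 0.
  by apply: contra_neq xi0 => H; rewrite -[xi](mulmxK Gu) H mul0mx.
have [c Hc] : exists c, differential iota b d p w *m gmx g d (iota p) = c *: (xi *m gmx g d (iota p)).
  apply: proportional_of_orthogonal => // y /rgP[v _ <-]; exact: nw.
exists c; have [_ _ inj] := hV; apply: (inj _ _ _ bp dp).
rewrite differentialZ// w0xi -[LHS](mulmxK Gu) Hc -scalemxAl mulmxK//.
Qed.

(** Null vectors form the kernel of the induced Gram matrix [H], and the row given by
    [kernel_row_inv] is a smooth section of it with i-th coordinate 1, the normalization that
    [flow_box] requires. *)
Lemma null_field p b d i w0 : chart_at p b -> chart_at (iota p) d ->
  null_in b d p w0 -> w0 0 i != 0 ->
  (forall w, null_in b d p w -> exists c, w = c *: w0) ->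
  exists (U : set 'rV[R]_n) (X : 'rV[R]_n -> 'rV[R]_n),
  [/\ open U, U (cmap b p), U `<=` loc_dom b d, smooth_on U X &
   forall u, U u -> X u 0 i = 1 /\ null_in b d (cinv b u) (X u)].
Proof.
move=> bp dp nw0 w0i w0ker; pose f := loc b d; pose O := loc_dom b d.
have oO : open O by exact: loc_dom_open.
have fs := loc_smooth bp.1 dp.1.
pose e j : 'rV[R]_n := delta_mx 0 j.
pose H u : 'M[R]_n := \matrix_(j, k) bform (gram g d (f u)) ('D_(e j) f u) ('D_(e k) f u).
have fO u : O u -> cimg d (f u).
  move=> Ou; have [b1 d1 _] := loc_dom_cinv bp.1 dp.1 Ou.
  by exists (iota (cinv b u)) => //; exact: d1.2.
have Hk k : Ck k O H.
  apply/(Ck_mxP _ _ oO) => j l; under eq_fun do rewrite mxE.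
  apply: Ck_bform => //.
    exact: (Ck_comp oO (@cimg_open _ _ _ d) fO (fs k) (gram_smooth g dp.1 k)).
  exact: (Ck_derive (e j) (fs k.+1)).
  exact: (Ck_derive (e l) (fs k.+1)).
have nullE u w : O u -> null_in b d (cinv b u) w <-> w *m H u = 0.
  move=> Ou; have [b1 d1 bu] := loc_dom_cinv bp.1 dp.1 Ou.
  have Gu : gmx g d (iota (cinv b u)) = gram g d (f u).
    by rewrite -(gram_cmap g d1) -(loc_cmap d b1) bu.
  have f1 : Ck 1 O f by exact: fs.
  have dE v : differential iota b d (cinv b u) v = \sum_j v 0 j *: 'D_(e j) f u.
    by rewrite /differential -/(loc b d) bu; exact: (C1_derive_sum _ oO Ou f1).
  have bsum (v : 'rV[R]_n) k : bform (gram g d (f u)) (\sum_j v 0 j *: 'D_(e j) f u) ('D_(e k) f u) =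
      (v *m H u) 0 k.
    by rewrite bform_suml mxE; apply: eq_bigr => j _; rewrite mxE.
  split=> [nw|wH v].
    apply/rowP => k; rewrite -bsum mxE.
    have := nw (e k); rewrite Gu dE => <-; congr bform.
    by rewrite /differential -/(loc b d) bu.
  rewrite Gu !dE bform_sumr big1// => j _.
  by rewrite bsum wH mxE mulr0.
pose K u := H u + delta_mx i i.
have Kk k : Ck k O K by apply: CkD => //; exact: Ck_cst.
(* Invertibility of the perturbed matrix is an open condition, and it holds at [p]. *)
pose U := O `&` (fun u => \det (K u)) @^-1` [set x | x != 0].
have oU : open U.
  apply: open_preimage_in => //.
  by move=> u Ou; exact: (Ck_continuous (Ck_det oO (Kk 0%N))).
have Op : O (cmap b p) by exact: loc_dom_cmap.
have pE : cinv b (cmap b p) = p by rewrite cmapK//; exact: bp.2.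
exists U, (fun u => row i (invmx (K u))); split; first exact: oU.
- split; first exact: Op.
  rewrite /= -unitfE -unitmxE.
  apply: (@kernel_perturb_unit _ _ _ _ w0) => //.
  + apply/matrixP => j k; rewrite !mxE; apply: bform_sym.
    exact: (gram_sym g dp.1 (fO _ Op)).
  + by apply/(nullE _ _ Op); rewrite pE.
  + by move=> x /(nullE _ _ Op); rewrite pE; exact: w0ker.
- by move=> u [].
- move=> k; have KU : Ck k U K by apply: (Ck_sub _ (Kk k)) => u [].
  have : Ck k U (fun u => invmx (K u)).
    by apply: Ck_invmx => // u [_ /=]; rewrite unitmxE unitfE.
  move=> /(Ck_mxP _ _ oU) Ik; apply/(Ck_rVP _ _ oU) => j.
  by under eq_fun do rewrite mxE.
- move=> u [Ou /=]; rewrite -unitfE -unitmxE => Ku.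
  have [b1 d1 bu] := loc_dom_cinv bp.1 dp.1 Ou.
  (* Away from [p] the kernel is still nonzero because [V] is lightlike there too. *)
  have [w [wn0 nw _]] := null_line b1 d1.
  have wH : w *m H u = 0 by apply/(nullE _ _ Ou).
  have [XH Xi] := kernel_row_inv wn0 wH Ku.
  by split; [exact: Xi|exact: (nullE _ _ Ou).2 XH].
Qed.

(** Unlike in [null_line], [a] is any vector of the ambient tangent space; this is the form needed
    for an acceleration. *)
Lemma perp_tangent p b d w0 a : chart_at p b -> chart_at (iota p) d ->
  w0 != 0 -> null_in b d p w0 ->
  (forall v, bform (gmx g d (iota p)) a (differential iota b d p v) = 0) ->
  exists c, a = c *: differential iota b d p w0.
Proof.
move=> bp dp w00 nw0 aperp; have [xi [xi0 iso rg]] := hL bp dp.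
have Gu := gmx_unit g dp.
have rgP v : range (differential iota b d p) v <-> bform (gmx g d (iota p)) xi v = 0.
  by rewrite rg; exact: cone_tangentE.
have b0 : xi *m gmx g d (iota p) != 0.
  by apply: contra_neq xi0 => H; rewrite -[xi](mulmxK Gu) H mul0mx.
have prop z : (forall v, bform (gmx g d (iota p)) z (differential iota b d p v) = 0) ->
    exists c, z = c *: xi.
  move=> zp.
  have [c Hc] : exists c, z *m gmx g d (iota p) = c *: (xi *m gmx g d (iota p)).
    by apply: proportional_of_orthogonal => // y /rgP[v _ <-]; exact: zp.
  by exists c; rewrite -[LHS](mulmxK Gu) Hc -scalemxAl mulmxK.
have [c ac] := prop _ aperp; have [c' wc] := prop _ nw0.
have c'0 : c' != 0.
  apply: contra_neq w00 => c'0; have [_ _ inj] := hV; apply: (inj _ _ _ bp dp).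
  by rewrite wc c'0 scale0r /differential; exact/esym/derive0.
by exists (c / c'); rewrite wc scalerA divfK.
Qed.

(** [i0] is prescribed, the same for all points, whereas the nonvanishing coordinate [j] of the null
    vector depends on [p]; a transposition of coordinates brings [j] to [i0]. Having a ball as image
    will make slices connected. *)
Lemma null_chart i0 p : exists (c : chart R V n) (z : 'rV[R]_n) (e : R),
  [/\ chart_at p c, 0 < e, cimg c = ball z e &
      forall q, cdom c q -> null_at c q (delta_mx 0 i0)].
Proof.
have [b Ab bp0] := atlas_cover p; have [d Ad dp0] := atlas_cover (iota p).
have bp : chart_at p b by []. have dp : chart_at (iota p) d by [].
have [w0 [w00 nw0 w0ker]] := null_line bp dp.
have [j w0j] : exists j, w0 0 j != 0.
  by apply/existsP; apply: contraNT w00 => /existsPn w00; apply/eqP/rowP => j;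
    rewrite mxE; apply/eqP; have := w00 j; rewrite negbK.
have [U [X [oU Up Uloc Xs X1]]] := null_field bp dp nw0 w0j w0ker.
have [e [W [kap [lam [[e0 oW WU Wp] [kaps lams lamK kapK lamD]]]]]] :=
  flow_box oU Xs Up (fun u Uu => (X1 u Uu).1).
set z := cmap b p in Wp lams lamK kapK lamD.
(* A permutation of coordinates preserves the sup norm, hence sends balls to balls. *)
pose P (u : 'rV[R]_n) : 'rV[R]_n := \row_k u 0 (tperm i0 j k).
have PK u : P (P u) = u by apply/rowP => k; rewrite !mxE tpermK.
have PB u v : P (u - v) = P u - P v by apply/rowP => k; rewrite !mxE.
have Pn u : `|P u| = `|u|.
  have H v : `|P v| <= `|v|.
    by apply: mx_norm_leP => // i k; rewrite mxE; exact: mx_norm_coord.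
  by apply/eqP; rewrite eq_le H -{1}[u]PK H.
have Pball u : ball (P z) e u <-> ball z e (P u).
  by rewrite -!ball_normE/= -[in X in _ <-> X](PK z) -[P (P z) - P u]PB Pn.
have Pk k A : open A -> Ck k A P.
  move=> oA; apply/(Ck_rVP _ _ oA) => l; under eq_fun do rewrite mxE.
  exact: Ck_coord.
have PD u v : is_derive u v P (P v).
  apply/is_derive_mxP => i k; rewrite mxE; under eq_fun do rewrite mxE.
  by have /is_derive_mxP := is_derive_id u v; exact.
have Pe : P (delta_mx 0 i0) = delta_mx 0 j.
  apply/rowP => k; rewrite !mxE.
  by rewrite -(inj_eq (@perm_inj _ (tperm i0 j))) tpermK tpermL.
have oQ : open (ball (P z) e) by exact: ball_open.
have oB : open (ball z e) by exact: ball_open.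
have lamPs : smooth_on (ball (P z) e) (lam \o P).
  by move=> k; apply: (Ck_comp oQ oB _ (Pk k _ oQ) (lams k)) => u /Pball.
have lamPD u : ball (P z) e u -> is_derive u (delta_mx 0 i0 : 'rV[R]_n) (lam \o P) (X (lam (P u))).
  move=> /Pball Bu.
  have h1 := PD u (delta_mx 0 i0); rewrite Pe in h1.
  have h2 := C1_differentiable_mx oB Bu (lams 1%N).
  have := is_derive_chain h1 h2.
  by have [_ ->] := lamD _ Bu.
have [|u /Pball Bu|w Ww|c [Ac cd cm ci cq]] := @chart_diffeo _ _ _ b W (ball (P z) e) (P \o kap) (lam \o P)
  Ab oW oQ _ (fun k => Ck_comp oW openT (fun _ _ => I) (kaps k) (Pk k _ openT)) lamPs.
- by move=> w /WU /Uloc [q [bq _] <-]; exists q.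
- by have [Wu ku] := lamK _ Bu; split=> //=; rewrite ku PK.
- have [Bw lw] := kapK _ Ww; split; last by rewrite /= PK.
  by apply/Pball; rewrite /= PK.
exists c, (P z), e; split=> //.
  by split=> //; rewrite cd; split.
move=> q cdq; have cdq' := cdq; rewrite cd in cdq'; have [bq Wq] := cdq'.
have cq_ : chart_at q c by [].
have bq_ : chart_at q b by [].
set u := cmap c q.
have Qu : ball (P z) e u by rewrite -cq; exists q.
have lu : lam (P u) = cmap b q.
  by rewrite /u cm /= PK; have [] := kapK _ Wq.
have Ob := Uloc _ (WU _ Wq).
have [b1 dq bqE] := loc_dom_cinv Ab Ad Ob.
rewrite cmapK// in dq.
apply: (null_in_at cq_ dq) => v.
have dE v' : differential iota c d q v' = differential iota b d q ('D_v' (lam \o P) u).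
  rewrite /differential.
  have h1 := Ck_is_derive v' (lamPs 1%N) Qu.
  have h2 : differentiable (loc b d) ((lam \o P) u).
    rewrite /= lu.
    exact: (C1_differentiable_mx (@loc_dom_open b d) Ob (loc_C1 Ab Ad)).
  have [_ e1] := is_derive_chain h1 h2.
  apply: (etrans _ (congr1 ('D_('D_v' (lam \o P) u) (loc b d)) lu)).
  by apply: (etrans _ e1); rewrite ci.
rewrite !dE; have [_ ->] := lamPD u Qu; rewrite lu.
have [_ nX] := X1 _ (WU _ Wq); have := nX ('D_v (lam \o P) u).
by rewrite cmapK.
Qed.

Lemma christoffel_smooth d k i j : atlas d ->
  smooth_on (cimg d) (fun y => christoffel g d (cinv d y) k i j).
Proof.
move=> Ad l; have oC := @cimg_open _ _ _ d.
have ginv : Ck l (cimg d) (fun y => invmx (gram g d y)).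
  apply: Ck_invmx => //; last exact: gram_smooth.
  by move=> y dy; apply: gmx_unit; exact: chart_at_cinv.
have dg a r s : Ck l (cimg d) (fun y => dgmx g d (cinv d y) a r s).
  have : Ck l (cimg d) ('D_(delta_mx 0 a : 'rV[R]_n.+1) (gram g d)).
    exact: (Ck_derive _ (gram_smooth g Ad l.+1)).
  move=> /(Ck_mxP _ _ oC)/(_ r s); apply: Ck_ext => // y dy.
  by rewrite dgmxE ?cinvK//; exact: chart_at_cinv.
rewrite /christoffel; apply: CkM => //; first exact: Ck_cst.
apply: Ck_sum => // r _; apply: CkM => //.
  by move/(Ck_mxP _ _ oC) : ginv; exact.
by apply: CkD => //; [apply: CkD|apply: CkN].
Qed.

(** The covariant derivative in [M] of the coordinate field [i0] of [V] along itself. *)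
Definition lift_acceleration c d i0 (u : 'rV[R]_n) : 'rV[R]_n.+1 :=
  'D_(delta_mx 0 i0 : 'rV[R]_n) ('D_(delta_mx 0 i0 : 'rV[R]_n) (loc c d)) u +
  christoffel_form g d (iota (cinv c u)) ('D_(delta_mx 0 i0 : 'rV[R]_n) (loc c d) u).

Lemma lift_acceleration_smooth c d i0 : atlas c -> atlas d ->
  smooth_on (loc_dom c d) (lift_acceleration c d i0).
Proof.
move=> Ac Ad k; have oO := @loc_dom_open c d.
have fs := loc_smooth Ac Ad.
apply: CkD => //; first exact: (Ck_derive _ (Ck_derive _ (fs k.+2))).
apply/(Ck_rVP _ _ oO) => l; under eq_fun do rewrite mxE.
have /(Ck_rVP _ _ oO) dk := Ck_derive (delta_mx 0 i0 : 'rV[R]_n) (fs k.+1).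
apply: Ck_sum => // i _; apply: Ck_sum => // j _.
apply: CkM => //; apply: CkM => //.
have dO u : loc_dom c d u -> cimg d (loc c d u).
  by move=> Ou; have [_ d1 _] := loc_dom_cinv Ac Ad Ou; exists (iota (cinv c u)) => //; exact: d1.2.
apply: (Ck_ext oO _ (Ck_comp_scalar oO (@cimg_open _ _ _ d) dO (fs k) (christoffel_smooth l i j Ad k))).
move=> u Ou; have [_ d1 _] := loc_dom_cinv Ac Ad Ou.
by rewrite /loc/= cmapK//; exact: d1.2.
Qed.

Lemma null_acceleration_coefficient c d i0 : atlas c -> atlas d ->
  (forall q, cdom c q -> null_at c q (delta_mx 0 i0)) ->
  exists2 phi : 'rV[R]_n -> R, smooth_on (loc_dom c d) phi &
    forall u, loc_dom c d u -> 'D_(delta_mx 0 i0 : 'rV[R]_n) (loc c d) u != 0 /\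
      lift_acceleration c d i0 u = phi u *: 'D_(delta_mx 0 i0 : 'rV[R]_n) (loc c d) u.
Proof.
move=> Ac Ad nullc; have oO := @loc_dom_open c d.
set e : 'rV[R]_n := delta_mx 0 i0.
pose f := loc c d.
have fs := loc_smooth Ac Ad.
have nz u : loc_dom c d u -> 'D_e f u != 0.
  move=> Ou; have [c1 d1 cu] := loc_dom_cinv Ac Ad Ou.
  have e0 : e != 0.
    apply/eqP => /rowP/(_ i0); rewrite !mxE !eqxx => /eqP; by rewrite oner_eq0.
  apply: contra_neq e0 => H; have [_ _ inj] := hV; apply: (inj _ _ _ c1 d1).
  rewrite /differential cu; apply: (etrans H); exact/esym/derive0.
have bE u v : loc_dom c d u -> bform (gmx g d (iota (cinv c u))) (lift_acceleration c d i0 u)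
    (differential iota c d (cinv c u) v) = 0.
  move=> Ou; have [c1 d1 cu] := loc_dom_cinv Ac Ad Ou.
  have dO y : loc_dom c d y -> cimg d (f y).
    by move=> Oy; have [_ d2 _] := loc_dom_cinv Ac Ad Oy; exists (iota (cinv c y)) => //; exact: d2.2.
  have fu : f u = cmap d (iota (cinv c u)) by [].
  (* These pairings vanish on the whole domain, not only at [u], hence so do their derivatives. *)
  have h0 w : 'D_w (fun y => bform (gram g d (f y)) ('D_e f y) ('D_e f y)) u = 0 /\
       'D_w (fun y => bform (gram g d (f y)) ('D_e f y) ('D_v f y)) u = 0.
    have Z y v' : loc_dom c d y -> bform (gram g d (f y)) ('D_e f y) ('D_v' f y) = 0.
      move=> Oy; have [c2 d2 cy] := loc_dom_cinv Ac Ad Oy.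
      have := nullc _ c2.2 d d2 v'; rewrite /differential cy.
      by rewrite -(gram_cmap g d2).
    by split; rewrite -(derive_cst (0 : R) u w); apply: near_eq_derive;
       apply: (open_near_eq oO Ou) => y Oy; rewrite Z.
  have PB := pullback_christoffel e v oO (@cimg_open _ _ _ d) dO (fs 2%N) (gram_smooth g Ad 1%N)
    (fun y => @gram_sym _ _ _ g d y Ad) Ou.
  have {PB} := etrans PB (congr2 (fun a b : R => a - 2^-1 * b) (h0 e).2 (h0 v).1).
  rewrite mulr0 subr0.
  have GE : gram g d (f u) = gmx g d (iota (cinv c u)) by exact: (gram_cmap g d1).
  have dv : differential iota c d (cinv c u) v = 'D_v f u by rewrite /differential cu.
  rewrite GE dv => PB; apply: (etrans (bformDl _ _ _ _)).
  apply: (etrans (congr1 (fun b : R => _ + b) (christoffel_lower g _ _ d1))).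
  exact: PB.
pose q u := lift_acceleration c d i0 u.
(* Pointwise proportionality says nothing about smoothness; the Euclidean quotient gives the factor
   by a smooth formula. *)
pose phi u := bform 1%:M (q u) ('D_e f u) / bform 1%:M ('D_e f u) ('D_e f u).
have sq (a : 'rV[R]_n.+1) : a != 0 -> bform 1%:M a a != 0.
  apply: contra_neq; rewrite /bform mulmx1 mxE => H.
  have : \sum_(j < n.+1) a 0 j ^+ 2 == 0.
    by apply/eqP; rewrite -[RHS]H; apply: eq_bigr => j _; rewrite mxE expr2.
  rewrite psumr_eq0 => [|j _]; last exact: sqr_ge0.
  by move=> /allP H'; apply/rowP => j; rewrite mxE; apply/eqP;
    rewrite -sqrf_eq0; apply: H'; rewrite mem_index_enum.
exists phi.
  move=> k; have dk : Ck k (loc_dom c d) ('D_e f) by exact: (Ck_derive _ (fs k.+1)).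
  apply: CkM => //.
    by apply: Ck_bform => //; [exact: Ck_cst|exact: lift_acceleration_smooth].
  apply: CkV => //; first by move=> u Ou; apply: sq; exact: nz.
  by apply: Ck_bform => //; exact: Ck_cst.
move=> u Ou; split; first exact: nz.
have [c1 d1 cu] := loc_dom_cinv Ac Ad Ou.
have e0 : e != 0 by apply: contra_neq (nz u Ou) => ->; exact: derive0.
have [r qr] := perp_tangent c1 d1 e0 (nullc _ c1.2 d d1) (fun v => bE u v Ou).
have dE : differential iota c d (cinv c u) e = 'D_e f u by rewrite /differential cu.
rewrite dE in qr; rewrite /phi /q qr bformZl mulfK//.
exact: (sq _ (nz u Ou)).
Qed.

End lightlike_hypersurface.

(** * Null geodesics *)

Section affine_reparametrization.
Context {R : realType}.

Definition affine (a t0 s : R) : R := a * s + t0.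

Lemma affine_continuous a t0 : continuous (affine a t0).
Proof.
move=> s; apply: cvgD; last exact: cvg_cst.
by apply: cvgMl_tmp; exact: cvg_id.
Qed.

Lemma affine_quotient (F : normedModType R) (f : R -> F) (a t0 s v : R) :
  (fun h : R => h^-1 *: (((f \o affine a t0) \o shift s) (h *: v) - (f \o affine a t0) s)) =
  (fun h : R => h^-1 *: ((f \o shift (affine a t0 s)) (h *: (a * v)) - f (affine a t0 s))).
Proof.
apply/funext => h /=; congr (_ *: (f _ - _)).
by rewrite /affine -![_ *: _]/(_ * _); ring.
Qed.

Lemma derive_affine (F : normedModType R) (f : R -> F) (a t0 v : R) :
  'D_v (f \o affine a t0) = 'D_(a * v) f \o affine a t0.
Proof. by apply/funext => s; rewrite /= /derive affine_quotient. Qed.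

Lemma is_derive_affine (F : normedModType R) (f : R -> F) (a t0 s : R) df :
  is_derive (affine a t0 s) 1 f df -> is_derive s 1 (f \o affine a t0) (a *: df).
Proof.
move=> /(is_derive_scalev a)[fd fE]; split.
  by rewrite /derivable affine_quotient mulr1; move: fd; rewrite [_ *: 1]mulr1.
apply: (etrans (congr1 (fun h => h s) (derive_affine f a t0 1))); exact: fE.
Qed.

Lemma Ck_affine (F : normedModType R) k (J : set R) (f : R -> F) (a t0 : R) :
  Ck k J f -> Ck k (affine a t0 @^-1` J) (f \o affine a t0).
Proof.
elim: k f => [|k IH] f [cf H].
  split=> // s Js; apply: continuous_comp; first exact: affine_continuous.
  exact: cf.
split=> [s Js|v].
  by apply: continuous_comp; [exact: affine_continuous|exact: cf].
have [fd Hk] := H (a * v); split=> [s Js|].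
  by rewrite /derivable affine_quotient; exact: fd.
by rewrite derive_affine; exact: IH.
Qed.

End affine_reparametrization.

Section curves_in_manifolds.
Context {R : realType} {n : nat} (M : manifold R n).
Implicit Types (c d : chart R M n) (x y : R -> M) (I J : set R).

Lemma velocityE c x : velocity c x = 'D_1 (cmap c \o x).
Proof. by apply/funext => t; rewrite /velocity derive1E. Qed.

Lemma curve_dom_open I x c : open I -> smooth_curve I x -> open (I `&` x @^-1` cdom c).
Proof. by move=> oI [xc _]; apply: open_preimage_in => //; exact: cdom_open. Qed.

Lemma curve_is_derive I x c t : open I -> smooth_curve I x -> I t -> chart_at (x t) c ->
  is_derive t 1 (cmap c \o x) (velocity c x t).
Proof.
move=> oI [xc xs] It [Ac ct]; rewrite velocityE.
exact: (Ck_is_derive (1 : R) (xs c Ac 1%N) (conj It ct : (I `&` x @^-1` cdom c) t)).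
Qed.

Lemma velocity_smooth I x c : smooth_curve I x -> atlas c ->
  smooth_on (I `&` x @^-1` cdom c) (velocity c x).
Proof. by move=> [_ xs] Ac k; rewrite velocityE; exact: (Ck_derive (1 : R) (xs c Ac k.+1)). Qed.

Lemma velocity_transition I x c d t : open I -> smooth_curve I x -> I t ->
  chart_at (x t) c -> chart_at (x t) d ->
  velocity d x t = 'D_(velocity c x t) (transition c d) (cmap c (x t)).
Proof.
move=> oI xs It ct dt.
have h1 := curve_is_derive oI xs It ct.
have h2 := C1_differentiable_mx (@transition_open _ _ _ c d) (transition_dom ct dt)
  (transition_smooth ct.1 dt.1 1%N).
have [_ e1] := is_derive_chain h1 h2.
rewrite velocityE; apply: (etrans _ e1); apply: near_eq_derive.
have oJ : open (I `&` x @^-1` cdom c) by exact: curve_dom_open.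
apply: (open_near_eq oJ (conj It ct.2)) => s [_ cs].
by rewrite /transition/= cmapK.
Qed.

Lemma velocity_germ c x y J t : open J -> J t -> (forall s, J s -> x s = y s) ->
  velocity c x t = velocity c y t.
Proof.
move=> oJ Jt xy; rewrite !velocityE; apply: near_eq_derive.
by apply: (open_near_eq oJ Jt) => s Js /=; rewrite xy.
Qed.

Lemma acceleration_germ (g : metric M) c x y J t : open J -> J t ->
  (forall s, J s -> x s = y s) -> acceleration g c x t = acceleration g c y t.
Proof.
move=> oJ Jt xy.
have e1 : derive1 (velocity c x) t = derive1 (velocity c y) t.
  rewrite !derive1E; apply: near_eq_derive.
  by apply: (open_near_eq oJ Jt) => s Js; exact: (velocity_germ c oJ Js xy).
have e2 : christoffel_form g c (x t) (velocity c x t) = christoffel_form g c (y t) (velocity c y t).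
  exact: (congr2 (christoffel_form g c) (xy t Jt) (velocity_germ c oJ Jt xy)).
exact: (congr2 (fun a b : 'rV[R]_n => a + b) e1 e2).
Qed.

Lemma smooth_curve_local I x :
  (forall t, I t -> exists J y, [/\ open J, J t, forall s, J s -> x s = y s & smooth_curve J y]) ->
  smooth_curve I x.
Proof.
move=> H; split=> [t It|c Ac k].
  have [J [y [oJ Jt xy [yc _]]]] := H t It.
  apply: near_continuous_eq (yc t Jt).
  by apply: (open_near_eq oJ Jt) => s Js; rewrite xy.
apply: Ck_local => t [It ct].
have [J [y [oJ Jt xy ys]]] := H t It.
exists (J `&` y @^-1` cdom c).
have oJc := @curve_dom_open _ _ c oJ ys; split=> //.
  by split=> //=; rewrite -xy.
apply: (Ck_ext oJc _ (ys.2 c Ac k)) => s [Js _] /=.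
by rewrite xy.
Qed.

Lemma smooth_curve_affine I x (a t0 : R) : smooth_curve I x ->
  smooth_curve (affine a t0 @^-1` I) (x \o affine a t0).
Proof.
move=> [xc xs]; split=> [t It|c Ac k].
  by apply: continuous_comp; [exact: affine_continuous|exact: xc].
exact: (Ck_affine a t0 (xs c Ac k)).
Qed.

Lemma affine_preimage_open I (a t0 : R) : open I -> open (affine a t0 @^-1` I).
Proof. by move=> oI; apply: open_comp oI => s _; exact: affine_continuous. Qed.

Lemma velocity_affine I x c (a t0 s : R) : open I -> smooth_curve I x ->
  I (affine a t0 s) -> chart_at (x (affine a t0 s)) c ->
  velocity c (x \o affine a t0) s = a *: velocity c x (affine a t0 s).
Proof.
move=> oI xs Is cs; rewrite [in LHS]/velocity derive1E.
by have [_ e1] := is_derive_affine (curve_is_derive oI xs Is cs); exact: e1.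
Qed.

Lemma christoffel_form_scale (g : metric M) c p (a : R) v :
  christoffel_form g c p (a *: v) = (a * a) *: christoffel_form g c p v.
Proof.
apply/rowP => k; rewrite !mxE mulr_sumr; apply: eq_bigr => i _.
rewrite mulr_sumr; apply: eq_bigr => j _; rewrite !mxE; ring.
Qed.

Lemma acceleration_affine (g : metric M) I x c (a t0 s : R) : open I -> smooth_curve I x ->
  I (affine a t0 s) -> chart_at (x (affine a t0 s)) c ->
  acceleration g c (x \o affine a t0) s = (a * a) *: acceleration g c x (affine a t0 s).
Proof.
move=> oI xs Is cs.
rewrite /acceleration -!/(christoffel_form _ _ _ _) (velocity_affine oI xs Is cs).
rewrite christoffel_form_scale scalerDr; congr (_ + _).
have oJ := @curve_dom_open _ _ c oI xs.
have oJ' : open (affine a t0 @^-1` (I `&` x @^-1` cdom c)) by exact: affine_preimage_open.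
have vD : is_derive (affine a t0 s) 1 (velocity c x) (derive1 (velocity c x) (affine a t0 s)).
  rewrite derive1E.
  exact: (Ck_is_derive (1 : R) (velocity_smooth xs cs.1 1%N) (conj Is cs.2 : (I `&` x @^-1` cdom c) (affine a t0 s))).
rewrite derive1E.
transitivity ('D_1 (a \*: (velocity c x \o affine a t0)) s).
  apply: near_eq_derive; apply: (open_near_eq oJ' (conj Is cs.2)) => r [Ir cr].
  by rewrite (velocity_affine oI xs Ir (conj cs.1 cr)).
have [vd vE] := is_derive_affine vD.
apply: (etrans (deriveZ a vd)).
exact: (etrans (congr1 (fun w => a *: w) vE) (scalerA _ _ _)).
Qed.

End curves_in_manifolds.

(** * Affinely parametrized null geodesics *)

Section null_geodesics.
Context {R : realType} {n : nat} (V : manifold R n) (M : manifold R n.+1)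
  (iota : V -> M) (g : metric M).
Hypothesis hV : hypersurface iota.
Hypothesis hL : lightlike_for iota g.

Implicit Types (b c : chart R V n) (d : chart R M n.+1) (x y : R -> V) (I J : set R).

Lemma smooth_curve_iota I x : open I -> smooth_curve I x -> smooth_curve I (iota \o x).
Proof.
move=> oI xS; have [xc xs] := xS; split=> [t It|d Ad k].
  by apply: continuous_comp; [exact: xc|exact: (iota_continuous hV)].
apply: Ck_local => t [It dt].
have [b Ab bt] := atlas_cover (x t).
have oA := @iota_preimage_open _ _ _ _ _ hV b d.
have [oJ us] := smooth_curve_chart oI xS Ab oA (@subIsetl _ _ _).
exists (I `&` x @^-1` (cdom b `&` iota @^-1` cdom d)); split=> //.
have sub s : (I `&` x @^-1` (cdom b `&` iota @^-1` cdom d)) s -> loc_dom iota b d ((cmap b \o x) s).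
  by move=> [Is As]; exists (x s).
apply: (Ck_ext oJ _ (Ck_comp oJ (@loc_dom_open _ _ _ _ _ hV b d) sub (us k) (loc_smooth hV Ab Ad k))).
by move=> s [Is [bs ds]]; rewrite /loc/= cmapK.
Qed.

Lemma velocity_iota I x b d t : open I -> smooth_curve I x -> I t ->
  chart_at (x t) b -> chart_at (iota (x t)) d ->
  velocity d (iota \o x) t = differential iota b d (x t) (velocity b x t).
Proof.
move=> oI xs It bt dt.
have h1 := curve_is_derive oI xs It bt.
have h2 := C1_differentiable_mx (@loc_dom_open _ _ _ _ _ hV b d) (loc_dom_cmap bt dt) (loc_C1 hV bt.1 dt.1).
have [_ e1] := is_derive_chain h1 h2.
rewrite velocityE /differential; apply: (etrans _ e1); apply: near_eq_derive.
have oJ : open (I `&` x @^-1` cdom b) by exact: curve_dom_open.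
apply: (open_near_eq oJ (conj It bt.2)) => s [_ bs].
by rewrite /loc/= cmapK.
Qed.

(** Zero acceleration, rather than acceleration along the velocity, fixes the parameter up to affine
    changes. All charts are quantified; [null_geodesic_atI] reduces the check to one pair. *)
Definition null_geodesic_at x t := forall b, chart_at (x t) b ->
  [/\ velocity b x t != 0, null_at iota g b (x t) (velocity b x t) &
    forall d, chart_at (iota (x t)) d -> acceleration g d (iota \o x) t = 0].

Definition null_geodesic I x := [/\ open I, is_interval I, smooth_curve I x &
  forall t, I t -> null_geodesic_at x t].

Lemma null_geodesic_atI I x t b d : open I -> smooth_curve I x -> I t ->
  chart_at (x t) b -> chart_at (iota (x t)) d ->
  velocity b x t != 0 -> null_in iota g b d (x t) (velocity b x t) ->
  acceleration g d (iota \o x) t = 0 -> null_geodesic_at x t.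
Proof.
move=> oI xs It bt dt v0 nv a0 b' bt'; split.
- apply: contra_neq v0 => v0.
  rewrite (velocity_transition oI xs It bt' bt) v0; exact: derive0.
- apply: (null_at_pullback hV bt bt').
  rewrite (velocity_transition oI xs It bt bt') (transition_derivative_inv _ bt' bt).
  exact: (null_in_at hV bt dt nv).
- move=> d' dt'; have ixs := smooth_curve_iota oI xs.
  exact: (acceleration_zero_chart (x := iota \o x) oI ixs It dt dt' a0).
Qed.

Lemma null_geodesic_at_germ x y J t : open J -> J t -> (forall s, J s -> x s = y s) ->
  null_geodesic_at x t -> null_geodesic_at y t.
Proof.
move=> oJ Jt xy H b; rewrite -xy// => bt.
have [h1 h2 h3] := H b bt.
have e1 := velocity_germ b oJ Jt xy.
have {}h1 : velocity b y t != 0 := eq_rect _ (fun v => v != 0) h1 _ e1.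
have {}h2 : null_at iota g b (x t) (velocity b y t) := eq_rect _ (null_at iota g b (x t)) h2 _ e1.
split=> [||d dt]; [exact: h1|exact: h2|].
have ixy s : J s -> (iota \o x) s = (iota \o y) s by move=> Js; exact: (congr1 iota (xy s Js)).
exact: (etrans (esym (acceleration_germ g d oJ Jt ixy)) (h3 d dt)).
Qed.

(** A negative [a] reverses the curve, as needed to match two geodesics that meet with opposite
    velocities. *)
Lemma null_geodesic_affine I x (a t0 : R) : a != 0 -> null_geodesic I x ->
  null_geodesic (affine a t0 @^-1` I) (x \o affine a t0).
Proof.
move=> a0 [oI iI xs xg]; have oJ := @affine_preimage_open _ I a t0 oI; split=> //.
- move=> s r Is Ir z /andP[sz zr].
  have [ap|an] := ltP 0 a.
    apply: (iI (affine a t0 s) (affine a t0 r)) => //.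
    by rewrite /affine !lerD2r !ler_pM2l// sz zr.
  have {}an : a < 0 by rewrite lt_neqAle a0.
  apply: (iI (affine a t0 r) (affine a t0 s)) => //.
  by rewrite /affine !lerD2r !ler_nM2l// sz zr.
- exact: smooth_curve_affine.
- move=> s Is; have Is' : I (affine a t0 s) := Is.
  have [b Ab bt] := atlas_cover (x (affine a t0 s)).
  have [d Ad dt] := atlas_cover (iota (x (affine a t0 s))).
  have [h1 h2 h3] := xg _ Is' b (conj Ab bt).
  have ys := smooth_curve_affine a t0 xs.
  have vE := velocity_affine oI xs Is' (conj Ab bt : chart_at _ b).
  apply: (null_geodesic_atI oJ ys Is (conj Ab bt) (conj Ad dt)).
  + by rewrite vE scaler_eq0 negb_or a0.
  + move=> v; rewrite vE (differentialZ hV _ _ (conj Ab bt : chart_at (x (affine a t0 s)) b) (conj Ad dt)) bformZl.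
    by rewrite (h2 d (conj Ad dt)) mulr0.
  + have ixs := smooth_curve_iota oI xs.
    rewrite (acceleration_affine (x := iota \o x) g oI ixs Is' (conj Ad dt)).
    by rewrite h3 ?scaler0.
Qed.

Lemma null_parallel p b d w w' : chart_at p b -> chart_at (iota p) d ->
  w != 0 -> null_in iota g b d p w -> null_in iota g b d p w' -> exists k, w' = k *: w.
Proof.
move=> bp dp w0 nw nw'; have [w1 [w10 nw1 H]] := null_line hV hL bp dp.
have [k kw] := H _ nw; have [k' kw'] := H _ nw'.
have k0 : k != 0 by apply: contra_neq w0 => k0; rewrite kw k0 scale0r.
by exists (k' / k); rewrite kw scalerA divfK.
Qed.

End null_geodesics.

(** * The geodesic equation in a flow box *)

Section null_state.
Context {R : realType} {n : nat} (V : manifold R n) (M : manifold R n.+1)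
  (iota : V -> M) (g : metric M).
Hypothesis hV : hypersurface iota.
Hypothesis hL : lightlike_for iota g.

Variables (c : chart R V n) (i0 : 'I_n).
Hypothesis Ac : atlas c.
Hypothesis nullc : forall q, cdom c q -> null_at iota g c q (delta_mx 0 i0).

Let e : 'rV[R]_n := delta_mx 0 i0.
Implicit Types (x y : R -> V) (I J : set R) (t : R).

Lemma delta_mx_neq0 : e != 0.
Proof.
apply: contra_neq (oner_neq0 R) => e0.
by have := congr1 (fun v : 'rV[R]_n => v 0 i0) e0; rewrite !mxE !eqxx.
Qed.

Lemma null_velocity x t : cdom c (x t) -> null_geodesic_at iota g x t ->
  velocity c x t = velocity c x t 0 i0 *: e.
Proof.
move=> ct xg; have [d Ad dt] := atlas_cover (iota (x t)).
have cx : chart_at (x t) c by []. have dx : chart_at (iota (x t)) d by [].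
have [_ nv _] := xg c cx.
have [k vE] := null_parallel hV hL cx dx delta_mx_neq0 (nullc ct dx) (nv d dx).
by rewrite vE !mxE !eqxx mulr1.
Qed.

(** The velocity is a multiple of the coordinate vector [i0]. The segment from [t0] to [t], in
    either order, is rescaled to [0, 1] so that [constant_unit] applies. *)
Lemma null_transversal I x t0 t i : open I -> is_interval I -> smooth_curve I x ->
  (forall t, I t -> cdom c (x t) /\ null_geodesic_at iota g x t) ->
  I t0 -> I t -> i != i0 -> cmap c (x t) 0 i = cmap c (x t0) 0 i.
Proof.
move=> oI iI xs H It0 It ii0.
have Ir r : unit_itv r -> I (affine (t - t0) t0 r).
  rewrite /unit_itv/affine/= => /andP[r0 r1].
  have [tt0|tt0] := leP t0 t.
    apply: (iI t0 t) => //; rewrite lerDr mulr_ge0 ?subr_ge0//=.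
    by rewrite -lerBrDr ler_piMr// subr_ge0.
  apply: (iI t t0) => //; rewrite gerDr mulr_le0_ge0 ?subr_le0 ?(ltW tt0)//= andbT.
  by rewrite -lerBlDr -[leLHS]mulr1 ler_nM2l ?subr_lt0.
have fD r : unit_itv r -> is_derive r 1 ((fun s => cmap c (x s) 0 i) \o affine (t - t0) t0) 0.
  move=> r01; have [cr xg] := H _ (Ir r r01).
  have /is_derive_mxP/(_ 0 i) := curve_is_derive oI xs (Ir r r01) (conj Ac cr).
  rewrite null_velocity// !mxE eqxx (negbTE ii0) mulr0 => fr.
  by have := is_derive_affine fr; rewrite scaler0.
have /= := constant_unit fD unit1.
by rewrite /affine mulr1 mulr0 add0r subrK.
Qed.

Variable d : chart R M n.+1.
Hypothesis Ad : atlas d.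
Variable phi : 'rV[R]_n -> R.
Hypothesis phis : smooth_on (loc_dom iota c d) phi.
Hypothesis phiE : forall u, loc_dom iota c d u -> 'D_e (loc iota c d) u != 0 /\
  lift_acceleration iota g c d i0 u = phi u *: 'D_e (loc iota c d) u.

Definition state_dom : set 'rV[R]_(1 + n) := [set p | loc_dom iota c d (rsubmx p)].

Definition state_field (p : 'rV[R]_(1 + n)) : 'rV[R]_(1 + n) :=
  pr (- phi (rsubmx p) * (p 0 0 * p 0 0)) (p 0 0 *: e).

Definition state (x : R -> V) t : 'rV[R]_(1 + n) := pr (velocity c x t 0 i0) (cmap c (x t)).

Lemma state_dom_open : open state_dom.
Proof.
by apply: open_comp (@loc_dom_open _ _ _ _ _ hV c d) => p _; exact: rsubmx_continuous.
Qed.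

Lemma state_field_smooth : smooth_on state_dom state_field.
Proof.
move=> k; have oS := state_dom_open; rewrite /state_field /pr; apply: Ck_row_mx => //.
  apply/(Ck_rVP _ _ oS) => j; rewrite ord1; under eq_fun do rewrite mxE eqxx mulr1n.
  apply: CkM => //; last by apply: CkM => //; exact: Ck_coord.
  apply: CkN => //; apply: (Ck_comp_scalar oS (@loc_dom_open _ _ _ _ _ hV c d) (fun p Hp => Hp)) => //.
  exact: Ck_rsubmx.
by apply: Ck_scale => //; [exact: Ck_coord|exact: Ck_cst].
Qed.

(** The bridge between geodesics and states, used in both directions, by [null_geodesic_state] and
    by [state_null_geodesic]. *)
Lemma acceleration_along_null (J : set R) (x : R -> V) (b : R -> R) b' t : open J -> J t ->
  (forall s, J s -> [/\ cdom c (x s), cdom d (iota (x s)) &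
    is_derive s 1 (cmap c \o x) (b s *: e)]) ->
  is_derive t 1 b b' ->
  acceleration g d (iota \o x) t =
    (b' + phi (cmap c (x t)) * (b t * b t)) *: 'D_e (loc iota c d) (cmap c (x t)).
Proof.
move=> oJ Jt H bD; set f := loc iota c d; have oO := @loc_dom_open _ _ _ _ _ hV c d.
have fs := loc_smooth hV Ac Ad.
have [ct dt uD] := H t Jt; set u := cmap c (x t).
have Ou : loc_dom iota c d u by exact: (loc_dom_cmap (conj Ac ct) (conj Ad dt)).
have f1 : Ck 1 (loc_dom iota c d) f := fs 1%N.
have H' s : J s -> [/\ loc_dom iota c d ((cmap c \o x) s),
    (cmap d \o (iota \o x)) s = f ((cmap c \o x) s) & is_derive s 1 (cmap c \o x) (b s *: e)].
  move=> Js; have [cs ds sD] := H s Js; split=> //.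
    exact: (loc_dom_cmap (conj Ac cs) (conj Ad ds)).
  by rewrite /f /loc/= cmapK.
have u1D : is_derive t 1 (fun s => b s *: e) (b' *: e).
  have := is_derive_scalerM bD (is_derive_cst e t 1).
  by rewrite scaler0 addr0.
have [v1 v2] := derive1_comp_field oO oJ Jt (fs 2%N) H' u1D.
have e1 : velocity d (iota \o x) t = b t *: 'D_e f u.
  exact: (etrans (v1 t Jt) (derive_dirZ _ _ oO Ou f1)).
have e2 : 'D_(b t *: e) ('D_(b t *: e) f) u = (b t * b t) *: 'D_e ('D_e f) u.
  apply: (etrans (derive_dirZ _ _ oO Ou (Ck_derive (b t *: e) (fs 2%N)))).
  rewrite -scalerA; congr (_ *: _).
  have [De _] := Ck_is_derive e (Ck_derive e (fs 2%N)) Ou.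
  apply: (etrans _ (deriveZ (b t) De)); apply: near_eq_derive.
  by apply: (open_near_eq oO Ou) => z Oz; exact: (derive_dirZ _ _ oO Oz f1).
have e3 : derive1 (velocity d (iota \o x)) t = b' *: 'D_e f u + (b t * b t) *: 'D_e ('D_e f) u.
  rewrite derive1E; have [_ e3] := v2; apply: (etrans e3).
  exact: (congr2 (fun a b : 'rV[R]_n.+1 => a + b) (derive_dirZ _ _ oO Ou f1) e2).
have e4 : christoffel_form g d ((iota \o x) t) (velocity d (iota \o x) t) =
    (b t * b t) *: christoffel_form g d (iota (cinv c u)) ('D_e f u).
  apply: (etrans (congr1 (christoffel_form g d _) e1)).
  by rewrite christoffel_form_scale /u cmapK.
have [_ e5] := phiE Ou.
apply: (etrans (congr2 (fun a b : 'rV[R]_n.+1 => a + b) e3 e4)).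
have key (q p : R) (A B D : 'rV[R]_n.+1) : B + D = p *: A ->
    b' *: A + q *: B + q *: D = (b' + p * q) *: A.
  by move=> BD; rewrite -addrA -scalerDr BD scalerA scalerDl [q * p]mulrC.
exact: key e5.
Qed.

Lemma null_geodesic_state I x t : open I -> smooth_curve I x ->
  (forall t, I t -> null_geodesic_at iota g x t) ->
  I t -> cdom c (x t) -> cdom d (iota (x t)) ->
  is_derive t (1 : R) (state x) (state_field (state x t)).
Proof.
move=> oI xs xg It ct dt; pose b s := velocity c x s 0 i0.
have oA := @iota_preimage_open _ _ _ _ _ hV c d.
have [oJ us] := smooth_curve_chart oI xs Ac oA (@subIsetl _ _ _).
have Jt : (I `&` x @^-1` (cdom c `&` iota @^-1` cdom d)) t by [].
have H s : (I `&` x @^-1` (cdom c `&` iota @^-1` cdom d)) s ->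
    [/\ cdom c (x s), cdom d (iota (x s)) & is_derive s 1 (cmap c \o x) (b s *: e)].
  move=> [Is [cs ds]]; split=> //; rewrite /b -null_velocity//; last exact: xg.
  exact: (curve_is_derive oI xs Is (conj Ac cs)).
have bD : is_derive t 1 b ('D_1 b t).
  have oJc := @curve_dom_open _ _ _ _ _ c oI xs.
  have /(Ck_rVP _ _ oJc)/(_ i0) b1 := velocity_smooth xs Ac 1%N.
  exact: (Ck_is_derive (1 : R) b1 (conj It ct : (I `&` x @^-1` cdom c) t)).
have Ou : loc_dom iota c d (cmap c (x t)) by exact: (loc_dom_cmap (conj Ac ct) (conj Ad dt)).
have [_ _ a0] := xg t It c (conj Ac ct).
have := acceleration_along_null oJ Jt H bD; rewrite (a0 d (conj Ad dt)) => /esym/eqP.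
have [f0 _] := phiE Ou.
rewrite scaler_eq0 (negbTE f0) orbF addr_eq0 => /eqP bE.
have [_ _ uD] := H t Jt.
rewrite /state_field /state row_mxKr !pr00 mulNr -bE; apply: is_derive_row_mx => //.
apply/is_derive_mxP => i j; rewrite !ord1.
by under eq_fun do rewrite mxE eqxx mulr1n; rewrite mxE eqxx mulr1n.
Qed.

Lemma state_null_geodesic J (s : R -> 'rV[R]_(1 + n)) : open J -> smooth_on J s ->
  (forall t, J t -> [/\ state_dom (s t), s t 0 0 != 0 & is_derive t 1 s (state_field (s t))]) ->
  let x t := cinv c (rsubmx (s t)) in
  [/\ smooth_curve J x, forall t, J t -> null_geodesic_at iota g x t &
    forall t, J t -> cdom c (x t) /\ state x t = s t].
Proof.
move=> oJ ss H x.
have us : smooth_on J (rsubmx \o s).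
  by move=> k; exact: (Ck_comp oJ openT (fun _ _ => Logic.I) (ss k) (Ck_rsubmx k openT)).
have xc t : J t -> [/\ cdom c (x t), cdom d (iota (x t)) & cmap c (x t) = rsubmx (s t)].
  by move=> /H[+ _ _] => /(loc_dom_cinv Ac Ad)[[_ ?] [_ ?] ?].
have cont t : J t -> {for t, continuous x}.
  move=> Jt; apply: continuous_comp; first exact: (Ck_continuous (us 0%N)).
  by have [ct _ <-] := xc t Jt; apply: cinv_continuous; exists (x t).
have xs : smooth_curve J x.
  split=> // c' Ac' k.
  have oJ' : open (J `&` x @^-1` cdom c') by apply: open_preimage_in => //; exact: cdom_open.
  apply: (Ck_comp oJ' (@transition_open _ _ _ c c') _ _ (transition_smooth Ac Ac' k)).
    move=> t [Jt c't]; have [ct _ <-] := xc t Jt.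
    exact: (transition_dom (conj Ac ct) (conj Ac' c't)).
  by apply: Ck_sub (us k); exact: subIsetl.
have uD t : J t -> is_derive t 1 (cmap c \o x) (s t 0 0 *: e).
  move=> Jt; have [_ _ sD] := H t Jt.
  have := is_derive_rsubmx sD; rewrite row_mxKr.
  apply: near_eq_is_derive; apply: (open_near_eq oJ Jt) => r Jr.
  by have [_ _ <-] := xc r Jr.
have vE t : J t -> velocity c x t = s t 0 0 *: e.
  by move=> Jt; rewrite velocityE; have [_ e1] := uD t Jt.
split=> [//|t Jt|t Jt]; last first.
  have [ct _ uE] := xc t Jt; split=> //.
  by rewrite /state uE vE// !mxE !eqxx mulr1 -prE.
have [ct dt uE] := xc t Jt; have [_ b0 sD] := H t Jt.
apply: (null_geodesic_atI hV oJ xs Jt (conj Ac ct : chart_at (x t) c) (conj Ad dt : chart_at (iota (x t)) d)).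
- by rewrite vE// scaler_eq0 negb_or b0 delta_mx_neq0.
- move=> v; rewrite vE// (differentialZ hV _ _ (conj Ac ct : chart_at (x t) c) (conj Ad dt)) bformZl.
  by rewrite (nullc ct (conj Ad dt)) mulr0.
have H' r : J r -> [/\ cdom c (x r), cdom d (iota (x r)) & is_derive r 1 (cmap c \o x) (s r 0 0 *: e)].
  by move=> Jr; have [? ? _] := xc r Jr; split=> //; exact: uD.
have /is_derive_mxP/(_ 0 0) bD := sD.
apply: (etrans (acceleration_along_null oJ Jt H' bD)).
by rewrite /state_field pr00 uE mulNr addNr scale0r.
Qed.

(** [sol_unique] runs forward on [0, 1]. For each [s] near [t], on either side, the segment from [t]
    to [s] is rescaled to [0, 1], which multiplies the field by s - t. *)
Lemma state_unique I I' x y t : open I -> smooth_curve I x ->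
  (forall t, I t -> null_geodesic_at iota g x t) ->
  open I' -> smooth_curve I' y -> (forall t, I' t -> null_geodesic_at iota g y t) ->
  I t -> I' t -> cdom c (x t) -> cdom d (iota (x t)) ->
  x t = y t -> velocity c x t = velocity c y t ->
  \forall s \near t, x s = y s.
Proof.
move=> oI xs xg oI' ys yg It It' ct dt xy vxy.
pose A := cdom c `&` iota @^-1` cdom d.
have oA : open A by exact: (iota_preimage_open hV).
have [oJ _] := smooth_curve_chart oI xs Ac oA (@subIsetl _ _ _).
have [oJ' _] := smooth_curve_chart oI' ys Ac oA (@subIsetl _ _ _).
have /(open_nbhs_nbhs (A := _)) : open_nbhs t ((I `&` x @^-1` A) `&` (I' `&` y @^-1` A)).
  split; first exact: openI.
  have At : A (x t) by [].
  by split; split=> //; exact: (eq_rect _ A At _ xy).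
move=> /nbhs_ballP[del /= del0 sub]; apply/nbhs_ballP; exists del => //= s ts.
have tr r : unit_itv r -> ball t del (affine (s - t) t r).
  rewrite /unit_itv/= => /andP[r0 r1]; move: ts; rewrite /ball/= /affine => ts.
  rewrite opprD addrCA subrr addr0 normrN normrM distrC; apply: le_lt_trans ts.
  by rewrite ler_piMr// ger0_norm.
have sol z K : open K -> smooth_curve K z -> (forall t, K t -> null_geodesic_at iota g z t) ->
    (forall r, ball t del r -> K r /\ A (z r)) ->
    is_sol state_dom (fun p => (s - t) *: state_field p) (state z \o affine (s - t) t).
  move=> oK zs zg H r r01; have [Kr [cr dr]] := H _ (tr r r01); split.
    rewrite /state_dom/= /state row_mxKr.
    exact: (loc_dom_cmap (conj Ac cr) (conj Ad dr)).
  exact: (is_derive_affine (null_geodesic_state oK zs zg Kr cr dr)).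
have Y1 : Ck 1 state_dom (fun p => (s - t) *: state_field p).
  apply: Ck_scale; [exact: state_dom_open|exact: Ck_cst|exact: state_field_smooth].
have sx := sol x I oI xs xg (fun r Hr => (sub r Hr).1).
have sy := sol y I' oI' ys yg (fun r Hr => (sub r Hr).2).
have := sol_unique state_dom_open Y1 sx sy _ unit1.
rewrite /= /affine mulr1 mulr0 add0r subrK {1 2}/state xy vxy => /(_ erefl) /pr_inj[_ uE].
have [[_ [cx _]] [_ [cy _]]] := sub s ts.
by rewrite -(cmapK cx) -(cmapK cy) uE.
Qed.

Lemma null_geodesic_chart_exists p : cdom c p -> cdom d (iota p) ->
  exists (del : R) x, [/\ 0 < del, null_geodesic iota g (ball (0 : R) del) x, x 0 = p,
    velocity c x 0 = e & forall t, ball (0 : R) del t -> cdom c (x t)].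
Proof.
move=> cp dp; pose z0 : 'rV[R]_(1 + n) := pr 1 (cmap c p).
have Uz0 : state_dom z0.
  by rewrite /state_dom/= row_mxKr; exact: (loc_dom_cmap (conj Ac cp) (conj Ad dp)).
have [D [Phi [oD Ps H0 HD _]]] := flow_exists state_dom_open state_field_smooth.
pose s t : 'rV[R]_(1 + n) := Phi (pr t z0).
have [D0 P0] := H0 z0 Uz0.
have prs k : Ck k setT (fun t : R => pr t z0).
  apply: Ck_row_mx; [exact: openT| |exact: Ck_cst].
  apply/(Ck_rVP _ _ openT) => j; rewrite ord1; under eq_fun do rewrite mxE eqxx mulr1n.
  exact: Ck_id.
have oJ1 : open [set t : R | D (pr t z0)].
  by apply: open_comp oD => t _; exact: (Ck_continuous (prs 0%N)).
have ss : smooth_on [set t : R | D (pr t z0)] s.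
  by move=> k; apply: (Ck_comp oJ1 oD (fun t Dt => Dt) _ (Ps k)); exact: Ck_sub (prs k).
(* The speed is 1 at time 0; times are restricted so that it stays nonzero and the curve regular. *)
have oJ2 : open ([set t : R | D (pr t z0)] `&` (fun t => s t 0 0) @^-1` [set r | r != 0]).
  apply: open_preimage_in; [exact: oJ1|exact: open_neq|move=> t Dt].
  by have /(Ck_rVP _ _ oJ1)/(_ 0) := ss 0%N; move=> /Ck_continuous; exact.
have J20 : ([set t : R | D (pr t z0)] `&` (fun t => s t 0 0) @^-1` [set r | r != 0]) 0.
  by split=> //=; rewrite /s P0 pr00 oner_eq0.
have /nbhs_ballP[del /= del0 sub] := open_nbhs_nbhs (conj oJ2 J20).
have H t : ball (0 : R) del t -> [/\ state_dom (s t), s t 0 0 != 0 & is_derive t 1 s (state_field (s t))].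
  by move=> /sub[Dt st]; have [_ St sD] := HD t z0 Dt; split.
have sB : smooth_on (ball (0 : R) del) s.
  by move=> k; apply: Ck_sub (ss k) => t /sub[].
have oB : open (ball (0 : R) del) by exact: ball_open.
have [xs xg xE] := state_null_geodesic oB sB H.
have B0 : ball (0 : R) del 0 by exact: ballxx.
exists del, (fun t => cinv c (rsubmx (s t))); split=> //.
- split=> //; rewrite ball_itv; exact: interval_is_interval.
- by rewrite /s P0 row_mxKr cmapK.
- have [c0 x0E] := xE 0 B0.
  rewrite null_velocity//; last exact: xg.
  move: x0E; rewrite {2}/s P0 => /pr_inj[-> _]; exact: scale1r.
- by move=> t /xE[].
Qed.

End null_state.

(** * Leaves *)

Section topology.

Lemma hausdorff_closure_eq (T S : topologicalType) (f h : T -> S) (A : set T) t :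
  hausdorff_space S -> {for t, continuous f} -> {for t, continuous h} ->
  closure A t -> (forall s, A s -> f s = h s) -> f t = h t.
Proof.
move=> hS cf ch clA fh; apply: hS => U W fU hW.
have [s [As [Us Ws]]] := clA _ (@filterI _ (nbhs t) _ _ _ (cf U fU) (ch W hW)).
by exists (f s); split; [exact: Us|rewrite fh].
Qed.

Lemma connected_locally_constant (T : topologicalType) (A : set T) (P : T -> Prop) :
  connected A -> (forall x, A x -> \forall y \near x, P y <-> P x) ->
  forall x y, A x -> A y -> P x -> P y.
Proof.
move=> cA H x y Ax Ay Px; pose Q := [set z | P z].
suff AQ : A `&` Q = A by move: Ay; rewrite -AQ => -[].
apply: cA; first by exists x.
  exists Q°; first exact: open_interior.
  apply/seteqP; split=> z [Az Qz]; split=> //; last exact: interior_subset.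
  by apply: filterS (H z Az) => w [_]; exact.
exists (closure Q); first exact: closed_closure.
apply/seteqP; split=> z [Az Qz]; split=> //; first exact: subset_closure.
by have [w [Qw [PQ _]]] := Qz _ (H z Az); exact: PQ.
Qed.

End topology.

(** * Maximal null geodesics and their images *)

Section leaves.
Context {R : realType} {n : nat} (V : manifold R n) (M : manifold R n.+1)
  (iota : V -> M) (g : metric M).
Hypothesis hV : hypersurface iota.
Hypothesis hL : lightlike_for iota g.
Variable i0 : 'I_n.

Implicit Types (x y : R -> V) (I J : set R) (t : R) (b c : chart R V n).

Local Notation ng := (null_geodesic iota g).

Lemma null_geodesic_unique_near I J x y t b : ng I x -> ng J y -> I t -> J t ->
  x t = y t -> chart_at (x t) b -> velocity b x t = velocity b y t ->
  \forall s \near t, x s = y s.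
Proof.
move=> [oI _ xs xg] [oJ _ ys yg] It Jt xy bt vxy.
have [c [z [del [ct _ _ nullc]]]] := null_chart hV hL i0 (x t).
have [d Ad dt] := atlas_cover (iota (x t)).
have [phi phis phiE] := null_acceleration_coefficient hV hL ct.1 Ad nullc.
have by' : chart_at (y t) b by exact: (eq_rect _ (fun q => chart_at q b) bt _ xy).
have cy : chart_at (y t) c by exact: (eq_rect _ (fun q => chart_at q c) ct _ xy).
apply: (state_unique hV hL ct.1 nullc Ad phis phiE oI xs xg oJ ys yg It Jt ct.2 dt xy).
apply: (etrans (velocity_transition oI xs It bt ct)).
apply: (etrans _ (esym (velocity_transition oJ ys Jt by' cy))).
exact: (congr2 (fun v q => 'D_v (transition b c) (cmap b q)) vxy xy).
Qed.

(** The interior of the coincidence set is open and also closed in the common interval. On it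
    velocities agree too, so at a limit point position and velocity agree by continuity, and local
    uniqueness applies again. *)
Lemma null_geodesic_unique I J x y t0 b : ng I x -> ng J y -> I t0 -> J t0 ->
  x t0 = y t0 -> chart_at (x t0) b -> velocity b x t0 = velocity b y t0 ->
  forall t, I t -> J t -> x t = y t.
Proof.
move=> xn yn It0 Jt0 xy0 b0 v0.
have [oI iI xs xg] := xn; have [oJ iJ ys yg] := yn.
pose E := [set s | x s = y s].
have cW : connected (I `&` J).
  apply/connected_intervalP => s r [Is Js] [Ir Jr] z szr.
  by split; [exact: (iI s r)|exact: (iJ s r)].
suff EW : (I `&` J) `&` E° = I `&` J.
  move=> t It Jt; have : (I `&` J) t by [].
  by rewrite -EW => -[_ /interior_subset].
apply: cW.
- by exists t0; split=> //; exact: (null_geodesic_unique_near xn yn It0 Jt0 xy0 b0 v0).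
- by exists E° => //; exact: open_interior.
exists (closure E°); first exact: closed_closure.
apply/seteqP; split=> [t [? ?]|t [[It Jt] clE]]; first by split=> //; exact: subset_closure.
have xyt : x t = y t.
  apply: (@hausdorff_closure_eq R V x y E° t (@mhausdorff _ _ V) (xs.1 t It) (ys.1 t Jt) clE).
  by move=> s /interior_subset.
have [b' Ab bt] := atlas_cover (x t).
have bt' : cdom b' (y t) by exact: (eq_rect _ (cdom b') bt _ xyt).
split=> //; apply: (null_geodesic_unique_near xn yn It Jt xyt (conj Ab bt)).
have cv z K : smooth_curve K z -> K t -> cdom b' (z t) -> {for t, continuous (velocity b' z)}.
  by move=> zs Kt bz; exact: (Ck_continuous (velocity_smooth zs Ab 0%N) (conj Kt bz : (K `&` z @^-1` cdom b') t)).
apply: (hausdorff_closure_eq (@norm_hausdorff _ _) (cv x I xs It bt) (cv y J ys Jt bt') clE).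
move=> s Es; apply: (velocity_germ b' (@open_interior _ E) Es) => r.
exact: interior_subset.
Qed.

(** The common time [t0] is what makes the union of the intervals an interval. *)
Lemma null_geodesic_glue (T : Type) (P : set T) (I : T -> set R) (x : T -> R -> V) t0 :
  P !=set0 -> (forall i, P i -> ng (I i) (x i) /\ I i t0) ->
  (forall i j, P i -> P j -> forall t, I i t -> I j t -> x i t = x j t) ->
  exists X, ng (\bigcup_(i in P) I i) X /\ forall i t, P i -> I i t -> X t = x i t.
Proof.
move=> [i1 Pi1] H xE.
have /choice[X XE] t : exists v, forall i, P i -> I i t -> v = x i t.
  have [[j [Pj jt]]|no] := pselect (exists j, P j /\ I j t).
    by exists (x j t) => i Pi it; exact: xE.
  by exists (x i1 t) => i Pi it; case: no; exists i.
exists X; split=> [|i t Pi it]; last exact: XE.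
have oU : open (\bigcup_(i in P) I i).
  by apply: bigcup_open => i /H[[]].
split=> //.
- apply/connected_intervalP/bigcup_connected.
    by exists t0 => i /H[].
  by move=> i /H[[_ /connected_intervalP]].
- apply: smooth_curve_local => t [i Pi it]; have [[oI _ xs _] _] := H i Pi.
  by exists (I i), (x i); split=> // s; exact: XE.
- move=> t [i Pi it]; have [[oI _ xs xg] _] := H i Pi.
  apply: (null_geodesic_at_germ oI it _ (xg t it)) => s Is.
  by rewrite (XE s i).
Qed.

Lemma null_geodesic_exists p c : chart_at p c ->
  (forall q, cdom c q -> null_at iota g c q (delta_mx 0 i0)) ->
  exists (del : R) x, [/\ 0 < del, ng (ball (0 : R) del) x, x 0 = p,
    velocity c x 0 = delta_mx 0 i0 & forall t, ball (0 : R) del t -> cdom c (x t)].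
Proof.
move=> cp nullc; have [d Ad dp] := atlas_cover (iota p).
have [phi phis phiE] := null_acceleration_coefficient hV hL cp.1 Ad nullc.
exact: (null_geodesic_chart_exists hV hL cp.1 nullc Ad phis phiE cp.2 dp).
Qed.

(** Stated with arbitrary null geodesics from [p]; [leaf_curve] shows that a single maximal one
    covers them all. *)
Definition leaf p : set V := [set q | exists I x t, [/\ ng I x, I 0, x 0 = p, I t & x t = q]].

(** The curve is the union of all null geodesics from [p] with one prescribed initial velocity, any
    two of which agree. Maximality is stated for images, because a null geodesic that meets the
    curve agrees with it only after an affine change of parameter. *)
Lemma maximal_null_geodesic p : exists I x, [/\ ng I x, I 0, x 0 = p &
  forall J y s t, ng J y -> J s -> I t -> y s = x t -> y @` J `<=` x @` I].
Proof.
have [c0 [z [del [c0p _ _ nullc]]]] := null_chart hV hL i0 p.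
have [e0 [y0 [e00 y0n y00 v0 _]]] := null_geodesic_exists c0p nullc.
pose P := [set i : set R * (R -> V) | [/\ ng i.1 i.2, i.1 0, i.2 0 = p &
  velocity c0 i.2 0 = delta_mx 0 i0]].
have [||i j [ni i00 ip vi] [nj j0 jp vj] t it jt|X [Xn XE]] :=
    @null_geodesic_glue _ P fst snd 0.
- by exists (ball (0 : R) e0, y0); split=> //; exact: ballxx.
- by move=> i [].
- have ip' : chart_at (i.2 0) c0 by rewrite ip.
  exact: (null_geodesic_unique ni nj i00 j0 (etrans ip (esym jp)) ip' (etrans vi (esym vj)) it jt).
set I := \bigcup_(i in P) i.1 in Xn.
have P0 : P (ball (0 : R) e0, y0) by split=> //; exact: ballxx.
have I0 : I 0 by exists (ball (0 : R) e0, y0) => //; exact: ballxx.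
have X0 : X 0 = p by rewrite (XE _ _ P0)//; exact: ballxx.
have vX : velocity c0 X 0 = delta_mx 0 i0.
  have oB : open (ball (0 : R) e0) by exact: ball_open.
  apply: etrans v0; apply: (velocity_germ c0 oB (ballxx (0 : R) e00)) => s Bs.
  exact: (XE _ s P0 Bs).
exists I, X; split=> // J y s t yn Js It yX.
have [oI _ Xs Xg] := Xn; have [oJ _ ys yg] := yn.
have [b Ab bX] := atlas_cover (X t); have [d Ad dX] := atlas_cover (iota (X t)).
have bp : chart_at (X t) b by []. have dp : chart_at (iota (X t)) d by [].
have by' : chart_at (y s) b by exact: (eq_rect _ (fun q => chart_at q b) bp _ (esym yX)).
have [vX0 nX _] := Xg t It b bp; have [vy0 ny _] := yg s Js b by'.
have ny' : null_at iota g b (X t) (velocity b y s).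
  exact: (eq_rect _ (fun q => null_at iota g b q (velocity b y s)) ny _ yX).
have [k kE] := null_parallel hV hL bp dp vy0 (ny' d dp) (nX d dp).
have k0 : k != 0 by apply: contra_neq vX0 => k0; rewrite kE k0 scale0r.
(* With slope [k] and offset [a], the reparametrized [y] passes through the meeting point at time
   [t] with the velocity of [X]. *)
pose a := s - k * t; have at_ : affine k a t = s by rewrite /affine /a addrC subrK.
have zn := null_geodesic_affine hV a k0 yn.
have Jt : J (affine k a t) by rewrite at_.
have ybt : chart_at (y (affine k a t)) b by rewrite at_.
have vz : velocity b X t = velocity b (y \o affine k a) t.
  apply: (etrans kE); apply/esym/(etrans (velocity_affine oJ ys Jt ybt)).
  by rewrite at_.
have Xz : forall r, I r -> J (affine k a r) -> X r = y (affine k a r).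
  move=> r Ir Jr; apply: (null_geodesic_unique Xn zn It Jt _ bp vz Ir Jr).
  by rewrite /= at_ yX.
pose II (i : bool) := if i then I else affine k a @^-1` J.
pose XX (i : bool) := if i then X else y \o affine k a.
have [||i j _ _ r|w [wn wE]] := @null_geodesic_glue bool setT II XX t.
- by exists true.
- by case.
- by case: i; case: j => //= Ir Jr; [exact: Xz|rewrite (Xz r)].
have W0 : (\bigcup_(i in setT) II i) 0 by exists true.
(* The glued curve is again a member of [P], so its interval lies in [I], the union over [P]. *)
have PW : P (\bigcup_(i in setT) II i, w).
  split=> //=; first by rewrite (wE true).
  apply: etrans vX; apply: (velocity_germ c0 oI I0) => r Ir.
  exact: (wE true).
move=> _ [r Jr <-]; pose r' := (r - a) / k.
have rr' : affine k a r' = r by rewrite /affine /r' mulrC divfK// subrK.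
have Wr' : (\bigcup_(i in setT) II i) r' by exists false => //=; rewrite /preimage/= rr'.
exists r'; first by exists (\bigcup_(i in setT) II i, w).
by rewrite (XE _ _ PW Wr') /= (wE false)//= /preimage/= rr'.
Qed.

Lemma leaf_curve p : exists I x, [/\ ng I x, I 0, leaf p = x @` I &
  forall J y s t, ng J y -> J s -> I t -> y s = x t -> y @` J `<=` x @` I].
Proof.
have [I [x [xn I0 x0 H]]] := maximal_null_geodesic p; exists I, x; split=> //.
apply/seteqP; split=> [q [J [y [t [yn J0 y0 Jt <-]]]]|_ [t It <-]].
  by apply: (H J y 0 0 yn J0 I0); [rewrite y0 x0|exists t].
by exists I, x, t.
Qed.

Lemma leaf_refl p : leaf p p.
Proof. by have [I [x [xn I0 x0 _]]] := maximal_null_geodesic p; exists I, x, 0. Qed.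

(** The maximal curves from [p] and from [q] both pass through [q], so each image contains the
    other. *)
Lemma leaf_eq p q : leaf p q -> leaf q = leaf p.
Proof.
have [I [x [xn I0 -> xmax]]] := leaf_curve p; move=> [t It xt].
have [J [y [yn J0 lq ymax]]] := leaf_curve q.
have : leaf q q by exact: leaf_refl.
rewrite lq => -[s Js ys]; apply/seteqP; split.
  by apply: (xmax J y s t) => //; rewrite ys xt.
by apply: (ymax I x t s) => //; rewrite ys xt.
Qed.

Lemma leaf_connected p : connected (leaf p).
Proof.
have [I [x [[oI iI [xc _] _] _ -> _]]] := leaf_curve p.
apply: connected_continuous_connected; first exact/connected_intervalP.
apply: continuous_in_subspaceT => t; rewrite inE; exact: xc.
Qed.

End leaves.

(** * The foliation *)

Section real_line.
Context {R : realType}.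

(** A nondegenerate interval has positive Lebesgue measure, a countable set has measure 0. *)
Lemma countable_connected (A : set R) : connected A -> countable A ->
  forall a b, A a -> A b -> a = b.
Proof.
move=> /connected_intervalP iA cA.
wlog ab : / forall a b, A a -> A b -> ~ a < b.
  apply=> a b Aa Ab ab; have cI : countable [set` `[a, b]].
    apply: sub_countable cA; apply: subset_card_le => z /=.
    by rewrite in_itv/= => zab; exact: (iA a b).
  have := countable_lebesgue_measure0 cI.
  rewrite lebesgue_measure_itv/= lte_fin ab -EFinB => /eqP.
  by rewrite eqe subr_eq0 => /eqP ba; move: ab; rewrite ba ltxx.
by move=> a b Aa Ab; case: (ltgtP a b) => // /ab; [case/(_ Aa Ab)|case/(_ Ab Aa)].
Qed.

(** The derivative is known at 0 only: it puts h (- m) below h 0 and h m above it, and the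
    intermediate value theorem fills the gap. *)
Lemma positive_derivative_image (h : R -> R) del : 0 < del ->
  (forall t, ball (0 : R) del t -> {for t, continuous h}) ->
  is_derive (0 : R) 1 h 1 ->
  \forall v \near h 0, exists2 t, ball (0 : R) del t & h t = v.
Proof.
move=> del0 hc [hd hE].
have : \forall s \near (0 : R)^', 0 < s^-1 *: ((h \o shift 0) (s *: 1) - h 0).
  have /cvgrPdist_lt/(_ 1 ltr01) := hd; rewrite -/('D_1 h 0) hE.
  apply: filterS => s; rewrite ltr_norml => /andP[_].
  by rewrite ltrBlDl ltrDr.
rewrite near_withinE => /nbhs_ballP[e /= e0 He].
pose m := Num.min (del / 2) (e / 2).
have m0 : 0 < m by rewrite lt_min !divr_gt0.
have mdel : m < del by rewrite gt_min ltr_pdivrMr// mulr_natr mulr2n ltrDl del0.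
have me : m < e by rewrite gt_min [X in _ || X]ltr_pdivrMr// mulr_natr mulr2n ltrDl e0 orbT.
have sgn s : `|s| = m -> 0 < s^-1 * (h s - h 0).
  move=> sm; have := He s; rewrite /ball/= sub0r normrN sm => /(_ me).
  rewrite [s *: 1]mulr1 addr0; apply.
  by rewrite -normr_gt0 sm.
have hm : h 0 < h m.
  by have := sgn m (gtr0_norm m0); rewrite pmulr_rgt0 ?invr_gt0// subr_gt0.
have hNm : h (- m) < h 0.
  have := sgn (- m); rewrite normrN gtr0_norm// => /(_ erefl).
  by rewrite invrN mulNr -mulrN opprB pmulr_rgt0 ?invr_gt0// subr_gt0.
have bm t : t \in `[- m, m] -> ball (0 : R) del t.
  rewrite in_itv/= => tm; rewrite /ball/= sub0r normrN.
  by apply: le_lt_trans mdel; rewrite ler_norml.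
have : \forall v \near h 0, v \in `]h (- m), h m[ by apply: near_in_itvoo; rewrite in_itv/= hNm.
apply: filterS => v; rewrite in_itv/= => /andP[v1 v2].
have mm : - m <= m by rewrite (le_trans _ (ltW m0))// oppr_le0 ltW.
have hc' : {within `[- m, m], continuous h}.
  by apply: continuous_in_subspaceT => t; rewrite inE => /bm; exact: hc.
have [|t /bm Bt <-] := IVT mm hc' (v := v); last by exists t.
have hh := ltW (lt_trans hNm hm).
by rewrite (min_idPl hh) (max_idPr hh) !ltW.
Qed.

End real_line.

Section foliation.
Context {R : realType} {n : nat} (V : manifold R n) (M : manifold R n.+1)
  (iota : V -> M) (g : metric M).
Hypothesis hV : hypersurface iota.
Hypothesis hL : lightlike_for iota g.
Variable i0 : 'I_n.

Implicit Types (x y : R -> V) (I J : set R) (t : R).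
Local Notation ng := (null_geodesic iota g).
Local Notation leaf := (leaf iota g).

Variables (c : chart R V n) (z : 'rV[R]_n) (del : R).
Hypothesis Ac : atlas c.
Hypothesis del0 : 0 < del.
Hypothesis cE : cimg c = ball z del.
Hypothesis nullc : forall q, cdom c q -> null_at iota g c q (delta_mx 0 i0).

Definition slice q : set V :=
  [set r | cdom c r /\ forall i, i != i0 -> cmap c r 0 i = cmap c q 0 i].

Definition slice_line q (s : R) : 'rV[R]_n := \row_i (if i == i0 then s else cmap c q 0 i).

(** The chart image is a sup-norm ball, a product of intervals, so one coordinate may range over its
    whole interval with the others fixed. *)
Lemma slice_line_img q s : cdom c q -> ball (z 0 i0) del s -> cimg c (slice_line q s).
Proof.
move=> cq zs; have : cimg c (cmap c q) by exists q.
rewrite cE => -[_ qz]; split=> // i j; rewrite mxE !ord1.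
by case: eqP => [->|_]; [exact: zs|exact: qz].
Qed.

Lemma slice_lineK q s : cdom c q -> ball (z 0 i0) del s ->
  cdom c (cinv c (slice_line q s)) /\ cmap c (cinv c (slice_line q s)) = slice_line q s.
Proof.
by move=> cq zs; have [r cr rE] := slice_line_img cq zs; rewrite -rE cmapK.
Qed.

Lemma slice_lineE q r : cdom c q -> slice q r ->
  ball (z 0 i0) del (cmap c r 0 i0) /\ r = cinv c (slice_line q (cmap c r 0 i0)).
Proof.
move=> cq [cr rq]; split.
  by have : cimg c (cmap c r); [exists r|rewrite cE => -[_]; exact].
rewrite -[LHS](cmapK cr); congr (cinv c _); apply/rowP => i; rewrite mxE.
by case: eqP => [->//|/eqP /rq].
Qed.

Lemma slice_imageE q : cdom c q -> slice q = (cinv c \o slice_line q) @` ball (z 0 i0) del.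
Proof.
move=> cq; apply/seteqP; split=> [r Hr|_ [s zs <-]].
  by have [zr rE] := slice_lineE cq Hr; exists (cmap c r 0 i0).
have [cs sE] := slice_lineK cq zs; split=> //= i ii0.
by rewrite sE mxE (negbTE ii0).
Qed.

Lemma slice_connected q : cdom c q -> connected (slice q).
Proof.
move=> cq; rewrite slice_imageE//; apply: connected_continuous_connected.
  by apply/connected_intervalP; rewrite ball_itv; exact: interval_is_interval.
apply: continuous_in_subspaceT => s; rewrite inE => zs.
apply: continuous_comp; last by apply: cinv_continuous; exact: slice_line_img.
apply/continuous_mxP => i j.
have -> : (fun s => slice_line q s i j) = if j == i0 then id else cst (cmap c q 0 j).
  by apply/funext => s'; rewrite mxE; case: eqP.
by case: eqP => _; [exact: cvg_id|exact: cvg_cst].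
Qed.

(** The null geodesic that starts along the coordinate vector [i0] stays in the slice, and its
    coordinate [i0] has derivative 1 at time 0, so it covers the slice near its starting point. *)
Lemma slice_leaf_near q s : cdom c q -> ball (z 0 i0) del s ->
  \forall s' \near s, leaf (cinv c (slice_line q s)) (cinv c (slice_line q s')).
Proof.
move=> cq zs; have [cp pE] := slice_lineK cq zs; set p := cinv c (slice_line q s) in cp pE *.
have [e [x [e0 xn x0 v0 xc]]] := null_geodesic_exists hV hL (conj Ac cp : chart_at p c) nullc.
have [oI iI xs xg] := xn; have B0 : ball (0 : R) e 0 by exact: ballxx.
pose h t := cmap c (x t) 0 i0.
have hs : s = h 0 by rewrite /h x0 pE mxE eqxx.
have hc t : ball (0 : R) e t -> {for t, continuous h}.
  move=> et; have [uc _] := curve_is_derive oI xs et (conj Ac (xc t et)).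
  have : {for t, continuous (cmap c \o x)} by exact/differentiable_continuous/derivable1_diffP.
  by move=> /continuous_mxP/(_ 0 i0).
have hD : is_derive (0 : R) 1 h 1.
  have /is_derive_mxP/(_ 0 i0) := curve_is_derive oI xs B0 (conj Ac (xc 0 B0)).
  by rewrite v0 !mxE !eqxx.
suff : \forall v \near h 0, leaf p (cinv c (slice_line q v)) by rewrite -hs.
apply: filterS (positive_derivative_image e0 hc hD) => _ [t et <-].
exists (ball (0 : R) e), x, t; split=> //.
rewrite -[LHS](cmapK (xc t et)); congr (cinv c _); apply/rowP => i; rewrite mxE.
case: eqP => [->//|/eqP ii0].
have H r : ball (0 : R) e r -> cdom c (x r) /\ null_geodesic_at iota g x r.
  by move=> er; split; [exact: xc|exact: xg].
rewrite (null_transversal hV hL Ac nullc oI iI xs H B0 et ii0).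
by rewrite x0 pE mxE (negbTE ii0).
Qed.

(** Membership in the leaf is locally constant along the interval that parametrizes the slice. *)
Lemma slice_sub_leaf p q : leaf p q -> cdom c q -> slice q `<=` leaf p.
Proof.
move=> pq cq r /(slice_lineE cq)[zr ->].
have sq : slice q q by [].
have [zq qE] := slice_lineE cq sq.
apply: (@connected_locally_constant R (ball (z 0 i0) del)
  (fun s => leaf p (cinv c (slice_line q s))) _ _ _ _ zq zr).
- by apply/connected_intervalP; rewrite ball_itv; exact: interval_is_interval.
- move=> s zs; apply: filterS (slice_leaf_near cq zs) => s' ss'; split=> H.
    by rewrite -(leaf_eq hV hL i0 H) (leaf_eq hV hL i0 ss'); exact: (leaf_refl hV hL i0).
  by rewrite -(leaf_eq hV hL i0 H).
- by rewrite -qE.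
Qed.

(** Each visit of the curve to the chart lasts an open interval of times, which contains a rational,
    and transversal coordinates are constant during a visit: every value is attained at a rational
    time. *)
Lemma leaf_transversal_countable p i : i != i0 ->
  countable ((fun r => cmap c r 0 i) @` (leaf p `&` cdom c)).
Proof.
move=> ii0; have [I [x [xn _ -> _]]] := leaf_curve hV hL i0 p.
have [oI _ xs xg] := xn.
apply: (@sub_countable _ _ _ ((fun k : rat => cmap c (x (ratr k)) 0 i) @` setT)); last first.
  by apply: sub_countable (card_image_le _ _) _; exact: countableP.
apply: subset_card_le => _ [_ [[t It <-] ct] <-].
have oJ := @curve_dom_open _ _ _ _ _ c oI xs.
have /nbhs_ballP[e /= e0 sub] := open_nbhs_nbhs (conj oJ (conj It ct : (I `&` x @^-1` cdom c) t)).
have tte : t - e < t + e by rewrite ltrD2l gtrN.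
have [k ktE] := rat_in_itvoo tte; exists k => //.
have bk : ball t e (ratr k) by rewrite ball_itv/= in_itv/=; move: ktE; rewrite in_itv.
have ibt : is_interval (ball t e) by rewrite ball_itv; exact: interval_is_interval.
have sB : smooth_curve (ball t e) x.
  have [xc xk] := xs; split=> [s /sub[Is _]|d Ad l]; first exact: xc.
  by apply: Ck_sub (xk d Ad l) => s [/sub[Is _] ds].
have H s : ball t e s -> cdom c (x s) /\ null_geodesic_at iota g x s.
  by move=> /sub[Is cs]; split=> //; exact: xg.
have oB : open (ball t e) by exact: ball_open.
exact: (null_transversal hV hL Ac nullc oB ibt sB H (ballxx t e0) bk ii0).
Qed.
(** A transversal coordinate maps the component to a connected countable set of reals, hence to a
    point. *)
Lemma leaf_slice p q : (leaf p `&` cdom c) q ->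
  connected_component (leaf p `&` cdom c) q = slice q.
Proof.
move=> pq; have [lq cq] := pq; apply/seteqP; split; last first.
  apply: connected_component_max; [by []| |exact: slice_connected].
  by move=> r Hr; split; [exact: (slice_sub_leaf lq cq Hr)|exact: Hr.1].
move=> r Kr; have sub := @connected_component_sub _ (leaf p `&` cdom c) q.
split=> [|i ii0]; first exact: (sub _ Kr).2.
apply: (@countable_connected _ ((fun r => cmap c r 0 i) @` connected_component (leaf p `&` cdom c) q)).
- apply: connected_continuous_connected; first exact: component_connected.
  apply: continuous_in_subspaceT => w; rewrite inE => /sub[_ cw].
  by have /continuous_mxP/(_ 0 i) := cmap_continuous cw.
- apply: sub_countable (leaf_transversal_countable p ii0).
  by apply: subset_card_le; exact: image_subset.
- by exists r.
- by exists q => //; exact: connected_component_refl.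
Qed.

End foliation.

(** With zero acceleration the factor in [geodesic] is 0; isotropy is the null condition applied to
    the velocity itself. *)
Lemma null_geodesic_isotropic (R : realType) n (V : manifold R n) (M : manifold R n.+1)
    (C : CO_structure M) (iota : V -> M) (g : metric M) I x :
  hypersurface iota -> CO_metrics C g -> null_geodesic iota g I x ->
  isotropic_geodesic C I (iota \o x).
Proof.
move=> hV Cg [oI _ xs xg]; exists g => //.
have vE t d b : I t -> chart_at (iota (x t)) d -> chart_at (x t) b ->
    velocity d (iota \o x) t = differential iota b d (x t) (velocity b x t).
  by move=> It dt bt; exact: (velocity_iota hV oI xs It bt dt).
split; first split.
- split=> [|t d It dt]; first exact: smooth_curve_iota.
  have [b Ab bt] := atlas_cover (x t); have bx : chart_at (x t) b by [].
  rewrite (vE t d b It dt bx); have [v0 _ _] := xg t It b bx.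
  apply: contra_neq v0 => d0; have [_ _ inj] := hV.
  apply: (inj _ _ _ bx dt); rewrite d0.
  by have := differentialZ hV 0 0 bx dt; rewrite !scale0r.
- exists (cst 0) => t d It dt; rewrite scale0r.
  have [b Ab bt] := atlas_cover (x t).
  by have [_ _] := xg t It b (conj Ab bt); apply.
- move=> t d It dt; have [b Ab bt] := atlas_cover (x t); have bx : chart_at (x t) b by [].
  rewrite /isotropic_cone/= (vE t d b It dt bx); have [_ nv _] := xg t It b bx.
  exact: nv.
Qed.

Lemma conformal_refl (R : realType) n (M : manifold R n) (g : metric M) : conformal g g.
Proof.
exists (cst 1); split=> // [c _ k|c x _]; last by rewrite scale1r.
exact: Ck_cst.
Qed.

Theorem theorem3 (R : realType) (n : nat) (M : manifold R n.+1)
    (C : CO_structure M) (V : manifold R n) (iota : V -> M)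
    (hV : hypersurface iota) (hL : lightlike C iota) :
  exists F : set (set V), foliation_by_curves F /\
    forall L, F L -> exists (I : set R) (x : R -> V),
      [/\ open_interval I, smooth_curve I x, L = x @` I &
          isotropic_geodesic C I (iota \o x)].
Proof.
have [g _ gC] := CO_class C; have Cg : CO_metrics C g by apply/gC; exact: conformal_refl.
have hLg : lightlike_for iota g by move=> p b c; exact: hL.
(* For n = 0 a lightlike [V] is empty, since [null_line] would give a nonzero vector of R^0; the
   empty family of leaves then works. *)
have [n0|n_gt0] := posnP n.
  have noV (p : V) : False.
    have [b Ab bp] := atlas_cover p; have [d Ad dp] := atlas_cover (iota p).
    have [w0 [/negP[]]] := null_line hV hLg (conj Ab bp : chart_at p b) (conj Ad dp).
    by apply/eqP/rowP => i; have := ltn_ord i; rewrite {2}n0.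
  by exists set0; split=> //; split=> // p; case: (noV p).
(* Coordinate 0 is the leaf direction in [foliation_by_curves]. *)
pose i0 := Ordinal n_gt0; exists (range (leaf iota g)); split; last first.
  move=> _ [p _ <-]; have [I [x [xn I0 -> _]]] := leaf_curve hV hLg i0 p.
  have [oI iI xs _] := xn; exists I, x; split=> //; last exact: null_geodesic_isotropic xn.
  by split=> //; exists 0.
split=> [p|_ [p _ <-]|p].
- exists (leaf iota g p); split=> [|_ [[q _ <-] qp]]; last exact: (leaf_eq hV hLg i0 qp).
  by split; [exists p|exact: (leaf_refl hV hLg i0)].
- by split; [exists p; exact: (leaf_refl hV hLg i0)|exact: (leaf_connected hV hLg i0)].
have [c [z [e [cp e0 cE nullc]]]] := null_chart hV hLg i0 p.
exists c => // _ q [r _ <-] qr; rewrite (leaf_slice hV hLg cp.1 e0 cE nullc qr).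
have iE (i : 'I_n) : (i != i0) = (0 < i)%N by rewrite -val_eqE /= lt0n.
by apply/seteqP; split=> w [cw H]; split=> // i ii; apply: H; rewrite ?iE// -iE.
Qed.
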